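(* Let $\{g_i\}_{i\in\mathbb N}$ be a sequence of smooth Riemannian metrics on $\mathbb S^2\times\mathbb S^1$ of the form $g_i=\varphi_i^{-2}h_i+\varphi_i^2\,d\xi^2$, with $h_i=dr^2+u_i^2(r)\,d\theta^2$ on $\mathbb S^2$, $r\in[0,a_i]$ (see context), satisfying for constants $V_0>0$ and $A_0>0$ independent of $i$: $\mathrm{Scalar}_{g_i}\ge 0$, $\mathrm{Vol}_{g_i}(\mathbb S^2\times\mathbb S^1)\le V_0$ and $\mathrm{MinA}(\mathbb S^2\times\mathbb S^1,g_i)\ge A_0$. Then there exists a positive constant $C$, depending only on $V_0$ and $A_0$, such that $$C^{-1}\le \mathrm{Diam}_{h_i}(\mathbb S^2)=a_i\le C\qquad\text{for all } i\in\mathbb N .$$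
   Context: Metric form: $g_i=\varphi_i^{-2}h_i+\varphi_i^2d\xi^2$ with $\xi\in[0,2\pi]$ the coordinate on $\mathbb S^1$, $\varphi_i\in C^\infty(\mathbb S^2)$, $\varphi_i>0$ (a function of $(r,\theta)$, independent of $\xi$), and $h_i=dr^2+u_i^2(r)d\theta^2$, $r\in[0,a_i]$, $\theta\in[0,2\pi]$, a smooth rotationally symmetric metric on $\mathbb S^2$; here $u_i\in C^\infty([0,a_i])$, $u_i>0$ on $(0,a_i)$, $u_i(0)=u_i(a_i)=0$, $u_i'(0)=1$, $u_i'(a_i)=-1$. $\mathrm{MinA}(M,g):=\inf\{\mathrm{Area}_g(\Sigma)\mid \Sigma\text{ is a closed minimal surface in }(M,g)\}$. $\mathrm{Scalar}_g$ denotes scalar curvature. *)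

(* Defs.v *)
From HB Require Import structures.
From mathcomp Require Import all_boot all_order all_algebra.
From mathcomp Require Import all_classical all_reals all_analysis.

Set Implicit Arguments.
Unset Strict Implicit.
Unset Printing Implicit Defensive.

Import Order.TTheory GRing.Theory Num.Theory.
Import numFieldNormedType.Exports.

Local Open Scope classical_set_scope.
Local Open Scope ring_scope.

(* Manifolds are embedded submanifolds S of a Euclidean space 'rV[R]_n.
   Vectors are rows, as for the library's Jacobian: 'D_v f x = v *m 'J f x,
   so the i-th row of 'J f x is the i-th partial derivative of f. *)

Section Smoothness.
Context {R : realType} {V W : normedModType R}.

Definition iter_derive (s : seq V) (f : V -> W) : V -> W :=
  foldr (fun v g x => 'D_v g x) f s.

Definition smooth_open (U : set V) (f : V -> W) : Prop :=
  forall (s : seq V) (x : V), U x -> differentiable (iter_derive s f) x.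

(* C^oo on an arbitrary subset, through local C^oo extensions. *)
Definition smooth (S : set V) (f : V -> W) : Prop :=
  forall x, S x -> exists (U : set V) (F : V -> W),
    [/\ open U, U x, smooth_open U F & forall y, S y -> U y -> F y = f y].

End Smoothness.

Section Submanifolds.
Context {R : realType}.

(* A local parametrization of S of dimension m: an immersion of the open set
   U into 'rV_n that is a homeomorphism onto a relatively open subset of S. *)
Definition local_param (m n : nat) (S : set 'rV[R]_n) (U : set 'rV[R]_m)
    (psi : 'rV[R]_m -> 'rV[R]_n) : Prop :=
  [/\ open U,
      smooth_open U psi,
      forall x, U x -> row_free ('J psi x),
      {in U &, injective psi} &
      forall B : set 'rV[R]_m, open B -> B `<=` U ->
        exists O : set 'rV[R]_n, open O /\ psi @` B = S `&` O].

Definition submanifold (m n : nat) (S : set 'rV[R]_n) : Prop :=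
  forall p, S p -> exists (U : set 'rV[R]_m) (psi : 'rV[R]_m -> 'rV[R]_n),
    local_param S U psi /\ (psi @` U) p.

(* A field G of bilinear forms on the ambient space, (v, w) |-> v G(p) w^T;
   only its restriction to the tangent spaces of S is ever used.
   [pullback G psi x] is the Gram matrix of the coordinate vectors at x. *)
Definition pullback (m n : nat) (G : 'rV[R]_n -> 'M[R]_n)
    (psi : 'rV[R]_m -> 'rV[R]_n) (x : 'rV[R]_m) : 'M[R]_m :=
  'J psi x *m G (psi x) *m ('J psi x)^T.

Definition riemannian_metric (m n : nat) (S : set 'rV[R]_n)
    (G : 'rV[R]_n -> 'M[R]_n) : Prop :=
  [/\ smooth S G,
      forall p, S p -> (G p)^T = G p &
      forall (U : set 'rV[R]_m) (psi : 'rV[R]_m -> 'rV[R]_n),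
        local_param S U psi -> forall x, U x -> forall v : 'rV[R]_m,
        v != 0 -> 0 < (v *m pullback G psi x *m v^T) 0 0].

End Submanifolds.

Section Curvature.
Context {R : realType}.

Definition partial (m : nat) (W : normedModType R) (i : 'I_m)
    (f : 'rV[R]_m -> W) (x : 'rV[R]_m) : W :=
  'D_(delta_mx 0 i : 'rV[R]_m) f x.

(* Gamma^k_(ij) of the metric coefficients gam *)
Definition christoffel (m : nat) (gam : 'rV[R]_m -> 'M[R]_m)
    (k i j : 'I_m) (x : 'rV[R]_m) : R :=
  2^-1 * \sum_(l < m) invmx (gam x) k l *
    (partial i (fun y => gam y j l) x + partial j (fun y => gam y i l) x
     - partial l (fun y => gam y i j) x).

(* The component R^l_(kij) of R(d_i, d_j) d_k, with the convention
   R(X, Y) = [nabla_X, nabla_Y] - nabla_[X, Y]. *)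
Definition riemann (m : nat) (gam : 'rV[R]_m -> 'M[R]_m)
    (l k i j : 'I_m) (x : 'rV[R]_m) : R :=
  partial i (christoffel gam l j k) x - partial j (christoffel gam l i k) x
  + \sum_(s < m) (christoffel gam l i s x * christoffel gam s j k x
                  - christoffel gam l j s x * christoffel gam s i k x).

Definition ricci (m : nat) (gam : 'rV[R]_m -> 'M[R]_m)
    (j k : 'I_m) (x : 'rV[R]_m) : R :=
  \sum_(i < m) riemann gam i k i j x.

Definition scalar_curvature (m : nat) (gam : 'rV[R]_m -> 'M[R]_m)
    (x : 'rV[R]_m) : R :=
  \sum_(j < m) \sum_(k < m) invmx (gam x) j k * ricci gam j k x.

Definition scalar_ge0 (m n : nat) (S : set 'rV[R]_n)
    (G : 'rV[R]_n -> 'M[R]_n) : Prop :=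
  forall (U : set 'rV[R]_m) (psi : 'rV[R]_m -> 'rV[R]_n),
    local_param S U psi ->
    forall x, U x -> 0 <= scalar_curvature (pullback G psi) x.

(* Below, f immerses a k-dimensional parameter domain in a coordinate domain
   with metric coefficients gam.
   The covariant derivative nabla_(d_a f) (d_b f): *)
Definition cov_partial (k m : nat) (gam : 'rV[R]_m -> 'M[R]_m)
    (f : 'rV[R]_k -> 'rV[R]_m) (a b : 'I_k) (x : 'rV[R]_k) : 'rV[R]_m :=
  partial a (partial b f) x +
  \row_l \sum_(i < m) \sum_(j < m)
    christoffel gam l i j (f x) * partial a f x 0 i * partial b f x 0 j.

(* The trace of the second fundamental form in the direction nu. *)
Definition mean_curvature (k m : nat) (gam : 'rV[R]_m -> 'M[R]_m)
    (f : 'rV[R]_k -> 'rV[R]_m) (x : 'rV[R]_k) (nu : 'rV[R]_m) : R :=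
  \sum_(a < k) \sum_(b < k) invmx (pullback gam f x) a b *
    (cov_partial gam f a b x *m gam (f x) *m nu^T) 0 0.

Definition normal_to (k m : nat) (gam : 'rV[R]_m -> 'M[R]_m)
    (f : 'rV[R]_k -> 'rV[R]_m) (x : 'rV[R]_k) (nu : 'rV[R]_m) : Prop :=
  'J f x *m gam (f x) *m nu^T = 0.

(* Sigma, of dimension k, is minimal in the m-dimensional manifold (S, G):
   its mean curvature, computed in coordinates psi of S and with a
   parametrization psi \o f of Sigma, vanishes at each of its points. *)
Definition minimal (k m n : nat) (S : set 'rV[R]_n) (G : 'rV[R]_n -> 'M[R]_n)
    (Sigma : set 'rV[R]_n) : Prop :=
  forall p, Sigma p ->
    exists (U : set 'rV[R]_m) (psi : 'rV[R]_m -> 'rV[R]_n)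
           (V : set 'rV[R]_k) (f : 'rV[R]_k -> 'rV[R]_m) (x : 'rV[R]_k),
      [/\ local_param S U psi,
          smooth_open V f /\ f @` V `<=` U,
          local_param Sigma V (psi \o f),
          V x /\ psi (f x) = p &
          forall nu, normal_to (pullback G psi) f x nu ->
            mean_curvature (pullback G psi) f x nu = 0].

Definition closed_minimal_surface (n : nat) (S : set 'rV[R]_n)
    (G : 'rV[R]_n -> 'M[R]_n) (Sigma : set 'rV[R]_n) : Prop :=
  [/\ Sigma !=set0, compact Sigma, Sigma `<=` S,
      submanifold 2 Sigma & minimal 2 3 S G Sigma].

End Curvature.

Section Volume.
Context {R : realType}.

(* The Lebesgue integral over R^m as an iterated integral; it is used for
   nonnegative Borel functions only. *)
Fixpoint lebesgue_int (m : nat) : ('rV[R]_m -> \bar R) -> \bar R :=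
  match m with
  | 0 => fun f => f 0
  | m'.+1 => fun f => (\int[@lebesgue_measure R]_(t in setT)
      lebesgue_int (fun y : 'rV[R]_m' =>
        f (row_mx (t%:M : 'rV[R]_1) y : 'rV[R]_(1 + m'))))%E
  end.

(* [has_volume m G S A]: A is the m-dimensional Riemannian volume of S for
   the metric induced by G, i.e. the sum of the integrals of sqrt(det) over
   the pieces of a finite partition of S into parametrized Borel pieces.
   A compact submanifold has such a partition, and all of them give the
   same A. *)
Definition has_volume (m n : nat) (G : 'rV[R]_n -> 'M[R]_n)
    (S : set 'rV[R]_n) (A : \bar R) : Prop :=
  exists (N : nat) (U : 'I_N -> set 'rV[R]_m)
         (psi : 'I_N -> 'rV[R]_m -> 'rV[R]_n) (D : 'I_N -> set 'rV[R]_m),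
    [/\ forall k, local_param S (U k) (psi k),
        forall k, D k `<=` U k /\ <<s @open 'rV[R]_m >> (D k),
        trivIset setT (fun k => psi k @` D k),
        \bigcup_k (psi k @` D k) = S &
        A = (\sum_(k < N) lebesgue_int (fun x =>
          (\1_(D k) x * Num.sqrt (\det (pullback G (psi k) x)))%:E))%E].

Definition MinA (n : nat) (S : set 'rV[R]_n) (G : 'rV[R]_n -> 'M[R]_n)
    : \bar R :=
  ereal_inf [set A | exists Sigma,
    closed_minimal_surface S G Sigma /\ has_volume 2 G Sigma A].

End Volume.

Section Distance.
Context {R : realType}.

(* cs is the list of the smooth arcs, each over [0, 1], of a piecewise smooth
   curve in S from p to q *)
Fixpoint piecewise_smooth_curve (n : nat) (S : set 'rV[R]_n)
    (cs : seq (R -> 'rV[R]_n)) (p q : 'rV[R]_n) : Prop :=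
  match cs with
  | [::] => p = q
  | c :: cs' => [/\ smooth [set t : R | 0 <= t <= 1] c,
                    forall t, 0 <= t <= 1 -> S (c t),
                    c 0 = p & piecewise_smooth_curve S cs' (c 1) q]
  end.

Definition arc_length (n : nat) (G : 'rV[R]_n -> 'M[R]_n)
    (c : R -> 'rV[R]_n) : \bar R :=
  (\int[@lebesgue_measure R]_(t in `]0%R, 1%R[)
    (Num.sqrt ((derive1 c t *m G (c t) *m (derive1 c t)^T) 0 0))%:E)%E.

Definition riem_dist (n : nat) (S : set 'rV[R]_n) (G : 'rV[R]_n -> 'M[R]_n)
    (p q : 'rV[R]_n) : \bar R :=
  ereal_inf [set L | exists cs, piecewise_smooth_curve S cs p q /\
                                L = (\sum_(c <- cs) arc_length G c)%E].

Definition Diam (n : nat) (S : set 'rV[R]_n) (G : 'rV[R]_n -> 'M[R]_n)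
    : \bar R :=
  ereal_sup [set d | exists p q, [/\ S p, S q & d = riem_dist S G p q]].

End Distance.

Section WarpedMetrics.
Context {R : realType}.

Definition usphere (n : nat) : set 'rV[R]_n :=
  [set p | \sum_(i < n) p 0 i ^+ 2 = 1].

Definition S2 : set 'rV[R]_3 := @usphere 3.

Definition S2xS1 : set 'rV[R]_(3 + 2) :=
  [set z | S2 (lsubmx z) /\ usphere (rsubmx z)].

(* The coordinates (r, theta) on S^2, 0 <= r <= a. *)
Definition polar (a : R) (x : 'rV[R]_2) : 'rV[R]_3 :=
  let r := x 0 0 in let theta := x 0 (1 : 'I_2) in
  \row_(i < 3) [:: sin (pi * r / a) * cos theta;
                   sin (pi * r / a) * sin theta;
                   cos (pi * r / a)]`_i.

(* h = dr^2 + u(r)^2 dtheta^2 is a smooth metric on S^2; the derivatives of u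
   at the end points are one-sided. *)
Definition rot_sym_metric (a : R) (u : R -> R) (h : 'rV[R]_3 -> 'M[R]_3)
    : Prop :=
  [/\ 0 < a,
      [/\ smooth [set r : R | 0 <= r <= a] u,
          forall r, 0 < r -> r < a -> 0 < u r,
          u 0 = 0 /\ u a = 0,
          (fun t => t^-1 * (u t - u 0)) @ 0^'+ --> (1 : R) &
          (fun t => t^-1 * (u (a + t) - u a)) @ 0^'- --> (-1 : R)],
      riemannian_metric 2 S2 h &
      forall x : 'rV[R]_2, 0 < x 0 0 -> x 0 0 < a ->
        pullback h (polar a) x =
        diag_mx (\row_(i < 2) [:: 1; u (x 0 0) ^+ 2]`_i)].

(* phi^-2 h + phi^2 dxi^2; on the unit circle dxi^2 is the metric induced by
   the Euclidean one. *)
Definition warped (phi : 'rV[R]_3 -> R) (h : 'rV[R]_3 -> 'M[R]_3)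
    (z : 'rV[R]_(3 + 2)) : 'M[R]_(3 + 2) :=
  let p := lsubmx z in
  block_mx (phi p ^- 2 *: h p) 0 0 ((phi p ^+ 2)%:M).

End WarpedMetrics.

(* Main.v *)
(* In the coordinates (r, theta, xi), with f = ln phi, Scalar >= 0 reads
     f_r^2 + f_theta^2 / u^2 <= - u'' / u,
   so u is concave; let M = u(r0) be its maximum. The torus {r = r0} x S^1 is
   minimal of area 4 pi^2 M, and M <= r0, a - r0 since |u'| <= 1: this bounds
   M, and then a, from below in terms of A0.

   For the upper bound, the slice S^2 x {pt} is minimal, hence has area
   int phi^-2 u dr dtheta >= A0, while Vol = 2 pi int phi^-1 u dr dtheta <= V0.
   The curvature inequality gives |f(r, theta) - f(r0, theta)| <=
   ln (r0 / r) / 2 + 1 for r <= r0 (symmetrically on the other side), and at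
   some radius beyond r0 it gives |f_theta| <= 2, so that phi(r0, .) is
   constant up to a universal factor. Inserted into the two integrals, this
   yields A0 <= c V0^2 M^(-3/2) a^(-1/2).

   Finally Diam = a: points are joined through a pole, and the poles are at
   distance at least a because (a / pi) asin (rho z), with z the height and
   0 < rho < 1, is smooth and 1-Lipschitz. *)
Require Import Defs.
From HB Require Import structures.
From mathcomp Require Import all_boot all_order all_algebra.
From mathcomp Require Import all_classical all_reals all_analysis.
From mathcomp Require Import ring lra measurable_realfun.
Import Order.TTheory GRing.Theory Num.Theory.
Import numFieldNormedType.Exports.
Local Open Scope classical_set_scope.
Local Open Scope ring_scope.
Set Implicit Arguments.
Unset Strict Implicit.
Unset Printing Implicit Defensive.

(** * Smooth functions *)

Section Ck.
Context {R : realType} {V : normedModType R}.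

(** The size E = phi(r0, 0)^-1 is not controlled by V0 and A0. It enters the area of the slice as
    E^2 and the volume as E, so the area bound is combined with the square of the volume bound and E
    drops out; only ratios of phi have to be estimated. The exponent 1/2 of the radial estimate is
    just good enough: phi^-2 may grow like r0 / r towards a pole, but u <= r, so the density phi^-2
    u stays below a multiple of E^2 a. Cutting at distance d from the poles gives area <= c E^2 a (d
    + M a / d) and volume >= c E M a; d = sqrt (M a) balances the two terms, whence A0 M^2 a <= c
    V0^2 sqrt (M a). On the formal side, areas exist only through parametrized partitions, and
    minimality has to be shown at every point. Hence the explicit charts: polar ones off the poles,
    stereographic ones that reach them. The iterated integrals are only compared with separable step
    functions, so that neither Fubini nor the measurability of the densities is involved. *)

Lemma near_eq_differentiable (W : normedModType R) (f g : V -> W) (x : V) :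
  (\near x, f x = g x) -> differentiable f x -> differentiable g x.
Proof.
(* [g] is [f] plus a function vanishing near [x]; the latter is differentiable because its expansion
   with zero linear part can be exhibited. *)
move=> fg df; pose k := g - f.
have k0 : \near x, k x = 0.
  by near=> y; rewrite /k !fctE (near fg y)// subrr.
have kx0 : k x = 0 by exact: nbhs_singleton k0.
have kE : k \o shift x = cst (k x) + (\0 : {linear V -> W}) +o_ 0 id.
  apply/eqaddoP => _/posnumP[e].
  have k0' : \forall h \near 0, k (h + x) = 0.
    by move: k0; rewrite (near_shift 0 x); apply: filterS => y /=; rewrite subr0.
  near=> h; rewrite !fctE/= (near k0' h)// kx0 addr0 subrr normr0.
  exact: mulr_ge0.
have dk : differentiable k x.
  apply/diff_locallyP.
  have c0 : continuous (\0 : {linear V -> W}) by exact: cst_continuous.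
  by rewrite (diff_unique c0 kE); split.
by rewrite (_ : g = f + k); [exact: differentiableD|rewrite /k addrC subrK].
Unshelve. all: by end_near. Qed.

(** In [iter_derive] the last vector of the list acts first, and [Ck] peels off that innermost
    derivative: smoothness becomes an induction on the order, suited to sums, products and
    composites. Level [n] asks that all derivatives up to order [n] be differentiable, so level 0 is
    already differentiability. *)
Fixpoint Ck (W : normedModType R) (n : nat) (U : set V) (f : V -> W) : Prop :=
  (forall x, U x -> differentiable f x) /\
  if n is n'.+1 then forall v, Ck n' U ('D_v f) else True.

Lemma Ck_diff (W : normedModType R) n U (f : V -> W) x :
  Ck n U f -> U x -> differentiable f x.
Proof. by case: n => [|n] [] + _; exact. Qed.

Lemma CkW (W : normedModType R) n U (f : V -> W) : Ck n.+1 U f -> Ck n U f.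
Proof.
elim: n f => [|n IH] f [df dv]; split=> // v.
by apply: IH; exact: dv.
Qed.

Lemma smooth_openP (W : normedModType R) U (f : V -> W) :
  smooth_open U f <-> forall n, Ck n U f.
Proof.
split=> [sf n|cf s].
  elim: n f sf => [|n IH] f sf; first by split=> //; exact: (sf [::]).
  split=> [|v]; first exact: (sf [::]).
 apply: IH => s x Ux; have := sf (rcons s v) x Ux.
  by rewrite /iter_derive foldr_rcons.
elim/last_ind: s f cf => [|s v IH] f cf x Ux; first exact: Ck_diff (cf 0%N) Ux.
rewrite /iter_derive foldr_rcons; apply: IH Ux => n.
by have [_] := cf n.+1; exact.
Qed.

Lemma near_open (U : set V) (P : V -> Prop) x :
  open U -> U x -> (forall y, U y -> P y) -> \near x, P x.
Proof. by move=> oU Ux UP; apply: filterS UP _; exact: open_nbhs_nbhs. Qed.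

Lemma Ck_ext (W : normedModType R) n (U : set V) (f g : V -> W) :
  open U -> (forall x, U x -> f x = g x) -> Ck n U f -> Ck n U g.
Proof.
move=> oU; elim: n f g => [|n IH] f g fg [df cf].
  split=> // x Ux.
  apply: near_eq_differentiable (df _ Ux); exact: near_open Ux fg.
split=> [x Ux|v].
- apply: near_eq_differentiable (df _ Ux); exact: near_open Ux fg.
- apply: IH (cf v) => x Ux; apply: near_eq_derive; exact: near_open Ux fg.
Qed.

Lemma CkS (W : normedModType R) n (U U' : set V) (f : V -> W) :
  U `<=` U' -> Ck n U' f -> Ck n U f.
Proof.
move=> UU'; elim: n f => [|n IH] f [df cf].
  by split=> // x /UU'; exact: df.
by split=> [x /UU'|v]; [exact: df|apply: IH; exact: cf].
Qed.

Lemma Ck_cst (W : normedModType R) n (U : set V) (w : W) : Ck n U (cst w).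
Proof.
elim: n w => [|n IH] w; split=> // v.
rewrite (_ : 'D_v (cst w) = cst 0)//; apply/funext => x; exact: derive_cst.
Qed.

Lemma Ck_add (W : normedModType R) n (U : set V) (f g : V -> W) :
  open U -> Ck n U f -> Ck n U g -> Ck n U (fun x => f x + g x).
Proof.
move=> oU; elim: n f g => [|n IH] f g [df cf] [dg cg].
  by split=> // x Ux; exact: differentiableD (df _ Ux) (dg _ Ux).
split=> [x Ux|v]; first exact: differentiableD (df _ Ux) (dg _ Ux). apply: Ck_ext (IH _ _ (cf v) (cg v)) => // x Ux.
  by rewrite -deriveD//; apply: diff_derivable; [exact: df|exact: dg].
Qed.

Lemma Ck_sum (W : normedModType R) n (U : set V) k (f : 'I_k -> V -> W) :
  open U -> (forall i, Ck n U (f i)) -> Ck n U (fun x => \sum_(i < k) f i x).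
Proof.
move=> oU; elim: k f => [|k IH] f cf.
  by apply: Ck_ext (Ck_cst n U (0 : W)) => // x _; rewrite big_ord0.
pose g := fun x => \sum_(i < k) f (widen_ord (leqnSn k) i) x + f ord_max x.
by apply: (@Ck_ext _ _ _ g) => // [x _|];
  [rewrite big_ord_recr|apply: Ck_add => //; exact: IH].
Qed.

Lemma Ck_mul n (U : set V) (f g : V -> R) :
  open U -> Ck n U f -> Ck n U g -> Ck n U (fun x => f x * g x).
Proof.
move=> oU; elim: n f g => [|n IH] f g Cf Cg.
  have [df _] := Cf; have [dg _] := Cg.
  by split=> // x Ux; exact: differentiableM (df _ Ux) (dg _ Ux).
have [df cf] := Cf; have [dg cg] := Cg.
split=> [x Ux|v]; first exact: differentiableM (df _ Ux) (dg _ Ux).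
pose k := fun x => f x * 'D_v g x + g x * 'D_v f x.
apply: (@Ck_ext _ _ _ k) => // [x Ux|].
  rewrite /k -[in RHS]/(f * g) deriveM//; apply: diff_derivable;
    [exact: df|exact: dg].
by apply: Ck_add => //; apply: IH; [exact: CkW|exact: cg|exact: CkW|exact: cf].
Qed.

End Ck.

(** * Composition, matrix coordinates and elementary functions *)

Section Ck_comp.
Context {R : realType} {V : normedModType R}.

Lemma derive_comp (W W' : normedModType R) (f : V -> W) (F : W -> W') x v :
  differentiable f x -> differentiable F (f x) ->
  'D_v (F \o f) x = 'D_('D_v f x) F (f x).
Proof.
move=> df dF; rewrite deriveE; last exact: differentiable_comp.
by rewrite diff_comp//= -!deriveE.
Qed.

Lemma derive_comp1 (f : V -> R) (F : R -> R) x v :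
  differentiable f x -> differentiable F (f x) ->
  'D_v (fun y => F (f y)) x = 'D_v f x * 'D_1 F (f x).
Proof.
move=> df dF; rewrite (derive_comp v df dF) (deriveE _ dF).
by rewrite -[X in 'd _ _ X]mulr1 linearZ/= -deriveE.
Qed.

Lemma Ck_comp1 n (U : set V) (D : set R) (F : R -> R) (f : V -> R) :
  open U -> (forall x, U x -> D (f x)) ->
  Ck n D F -> Ck n U f -> Ck n U (fun x => F (f x)).
Proof.
move=> oU UD; elim: n F f UD => [|n IH] F f UD CF Cf;
  have [df cf] := Cf; have [dF cF] := CF.
  by split=> // x Ux; apply: differentiable_comp; [exact: df|exact/dF/UD].
split=> [x Ux|v]; first by apply: differentiable_comp; [exact: df|exact/dF/UD].
apply: (@Ck_ext _ _ _ _ _ (fun x => 'D_v f x * 'D_1 F (f x))) => // [x Ux|].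
  by rewrite derive_comp1//; [exact: df|exact/dF/UD].
by apply: Ck_mul => //; [exact: cf|apply: (IH ('D_1 F) f UD); [exact: cF|exact: CkW]].
Qed.

Lemma differentiable_mx m k (f : V -> 'M[R]_(m, k)) x :
  (forall i j, differentiable (fun y => f y i j) x) -> differentiable f x.
Proof.
move=> df; have dlt i j : differentiable (fun y => f y i j *: delta_mx i j) x.
  exact: differentiableZl.
rewrite (_ : f = fun y => \sum_i \sum_j f y i j *: delta_mx i j); last first.
  by apply/funext => y; exact: matrix_sum_delta.
have dsum p (g : 'I_p -> V -> 'M[R]_(m, k)) :
    (forall i, differentiable (g i) x) ->
    differentiable (fun y => \sum_(i < p) g i y) x.
  move=> dg; rewrite (_ : (fun _ => _) = \sum_(i < p) g i).
    exact: differentiable_sum.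
  by apply/funext => y; rewrite fct_sumE.
by apply: (dsum m) => i; apply: (dsum k) => j.
Qed.

Lemma differentiable_mxE m k (f : V -> 'M[R]_(m, k)) x i j :
  differentiable f x -> differentiable (fun y => f y i j) x.
Proof. by move=> df; apply: differentiable_comp df (differentiable_coord _ _ _). Qed.

Lemma derive_mxE m k (f : V -> 'M[R]_(m, k)) x v i j :
  differentiable f x -> ('D_v f x) i j = 'D_v (fun y => f y i j) x.
Proof. by move=> df; rewrite derive_mx ?mxE//; exact: diff_derivable. Qed.

Lemma Ck_mx n (U : set V) m k (f : V -> 'M[R]_(m, k)) : open U ->
  (forall i j, Ck n U (fun x => f x i j)) <-> Ck n U f.
Proof.
move=> oU; elim: n f => [|n IH] f.
  split=> [cf|[df _] i j]; split=> // x Ux.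
    by apply: differentiable_mx => i j; have [+ _] := cf i j; exact.
  exact/differentiable_mxE/df.
split=> [cf|[df cf] i j].
  have df x : U x -> differentiable f x.
    by move=> Ux; apply: differentiable_mx => i j; have [+ _] := cf i j; exact.
  split=> // v; apply/IH => i j; have [_ /(_ v)] := cf i j.
  by apply: Ck_ext => // x Ux; rewrite derive_mxE//; exact: df.
split=> [x Ux|v]; first exact/differentiable_mxE/df.
move: (cf v) => /IH /(_ i j).
by apply: Ck_ext => // x Ux; rewrite derive_mxE//; exact: df.
Qed.

Lemma derive_rV_sum m (W : normedModType R) (F : 'rV[R]_m -> W) x v :
  differentiable F x ->
  'D_v F x = \sum_i v 0 i *: 'D_(delta_mx 0 i) F x.
Proof.
move=> dF; rewrite deriveE// {1}(row_sum_delta v) linear_sum; apply: eq_bigr.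
by move=> i _; rewrite linearZ -deriveE.
Qed.

(** With a scalar outer function, the chain rule expresses the derivative as a sum of products of
    scalar functions, to which the induction applies. *)
Lemma Ck_comp m n (U : set V) (D : set 'rV[R]_m) (F : 'rV[R]_m -> R)
    (f : V -> 'rV[R]_m) : open U -> (forall x, U x -> D (f x)) ->
  Ck n D F -> Ck n U f -> Ck n U (F \o f).
Proof.
move=> oU UD; elim: n F f UD => [|n IH] F f UD CF Cf;
  have [df cf] := Cf; have [dF cF] := CF.
  by split=> // x Ux; apply: differentiable_comp; [exact: df|exact/dF/UD].
split=> [x Ux|v]; first by apply: differentiable_comp; [exact: df|exact/dF/UD].
pose g x := \sum_i ('D_v f x 0 i) * ('D_(delta_mx 0 i) F (f x)).
apply: (@Ck_ext _ _ _ _ _ g) => // [x Ux|].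
  rewrite derive_comp//; [|exact: df|exact/dF/UD].
  by rewrite derive_rV_sum//; exact/dF/UD.
apply: Ck_sum => // i; apply: Ck_mul => //; last by apply: (IH ('D_(delta_mx 0 i) F) f UD); [exact: cF|exact: CkW].
by move/Ck_mx : (cf v); exact.
Qed.

Lemma Ck_linear n (U : set V) (W : normedModType R) (f : {linear V -> W}) :
  continuous f -> Ck n U f.
Proof.
move=> cf; have df x : differentiable f x by exact: linear_differentiable.
case: n => [|n]; first by split.
split=> // v; rewrite (_ : 'D_v f = cst (f v)); first exact: Ck_cst.
by apply/funext => x; rewrite deriveE// diff_lin.
Qed.

Lemma Ck_local (W : normedModType R) n (U : set V) (f : V -> W) :
  (forall x, U x -> exists B, [/\ open B, B x & Ck n B f]) -> Ck n U f.
Proof.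
elim: n f => [|n IH] f lf.
  by split=> // x /lf[B [_ Bx [+ _]]]; exact.
split=> [x /lf[B [_ Bx [+ _]]]|v]; first exact.
by apply: IH => x /lf[B [oB Bx [_ cB]]]; exists B; split=> //; exact: cB.
Qed.

End Ck_comp.

Lemma Ck_coord {R : realType} m n (U : set 'rV[R]_m) (i : 'I_m) :
  Ck n U (fun x : 'rV[R]_m => x 0 i : R).
Proof.
have df x : differentiable (fun x : 'rV[R]_m => x 0 i : R) x.
  exact: differentiable_coord.
case: n => [|n]; first by split.
split=> // v.
rewrite (_ : 'D_v _ = cst (v 0 i)); first exact: Ck_cst.
apply/funext => x; rewrite -(derive_mxE (f := id))//.
by rewrite derive_id.
Qed.

Lemma Ck_sin_cos {R : realType} n : Ck n setT (@sin R) /\ Ck n setT (@cos R).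
Proof.
have ds x : differentiable (@sin R) x.
  by apply/derivable1_diffP; exact: derivable_sin.
have dc x : differentiable (@cos R) x.
  by apply/derivable1_diffP; exact: derivable_cos.
elim: n => [|n [IHs IHc]]; first by split; split.
have hD (F G : R -> R) : (forall x, differentiable F x) ->
    (forall x, 'D_1 F x = G x) -> forall v, 'D_v F = (fun x => v * G x).
  move=> dF FG v; apply/funext => x.
  by rewrite deriveE// -[in LHS](mulr1 v) linearZ/= -deriveE// FG.
split; split=> // v.
- rewrite (hD _ cos)//; last by move=> x; exact: derive_val.
  by apply: Ck_mul => //; [exact: openT|exact: Ck_cst].
- rewrite (hD _ (fun x => -1 * sin x))//; last first.
    by move=> x; rewrite derive_val mulN1r.
  by do 2 (apply: Ck_mul; [exact: openT|exact: Ck_cst|]).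
Qed.

Lemma Ck_inv {R : realType} n : Ck n [set x : R | x != 0] (fun x => x^-1).
Proof.
have o0 : open [set x : R | x != 0] by exact: open_neq.
elim: n => [|n IH]; first by split=> // x; exact: differentiable_Rinv.
split=> [x|v]; first exact: differentiable_Rinv.
have df (x : R) : x != 0 -> 'D_v (fun x : R => x^-1) x = - v * (x^-1 * x^-1).
  by move=> x0; rewrite (@deriveV _ _ id x v x0)//= derive_id scaleNr mulNr -[_ *: _]/(_ * _) mulrC expr2 invfM.
apply: (@Ck_ext R R R n [set x : R | x != 0] (fun x : R => - (v : R) * (x^-1 * x^-1)) (fun x : R => 'D_v (fun x : R => x^-1) x)) => // [x x0|].
  by rewrite df.
by do ?apply: Ck_mul => //; exact: Ck_cst.
Qed.

Section Ck_R.
Context {R : realType} {V : normedModType R} (n : nat) (U : set V) (oU : open U).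
Implicit Types f : V -> R.

Lemma Ck_sin f : Ck n U f -> Ck n U (fun x => sin (f x)).
Proof. by apply: (Ck_comp1 oU (D := setT)) => //; have [] := @Ck_sin_cos R n. Qed.

Lemma Ck_cos f : Ck n U f -> Ck n U (fun x => cos (f x)).
Proof. by apply: (Ck_comp1 oU (D := setT)) => //; have [] := @Ck_sin_cos R n. Qed.

Lemma Ck_V f : (forall x, U x -> f x != 0) -> Ck n U f ->
  Ck n U (fun x => (f x)^-1).
Proof. by move=> f0; apply: (Ck_comp1 oU f0); exact: Ck_inv. Qed.

Lemma Ck_opp f : Ck n U f -> Ck n U (fun x => - f x).
Proof.
move=> cf; apply: (@Ck_ext _ _ _ _ _ (fun x => -1 * f x)) => // [x _|].
  by rewrite mulN1r.
by apply: Ck_mul => //; exact: Ck_cst.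
Qed.

End Ck_R.

(** * Local parametrizations *)

Section Differentiable_fun.
Context {R : realType} {V : normedModType R}.
Implicit Types (f g : V -> R) (x : V).

Lemma dfD f g x : differentiable f x -> differentiable g x ->
  differentiable (fun y => f y + g y) x.
Proof. exact: differentiableD. Qed.

Lemma dfM f g x : differentiable f x -> differentiable g x ->
  differentiable (fun y => f y * g y) x.
Proof. exact: differentiableM. Qed.

Lemma dfN f x : differentiable f x -> differentiable (fun y => - f y) x.
Proof. exact: differentiableN. Qed.

Lemma dfV f x : f x != 0 -> differentiable f x ->
  differentiable (fun y => (f y)^-1) x.
Proof. by move=> f0 df; apply: differentiableV. Qed.

Lemma df_comp (F : R -> R) f x : derivable F (f x) 1 -> differentiable f x ->
  differentiable (fun y => F (f y)) x.
Proof. by move=> /derivable1_diffP dF df; exact: differentiable_comp df dF. Qed.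

Lemma near_neq0 f x : differentiable f x -> f x != 0 ->
  \forall y \near x, f y != 0.
Proof.
move=> /differentiable_continuous cf fx.
have /cf : nbhs (f x) [set r : R | r != 0]; last exact.
by apply: open_nbhs_nbhs; split=> //; exact: open_neq.
Qed.

Lemma near_lt f x c : differentiable f x -> f x < c ->
  \forall y \near x, f y < c.
Proof.
move=> /differentiable_continuous cf fx.
have /cf : nbhs (f x) [set r : R | r < c]; last exact.
by apply: open_nbhs_nbhs; split=> //; exact: open_lt.
Qed.

Lemma derive_fM f g x v : differentiable f x -> differentiable g x ->
  'D_v (fun y => f y * g y) x = f x * 'D_v g x + g x * 'D_v f x.
Proof.
by move=> df dg; rewrite -[fun _ => _]/(f * g) deriveM//; exact: diff_derivable.
Qed.

Lemma derive_fD f g x v : differentiable f x -> differentiable g x ->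
  'D_v (fun y => f y + g y) x = 'D_v f x + 'D_v g x.
Proof.
by move=> df dg; rewrite -[fun _ => _]/(f + g) deriveD//; exact: diff_derivable.
Qed.

Lemma derive_fN f x v : differentiable f x ->
  'D_v (fun y => - f y) x = - 'D_v f x.
Proof.
by move=> df; rewrite -[fun _ => _]/(- f) deriveN//; exact: diff_derivable.
Qed.

Lemma derive_fV f x v : f x != 0 -> differentiable f x ->
  'D_v (fun y => (f y)^-1) x = - (f x ^- 2) * 'D_v f x.
Proof. by move=> f0 df; rewrite deriveV//; exact: diff_derivable. Qed.

Lemma df_sin f x : differentiable f x -> differentiable (fun y => sin (f y)) x.
Proof. by move=> df; apply: df_comp => //; exact: derivable_sin. Qed.

Lemma df_cos f x : differentiable f x -> differentiable (fun y => cos (f y)) x.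
Proof. by move=> df; apply: df_comp => //; exact: derivable_cos. Qed.

Lemma derive_fsin f x v : differentiable f x ->
  'D_v (fun y => sin (f y)) x = 'D_v f x * cos (f x).
Proof.
move=> df; rewrite derive_comp1//; last first.
  by apply/derivable1_diffP; exact: derivable_sin.
by rewrite derive_val.
Qed.

Lemma derive_fcos f x v : differentiable f x ->
  'D_v (fun y => cos (f y)) x = - ('D_v f x * sin (f x)).
Proof.
move=> df; rewrite derive_comp1//; last first.
  by apply/derivable1_diffP; exact: derivable_cos.
by rewrite derive_val mulrN.
Qed.

End Differentiable_fun.

Lemma derive_coord (R : realType) m (x v : 'rV[R]_m) i :
  'D_v (fun y : 'rV[R]_m => y 0 i : R) x = v 0 i.
Proof. by rewrite -(derive_mxE (f := id))// derive_id. Qed.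

(** * Charts with continuous local inverses, and their products *)

Section Charts.
Context {R : realType}.

(* A local parametrization together with, near each image point, a continuous
   local right inverse; unlike the topological condition of [local_param], this
   can be checked by formulas and passes to products. *)
Definition good_chart (m n : nat) (S : set 'rV[R]_n) (U : set 'rV[R]_m)
    (psi : 'rV[R]_m -> 'rV[R]_n) : Prop :=
  [/\ open U, smooth_open U psi,
      (forall x v, U x -> 'D_v psi x = 0 -> v = 0),
      {in U &, injective psi} &
      forall x, U x -> S (psi x) /\
        exists chi : 'rV[R]_n -> 'rV[R]_m,
          [/\ {for psi x, continuous chi}, chi (psi x) = x &
              \forall p \near psi x, S p -> psi (chi p) = p]].

Lemma smooth_open_diff (V W : normedModType R) (U : set V) (f : V -> W) x :
  smooth_open U f -> U x -> differentiable f x.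
Proof. by move=> sf; exact: (sf [::]). Qed.

Lemma good_chart_local_param m n (S : set 'rV[R]_n) (U : set 'rV[R]_m) psi :
  good_chart S U psi -> local_param S U psi.
Proof.
move=> [oU sU dU iU cU]; split=> // [x Ux|B oB BU].
  rewrite -kermx_eq0; apply/eqP/row_matrixP => i; rewrite row0.
  apply: (dU x) => //; rewrite deriveEjacobian; last exact: smooth_open_diff sU Ux.
  by rewrite -row_mul mulmx_ker row0.
(* Near [psi b] the local inverse takes values in [B], so every point of [S] there is the image of a
   point of [B]: the image of [B] is relatively open. *)
exists (interior [set p | S p -> (psi @` B) p]); split; first exact: open_interior.
apply/seteqP; split=> [_ [b Bb <-]|p [Sp /interior_subset]]; last exact.
have [Sb [chi [cc cb nc]]] := cU _ (BU _ Bb); split => //.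
have nB : \forall p \near psi b, B (chi p).
  by apply: cc; rewrite cb; exact: open_nbhs_nbhs.
rewrite /interior/=; near=> p => Sp; exists (chi p); first by near: p.
by move: Sp; near: p.
Unshelve. all: by end_near. Qed.

Definition prodset (n1 n2 : nat) (S1 : set 'rV[R]_n1) (S2 : set 'rV[R]_n2) :
    set 'rV[R]_(n1 + n2) := [set z | S1 (lsubmx z) /\ S2 (rsubmx z)].

Definition prodchart (m1 m2 n1 n2 : nat) (psi1 : 'rV[R]_m1 -> 'rV[R]_n1)
    (psi2 : 'rV[R]_m2 -> 'rV[R]_n2) (x : 'rV[R]_(m1 + m2)) : 'rV[R]_(n1 + n2) :=
  row_mx (psi1 (lsubmx x)) (psi2 (rsubmx x)).

Lemma open_prodset m1 m2 (U1 : set 'rV[R]_m1) (U2 : set 'rV[R]_m2) :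
  open U1 -> open U2 -> open (prodset U1 U2).
Proof.
move=> o1 o2; apply: openI.
- by apply: open_comp => // x _; exact: continuous_lsubmx.
- by apply: open_comp => // x _; exact: continuous_rsubmx.
Qed.

Lemma derive_row_mx (V : normedModType R) n1 n2 (f : V -> 'rV[R]_n1)
    (g : V -> 'rV[R]_n2) x v : differentiable f x -> differentiable g x ->
  'D_v (fun y => row_mx (f y) (g y)) x = row_mx ('D_v f x) ('D_v g x).
Proof.
move=> df dg; have dfg : differentiable (fun y => row_mx (f y) (g y)) x.
  apply: differentiable_mx => i j; rewrite (ord1 i).
  case: (splitP j) => k jk.
    rewrite (_ : (fun _ => _) = fun y => f y 0 k); first exact: differentiable_mxE.
    by apply/funext => y; rewrite (_ : j = lshift _ k) ?row_mxEl//; exact: val_inj.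
  rewrite (_ : (fun _ => _) = fun y => g y 0 k); first exact: differentiable_mxE.
  by apply/funext => y; rewrite (_ : j = rshift _ k) ?row_mxEr//; exact: val_inj.
apply/rowP => j; rewrite derive_mxE//.
case: (splitP j) => k jk.
  have -> : j = lshift _ k by exact: val_inj.
  have -> : (fun y => row_mx (f y) (g y) 0 (lshift n2 k)) = fun y => f y 0 k.
    by apply/funext => y; rewrite row_mxEl.
  by rewrite row_mxEl derive_mxE.
have -> : j = rshift _ k by exact: val_inj.
have -> : (fun y => row_mx (f y) (g y) 0 (rshift n1 k)) = fun y => g y 0 k.
  by apply/funext => y; rewrite row_mxEr.
by rewrite row_mxEr derive_mxE.
Qed.

Lemma derive_lsubmx m1 m2 (x v : 'rV[R]_(m1 + m2)) :
  'D_v (lsubmx : 'rV[R]_(m1 + m2) -> 'rV[R]_m1) x = lsubmx v.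
Proof.
rewrite deriveE; last exact: differentiable_lsubmx.
by rewrite diff_lin//; exact: continuous_lsubmx.
Qed.

Lemma derive_rsubmx m1 m2 (x v : 'rV[R]_(m1 + m2)) :
  'D_v (rsubmx : 'rV[R]_(m1 + m2) -> 'rV[R]_m2) x = rsubmx v.
Proof.
rewrite deriveE; last exact: differentiable_rsubmx.
by rewrite diff_lin//; exact: continuous_rsubmx.
Qed.

Lemma derive_prodchart m1 m2 n1 n2 (psi1 : 'rV[R]_m1 -> 'rV[R]_n1)
    (psi2 : 'rV[R]_m2 -> 'rV[R]_n2) x v :
  differentiable psi1 (lsubmx x) -> differentiable psi2 (rsubmx x) ->
  'D_v (prodchart psi1 psi2) x =
  row_mx ('D_(lsubmx v) psi1 (lsubmx x)) ('D_(rsubmx v) psi2 (rsubmx x)).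
Proof.
move=> d1 d2.
have dl := @differentiable_lsubmx R 1 m1 m2 x.
have dr := @differentiable_rsubmx R 1 m1 m2 x.
rewrite derive_row_mx; [|exact: differentiable_comp dl d1|
  exact: differentiable_comp dr d2].
by rewrite (derive_comp _ dl d1) (derive_comp _ dr d2) derive_lsubmx derive_rsubmx.
Qed.

Lemma Ck_prodchart n m1 m2 n1 n2 (U1 : set 'rV[R]_m1) (U2 : set 'rV[R]_m2)
    (psi1 : 'rV[R]_m1 -> 'rV[R]_n1) (psi2 : 'rV[R]_m2 -> 'rV[R]_n2) :
  open U1 -> open U2 -> Ck n U1 psi1 -> Ck n U2 psi2 ->
  Ck n (prodset U1 U2) (prodchart psi1 psi2).
Proof.
move=> o1 o2 c1 c2; have oU := open_prodset o1 o2.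
apply/Ck_mx => // i j; rewrite (ord1 i).
case: (splitP j) => k jk.
  apply: (@Ck_ext _ _ _ _ _ ((fun y => psi1 y 0 k) \o lsubmx)) => // [x _/=|].
    by rewrite (_ : j = lshift _ k) ?row_mxEl//; exact: val_inj.
  apply: (Ck_comp oU (D := U1)) => [x []//||].
    by move/Ck_mx : c1; exact.
  by apply: Ck_linear; exact: continuous_lsubmx.
apply: (@Ck_ext _ _ _ _ _ ((fun y => psi2 y 0 k) \o rsubmx)) => // [x _/=|].
  by rewrite (_ : j = rshift _ k) ?row_mxEr//; exact: val_inj.
apply: (Ck_comp oU (D := U2)) => [x []//||].
  by move/Ck_mx : c2; exact.
by apply: Ck_linear; exact: continuous_rsubmx.
Qed.

Lemma row_mx_continuous (T : topologicalType) n1 n2 (f : T -> 'rV[R]_n1)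
    (g : T -> 'rV[R]_n2) x : {for x, continuous f} -> {for x, continuous g} ->
  {for x, continuous (fun y => row_mx (f y) (g y))}.
Proof.
move=> cf cg; apply/cvgrPdist_lt => e e0.
have /cvgrPdist_lt/(_ _ e0) nf := cf; have /cvgrPdist_lt/(_ _ e0) ng := cg.
near=> y; have fy : `|f x - f y| < e by near: y.
have gy : `|g x - g y| < e by near: y.
rewrite opp_row_mx add_row_mx [ltLHS]/Num.Def.normr/= mx_normrE.
apply: bigmax_lt => // -[i j] _ /=; rewrite (ord1 i).
case: (splitP j) => k jk.
  rewrite (_ : j = lshift _ k) ?row_mxEl//; last exact: val_inj.
  apply: le_lt_trans fy; rewrite [leRHS]/Num.Def.normr/= mx_normrE.
  exact: (le_bigmax _ _ (0, k)).
rewrite (_ : j = rshift _ k) ?row_mxEr//; last exact: val_inj.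
apply: le_lt_trans gy; rewrite [leRHS]/Num.Def.normr/= mx_normrE.
exact: (le_bigmax _ _ (0, k)).
Unshelve. all: by end_near. Qed.

Lemma good_chart_prod m1 m2 n1 n2 (S1 : set 'rV[R]_n1) (S2 : set 'rV[R]_n2)
    (U1 : set 'rV[R]_m1) (U2 : set 'rV[R]_m2) psi1 psi2 :
  good_chart S1 U1 psi1 -> good_chart S2 U2 psi2 ->
  good_chart (prodset S1 S2) (prodset U1 U2) (prodchart psi1 psi2).
Proof.
move=> [ o1 s1 d1 i1 c1] [ o2 s2 d2 i2 c2]; split.
- exact: open_prodset.
- apply/smooth_openP => n; apply: Ck_prodchart => //.
    by move/smooth_openP : s1; exact.
  by move/smooth_openP : s2; exact.
- move=> x v [Ux1 Ux2]; rewrite derive_prodchart; last 2 first.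
  + exact: smooth_open_diff s1 Ux1.
  + exact: smooth_open_diff s2 Ux2.
  rewrite -row_mx0 => /eq_row_mx[/(d1 _ _ Ux1) v1 /(d2 _ _ Ux2) v2].
  by rewrite -(hsubmxK v) v1 v2 row_mx0.
- move=> x y; rewrite !inE => -[x1 x2] [y1 y2] /eq_row_mx[e1 e2].
  rewrite -(hsubmxK x) -(hsubmxK y); congr row_mx.
    by apply: i1 => //; rewrite inE.
  by apply: i2 => //; rewrite inE.
- move=> x [x1 x2]; have [S1x [chi1 [cc1 cx1 n1']]] := c1 _ x1.
  have [S2x [chi2 [cc2 cx2 n2']]] := c2 _ x2.
  rewrite /prodchart /prodset/= row_mxKl row_mxKr; split => //.
  exists (fun p => row_mx (chi1 (lsubmx p)) (chi2 (rsubmx p))); split.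
  + apply: row_mx_continuous.
      apply: (@continuous_comp _ _ _ lsubmx chi1); first exact: continuous_lsubmx.
      by rewrite row_mxKl.
    apply: (@continuous_comp _ _ _ rsubmx chi2); first exact: continuous_rsubmx.
    by rewrite row_mxKr.
  + by rewrite row_mxKl row_mxKr cx1 cx2 hsubmxK.
  + set z := row_mx _ _.
    have cl : lsubmx @ z --> psi1 (lsubmx x).
      by have := @continuous_lsubmx R 1 n1 n2 z; rewrite /continuous_at /z row_mxKl.
    have cr : rsubmx @ z --> psi2 (rsubmx x).
      by have := @continuous_rsubmx R 1 n1 n2 z; rewrite /continuous_at /z row_mxKr.
    near=> p => -[p1 p2]; rewrite row_mxKl row_mxKr.
    have -> : psi1 (chi1 (lsubmx p)) = lsubmx p.
      by move: p1; near: p; exact: cl n1'.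
    have -> : psi2 (chi2 (rsubmx p)) = rsubmx p.
      by move: p2; near: p; exact: cr n2'.
    by rewrite hsubmxK.
Unshelve. all: by end_near. Qed.

End Charts.

(** * Charts of the circle and of the sphere *)

Section ConcreteCharts.
Context {R : realType}.

Definition circ (x : 'rV[R]_1) : 'rV[R]_2 :=
  \row_(i < 2) [:: cos (x 0 0); sin (x 0 0)]`_i.

(** The argument of the unit vector (X, Y) that is within pi of [c]: after rotation by - c this is
    the half-angle formula 2 atan (y / (1 + x)), valid except at the antipode of (cos c, sin c),
    where the denominator vanishes. The free centre [c] makes it usable around any point of the
    circle. *)
Definition angle (c X Y : R) : R :=
  c + 2 * atan ((Y * cos c - X * sin c) / (1 + X * cos c + Y * sin c)).

Lemma cos_atan2 (t : R) : cos (2 * atan t) = (1 - t ^+ 2) / (1 + t ^+ 2).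
Proof.
have c2 : cos (atan t) ^+ 2 = (1 + t ^+ 2)^-1.
  by rewrite cos_atan exprVn sqr_sqrtr// addr_ge0// sqr_ge0.
have t0 : 1 + t ^+ 2 != 0 by rewrite gt_eqF// ltr_pwDl// sqr_ge0.
by rewrite mulr_natl cos_mulr2n c2 -mulr_natl; field.
Qed.

Lemma sin_atan2 (t : R) : sin (2 * atan t) = 2 * t / (1 + t ^+ 2).
Proof.
have t0 : 1 + t ^+ 2 != 0 by rewrite gt_eqF// ltr_pwDl// sqr_ge0.
have c2 : cos (atan t) ^+ 2 = (1 + t ^+ 2)^-1.
  by rewrite cos_atan exprVn sqr_sqrtr// addr_ge0// sqr_ge0.
have c0 : cos (atan t) != 0.
  by rewrite -sqrf_eq0 c2 invr_eq0.
have st : sin (atan t) = t * cos (atan t).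
  by rewrite -[X in _ = X * _](atanK t) /tan mulfVK.
by rewrite mulr_natl sin_mulr2n st mulrCA -expr2 c2 -mulr_natl mulrA.
Qed.

Lemma angle_cos_sin (c X Y : R) : X ^+ 2 + Y ^+ 2 = 1 ->
  1 + X * cos c + Y * sin c != 0 ->
  cos (angle c X Y) = X /\ sin (angle c X Y) = Y.
Proof.
move=> XY; rewrite /angle; set t := _ / _; set w := 1 + _ + _ => w0.
have cs : cos c ^+ 2 + sin c ^+ 2 = 1 := cos2Dsin2 c.
pose C := X * cos c + Y * sin c; pose S := Y * cos c - X * sin c.
have CS : C ^+ 2 + S ^+ 2 = 1.
  rewrite -[RHS](mul1r 1) -{1}XY -cs /C /S; ring.
have wE : w = 1 + C by rewrite /w /C addrA.
have tE : t = S / (1 + C) by rewrite -wE.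
have C0 : 1 + C != 0 by rewrite -wE.
have t2 : 1 + t ^+ 2 = 2 / (1 + C).
  rewrite tE; apply: (mulIf (expf_neq0 2 C0)).
  rewrite mulrDl mul1r -exprMn mulfVK//.
  have -> : S ^+ 2 = 1 - C ^+ 2 by rewrite -CS; ring.
  by field.
have cE : cos (2 * atan t) = C.
  rewrite cos_atan2 t2 (_ : 1 - t ^+ 2 = 2 - 2 / (1 + C)); first by field.
  by rewrite -t2; ring.
have sE : sin (2 * atan t) = S.
  by rewrite sin_atan2 t2 tE; field.
rewrite cosD sinD cE sE; split.
- rewrite -[RHS](mulr1 X) -cs /C /S; ring.
- rewrite -[RHS](mulr1 Y) -cs /C /S; ring.
Qed.

Lemma angle_id (c : R) : angle c (cos c) (sin c) = c.
Proof. by rewrite /angle (mulrC (sin c) (cos c)) subrr mul0r atan0 mulr0 addr0. Qed.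

Lemma differentiable_angle (V : normedModType R) (c : R) (f g : V -> R) x :
  differentiable f x -> differentiable g x ->
  1 + f x * cos c + g x * sin c != 0 ->
  differentiable (fun y => angle c (f y) (g y)) x.
Proof.
move=> df dg w0; apply: dfD => //; apply: dfM => //.
apply: df_comp; first exact: derivable_atan.
apply: dfM.
  by apply: dfD; [apply: dfM|apply: dfN; apply: dfM].
apply: dfV => //; apply: dfD; [apply: dfD => //|]; exact: dfM.
Qed.

Lemma cos_sin_inj (x y : R) : `|x - y| < pi + pi ->
  cos x = cos y -> sin x = sin y -> x = y.
Proof.
move=> xy cxy sxy; apply/eqP; rewrite -subr_eq0; apply/negP => /negP d0.
have c1 : cos (x - y) = 1 by rewrite cosB cxy sxy -!expr2 cos2Dsin2.
(* Half of the distance lies in ]0, pi[, where the sine does not vanish, whereas the double-angle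
   formula makes its sine 0. *)
pose z := `|x - y| / 2.
have z0 : 0 < z < pi.
  by rewrite divr_gt0 ?normr_gt0//= ltr_pdivrMr// mulr_natr mulr2n.
have : cos (z *+ 2) = 1.
  by rewrite -mulr_natr /z mulfVK// cos_norm.
rewrite cos_mulr2n cos2sin2 => e.
have : sin z ^+ 2 = 0 by move: e; rewrite -mulr_natl; lra.
by move/eqP; rewrite sqrf_eq0 gt_eqF// sin_gt0_pi.
Qed.

Lemma circ_chart (c : R) :
  good_chart (@usphere R 2) [set x : 'rV[R]_1 | `|x 0 0 - c| < pi] circ.
Proof.
have oU : open [set x : 'rV[R]_1 | `|x 0 0 - c| < pi].
  apply: (@open_comp _ _ (fun x : 'rV[R]_1 => `|x 0 0 - c|) [set r | r < pi]); last exact: open_lt.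
  move=> x _; apply: (@continuous_comp _ _ _ (fun x : 'rV[R]_1 => x 0 0 - c) Num.norm); last exact: norm_continuous.
  by apply: differentiable_continuous; apply: dfD => //; exact: differentiable_coord.
have sm : forall n U, open U -> Ck n U circ.
  move=> n U oU'; apply/Ck_mx => // i [[|[|//]] Hj].
  - apply: (@Ck_ext _ _ _ _ _ (fun x : 'rV[R]_1 => cos (x 0 0))) => // [x _|].
      by rewrite mxE.
    exact/Ck_cos/Ck_coord.
  - apply: (@Ck_ext _ _ _ _ _ (fun x : 'rV[R]_1 => sin (x 0 0))) => // [x _|].
      by rewrite mxE.
    exact/Ck_sin/Ck_coord.
split=> //.
- by apply/smooth_openP => n; exact: sm.
- move=> x v _ Dv0.
  have dc : differentiable circ x by exact: (Ck_diff (sm 0%N setT openT)).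
  have dx : differentiable (fun x : 'rV[R]_1 => x 0 0 : R) x by exact: differentiable_coord.
  have Dx : 'D_v (fun x : 'rV[R]_1 => x 0 0 : R) x = v 0 0.
    by rewrite -(derive_mxE (f := id))// derive_id.
  have D0 : v 0 0 * - sin (x 0 0) = 0.
    have := derive_mxE v 0 0 dc; rewrite Dv0 mxE.
    rewrite (_ : (fun _ => _) = fun y : 'rV[R]_1 => cos (y 0 0)); last first.
      by apply/funext => y; rewrite mxE.
    rewrite derive_comp1//; last by apply/derivable1_diffP; exact: derivable_cos.
    by rewrite Dx derive_val.
  have D1 : v 0 0 * cos (x 0 0) = 0.
    have := derive_mxE v 0 1 dc; rewrite Dv0 mxE.
    rewrite (_ : (fun _ => _) = fun y : 'rV[R]_1 => sin (y 0 0)); last first.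
      by apply/funext => y; rewrite mxE.
    rewrite derive_comp1//; last by apply/derivable1_diffP; exact: derivable_sin.
    by rewrite Dx derive_val.
  apply/rowP => i; rewrite (ord1 i) mxE.
  have : v 0 0 ^+ 2 * (cos (x 0 0) ^+ 2 + sin (x 0 0) ^+ 2) = 0.
    rewrite mulrDr -!exprMn D1; move: D0; rewrite mulrN => /eqP.
    by rewrite oppr_eq0 => /eqP ->; rewrite expr0n/= addr0.
  by rewrite cos2Dsin2 mulr1 => /eqP; rewrite sqrf_eq0 => /eqP.
- move=> x y; rewrite !inE/= => xc yc /rowP e.
  have := e 0; rewrite !mxE/= => e0; have := e 1; rewrite !mxE/= => e1.
  apply/rowP => i; rewrite (ord1 i); apply: cos_sin_inj => //.
  rewrite (_ : _ - _ = (x 0 0 - c) - (y 0 0 - c)); last by ring.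
  by rewrite (le_lt_trans (ler_normB _ _))// ltrD.
- move=> x xc; split.
    by rewrite /usphere/= big_ord_recl big_ord1 !mxE/= cos2Dsin2.
  (* Centred at the angle of the point itself, the denominator in [angle] equals 2 there, hence is
     nonzero nearby. *)
  exists (fun p => \row_(i < 1) angle (x 0 0) (p 0 0) (p 0 1)).
  have x1 : 1 + circ x 0 0 * cos (x 0 0) + circ x 0 1 * sin (x 0 0) != 0.
    by rewrite !mxE/= -!expr2 -addrA cos2Dsin2 -[1 + 1]/(2%:R) pnatr_eq0.
  split.
  + apply: differentiable_continuous; apply: differentiable_mx => i j.
    rewrite (_ : (fun _ => _) = fun p : 'rV[R]_2 => angle (x 0 0) (p 0 0) (p 0 1)).
      by apply: differentiable_angle => //; exact: differentiable_coord.
    by apply/funext => p; rewrite mxE.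
  + by apply/rowP => i; rewrite (ord1 i) !mxE/= angle_id.
  + have dw : differentiable (fun p : 'rV[R]_2 => 1 + p 0 0 * cos (x 0 0) + p 0 1 * sin (x 0 0)) (circ x).
      by apply: dfD; [apply: dfD => //|]; apply: dfM => //; exact: differentiable_coord.
    have nw : \forall p \near circ x, 1 + (p : 'rV[R]_2) 0 0 * cos (x 0 0) + p 0 1 * sin (x 0 0) != 0.
      exact: near_neq0 dw _.
    near=> p; rewrite /usphere/= big_ord_recl big_ord1 => Sp.
    have p1 : lift ord0 (ord0 : 'I_1) = 1 :> 'I_2 by exact: val_inj.
    rewrite p1 in Sp.
    have [|cp sp] := @angle_cos_sin (x 0 0) (p 0 0) (p 0 1) Sp; first by near: p.
    by apply/rowP => -[[|[|//]] Hi]; rewrite !mxE/= ?cp ?sp; congr (p _ _); exact: val_inj.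
Unshelve. all: by end_near. Qed.

Lemma open_rV_lt m (f : 'rV[R]_m -> R) c :
  (forall x, differentiable f x) -> open [set x | f x < c].
Proof.
move=> df; apply: (@open_comp _ _ f [set r | r < c]); last exact: open_lt.
by move=> x _; exact: differentiable_continuous.
Qed.

Lemma Ck_polar (a : R) n U : open U -> Ck n U (polar a).
Proof.
have cs m V : open V -> Ck m V (fun x : 'rV[R]_2 => pi * x 0 0 / a).
  move=> oV; apply: Ck_mul => //; last exact: Ck_cst.
  by apply: Ck_mul => //; [exact: Ck_cst|exact: Ck_coord].
move=> oU; apply/Ck_mx => // i [[|[|[|//]]] Hj].
- apply: (@Ck_ext _ _ _ _ _ (fun x : 'rV[R]_2 => sin (pi * x 0 0 / a) * cos (x 0 1))) => // [x _|].
    by rewrite mxE.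
  by apply: Ck_mul => //; [exact/Ck_sin/cs|exact/Ck_cos/Ck_coord].
- apply: (@Ck_ext _ _ _ _ _ (fun x : 'rV[R]_2 => sin (pi * x 0 0 / a) * sin (x 0 1))) => // [x _|].
    by rewrite mxE.
  by apply: Ck_mul => //; [exact/Ck_sin/cs|exact/Ck_sin/Ck_coord].
- apply: (@Ck_ext _ _ _ _ _ (fun x : 'rV[R]_2 => cos (pi * x 0 0 / a))) => // [x _|].
    by rewrite mxE.
  exact/Ck_cos/cs.
Qed.

Lemma differentiable_polar (a : R) x : differentiable (polar a) x.
Proof. exact: (Ck_diff (Ck_polar a 0 openT)). Qed.

Lemma derive_polar (a : R) (x v : 'rV[R]_2) :
  let s := pi * x 0 0 / a in let t := x 0 1 in
  'D_v (polar a) x = \row_(i < 3)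
    [:: pi * v 0 0 / a * cos s * cos t - v 0 1 * sin s * sin t;
        pi * v 0 0 / a * cos s * sin t + v 0 1 * sin s * cos t;
        - (pi * v 0 0 / a * sin s)]`_i.
Proof.
move=> s t.
have d0 : differentiable (fun x : 'rV[R]_2 => pi * x 0 0 / a) x.
  by apply: dfM => //; apply: dfM => //; exact: differentiable_coord.
have D0 : 'D_v (fun x : 'rV[R]_2 => pi * x 0 0 / a) x = pi * v 0 0 / a.
  rewrite derive_fM//; last by apply: dfM => //; exact: differentiable_coord.
  rewrite derive_fM//; last exact: differentiable_coord.
  by rewrite derive_coord !derive_cst !mulr0 add0r addr0 mulrC.
have d1 : differentiable (fun x : 'rV[R]_2 => x 0 1 : R) x by exact: differentiable_coord.
have D1 := derive_coord x v (1 : 'I_2).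
apply/rowP => j; rewrite derive_mxE; last exact: differentiable_polar.
case: j => [[|[|[|//]]] Hj]; rewrite mxE/=.
- rewrite (_ : (fun _ => _) = fun x : 'rV[R]_2 => sin (pi * x 0 0 / a) * cos (x 0 1)).
    rewrite derive_fM; [|exact: df_sin|exact: df_cos].
    by rewrite derive_fsin// derive_fcos// D0 D1 -/s -/t; ring.
  by apply/funext => y; rewrite mxE.
- rewrite (_ : (fun _ => _) = fun x : 'rV[R]_2 => sin (pi * x 0 0 / a) * sin (x 0 1)).
    rewrite derive_fM; [|exact: df_sin|exact: df_sin].
    by rewrite !derive_fsin// D0 D1 -/s -/t; ring.
  by apply/funext => y; rewrite mxE.
- rewrite (_ : (fun _ => _) = fun x : 'rV[R]_2 => cos (pi * x 0 0 / a)).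
    by rewrite derive_fcos// D0 -/s -/t; ring.
  by apply/funext => y; rewrite mxE.
Qed.

Definition i30 : 'I_3 := @Ordinal 3 0 isT.
Definition i31 : 'I_3 := @Ordinal 3 1 isT.
Definition i32 : 'I_3 := @Ordinal 3 2 isT.

Lemma sum3E (T : nmodType) (F : 'I_3 -> T) :
  \sum_(i < 3) F i = F i30 + F i31 + F i32.
Proof.
rewrite big_ord_recl big_ord_recl big_ord1 addrA.
by congr (F _ + F _ + F _); exact: val_inj.
Qed.

Lemma S2E (p : 'rV[R]_3) : S2 p <-> p 0 i30 ^+ 2 + p 0 i31 ^+ 2 + p 0 i32 ^+ 2 = 1.
Proof. by rewrite /S2 /usphere/= sum3E. Qed.

Lemma polar_S2 (a : R) x : S2 (polar a x).
Proof.
apply/S2E; rewrite !mxE/= !exprMn -mulrDr cos2Dsin2 mulr1 addrC; exact: cos2Dsin2.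
Qed.

Lemma polar_angle_in (a r : R) : 0 < r -> r < a -> 0 < pi * r / a < pi.
Proof.
move=> r0 ra; have a0 : 0 < a by exact: lt_trans ra.
by rewrite divr_gt0 ?mulr_gt0 ?pi_gt0//= ltr_pdivrMr// ltr_pM2l ?pi_gt0.
Qed.

Let scaleK (P Q t : R) : P != 0 -> Q != 0 -> Q / P * (P * t / Q) = t.
Proof. by move=> P0 Q0; field; rewrite P0 Q0. Qed.

Let scaleKV (P Q t : R) : P != 0 -> Q != 0 -> P * (Q / P * t) / Q = t.
Proof. by move=> P0 Q0; field; rewrite P0 Q0. Qed.

Definition polar_dom (a c : R) : set 'rV[R]_2 :=
  [set x | [/\ 0 < x 0 0, x 0 0 < a & `|x 0 1 - c| < pi]].

Lemma polar_chart (a c : R) : 0 < a -> good_chart S2 (polar_dom a c) (polar a).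
Proof.
move=> a0.
have dc (i : 'I_2) (x : 'rV[R]_2) : differentiable (fun x : 'rV[R]_2 => x 0 i : R) x.
  exact: differentiable_coord.
have pi0 := @pi_gt0 R.
have oU : open (polar_dom a c).
  rewrite (_ : polar_dom a c = [set x : 'rV[R]_2 | - x 0 0 < 0] `&` [set x : 'rV[R]_2| x 0 0 < a] `&`
    ([set x : 'rV[R]_2| x 0 1 - c < pi] `&` [set x : 'rV[R]_2| c - x 0 1 < pi])).
    by apply: openI; apply: openI; apply: open_rV_lt => x //;
      [exact: dfN|exact: dfD|apply: dfD => //; exact: dfN].
  apply/seteqP; split=> x; rewrite /polar_dom /= ltr_norml.
    by move=> [x0 xa /andP[h1 h2]]; do !split; lra.
  move=> [[x0 xa] [h1 h2]]; split; [lra|lra|].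
  by apply/andP; split; lra.
split=> //.
- by apply/smooth_openP => n; exact: Ck_polar.
- move=> x v [x0 xa _]; rewrite derive_polar => /rowP e.
  have s0 : 0 < sin (pi * x 0 0 / a) by apply: sin_gt0_pi; exact: polar_angle_in.
  have v0 : v 0 0 = 0.
    have := e i32; rewrite !mxE/= => /eqP.
    by rewrite oppr_eq0 !mulf_eq0 (gt_eqF s0) invr_eq0 (gt_eqF a0) (gt_eqF pi0) !orbF => /eqP.
  have := e i30; have := e i31; rewrite !mxE/= v0 !(mulr0, mul0r, add0r) => e1 e0.
  have e2 : (v 0 1 * sin (pi * x 0 0 / a)) ^+ 2 * (cos (x 0 1) ^+ 2 + sin (x 0 1) ^+ 2) = 0.
    rewrite mulrDr -!exprMn e1; move/eqP : e0; rewrite oppr_eq0 => /eqP ->.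
    by rewrite expr0n/= addr0.
  move: e2; rewrite cos2Dsin2 mulr1 => /eqP; rewrite sqrf_eq0 mulf_eq0 (gt_eqF s0) orbF => /eqP v1.
  apply/rowP => -[[|[|//]] Hi]; rewrite mxE; [rewrite -[RHS]v0|rewrite -[RHS]v1];
    congr (v _ _); exact: val_inj.
- move=> x y; rewrite !inE => -[x0 xa xc] [y0 ya yc] /rowP e.
  have sx0 : 0 < sin (pi * x 0 0 / a) by apply: sin_gt0_pi; exact: polar_angle_in.
  have xy0 : x 0 0 = y 0 0.
    have := e i32; rewrite !mxE/= => /cos_inj; rewrite !in_itv/=.
    have /andP[/ltW -> /ltW ->] := polar_angle_in x0 xa.
    have /andP[/ltW -> /ltW ->] := polar_angle_in y0 ya.
    move=> /(_ isT isT)/(mulIf (invr_neq0 (lt0r_neq0 a0))).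
    exact/mulfI/lt0r_neq0.
  have xy1 : x 0 1 = y 0 1.
    have := e i30; rewrite !mxE/= -xy0 => /(mulfI (lt0r_neq0 sx0)) e0.
    have := e i31; rewrite !mxE/= -xy0 => /(mulfI (lt0r_neq0 sx0)) e1.
    apply: cos_sin_inj => //.
    rewrite (_ : _ - _ = (x 0 1 - c) - (y 0 1 - c)); last by ring.
    by rewrite (le_lt_trans (ler_normB _ _))// ltrD.
  by apply/rowP => -[[|[|//]] Hi]; [rewrite (_ : Ordinal Hi = 0)//|
    rewrite (_ : Ordinal Hi = 1)//]; exact: val_inj.
- move=> x [x0 xa xc]; split; first exact: polar_S2.
  have /andP[s0 spi] := polar_angle_in x0 xa.
  have s1 : 0 < sin (pi * x 0 0 / a) by apply: sin_gt0_pi; rewrite s0.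
  (* On the sphere this is the distance to the axis. Written with the height alone it is
     differentiable wherever that height lies in ]-1, 1[, also off the sphere, where the local
     inverse must still be defined. *)
  pose rho (p : 'rV[R]_3) := sin (acos (p 0 i32)).
  exists (fun p : 'rV[R]_3 => \row_(i < 2) [:: a / pi * acos (p 0 i32);
     angle (x 0 1) (p 0 i30 / rho p) (p 0 i31 / rho p)]`_i).
  have acx : acos (polar a x 0 i32) = pi * x 0 0 / a.
    by rewrite mxE/= cosK// in_itv/= !ltW.
  have rhox : rho (polar a x) = sin (pi * x 0 0 / a) by rewrite /rho acx.
  have X0 : polar a x 0 i30 / rho (polar a x) = cos (x 0 1).
    by rewrite rhox mxE/= mulrC mulKf// gt_eqF.
  have X1 : polar a x 0 i31 / rho (polar a x) = sin (x 0 1).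
    by rewrite rhox mxE/= mulrC mulKf// gt_eqF.
  have dc3 (i : 'I_3) : differentiable (fun x : 'rV[R]_3 => x 0 i : R) (polar a x).
    exact: differentiable_coord.
  have z1 : -1 < polar a x 0 i32 < 1.
    have : polar a x 0 i32 ^+ 2 < 1.
      by rewrite mxE/= -(cos2Dsin2 (pi * x 0 0 / a)) ltrDl exprn_gt0.
    by move=> h; apply/andP; split; nra.
  have dac : differentiable (fun p : 'rV[R]_3 => acos (p 0 i32)) (polar a x).
    by apply: df_comp => //; exact: (@ex_derive _ _ _ _ _ _ _ (is_derive1_acos z1)).
  have drho : differentiable rho (polar a x) by exact: df_sin.
  have rho0 : rho (polar a x) != 0 by rewrite rhox gt_eqF.
  have dX (i : 'I_3) : differentiable (fun p : 'rV[R]_3 => p 0 i / rho p) (polar a x).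
    by apply: dfM => //; exact: dfV.
  have w0 : 1 + polar a x 0 i30 / rho (polar a x) * cos (x 0 1) +
      polar a x 0 i31 / rho (polar a x) * sin (x 0 1) != 0.
    by rewrite X0 X1 -!expr2 -addrA cos2Dsin2 -[1 + 1]/(2%:R) pnatr_eq0.
  have dw : differentiable (fun p : 'rV[R]_3 => 1 + p 0 i30 / rho p * cos (x 0 1) +
      p 0 i31 / rho p * sin (x 0 1)) (polar a x).
    by apply: dfD; [apply: dfD => //|]; apply: dfM.
  split.
  + apply: differentiable_continuous; apply: differentiable_mx => i -[[|[|//]] Hj].
      rewrite (_ : (fun _ => _) = fun p : 'rV[R]_3 => a / pi * acos (p 0 i32)).
        exact: dfM.
      by apply/funext => p; rewrite mxE.
    rewrite (_ : (fun _ => _) = fun p : 'rV[R]_3 => angle (x 0 1) (p 0 i30 / rho p) (p 0 i31 / rho p)).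
      exact: differentiable_angle.
    by apply/funext => p; rewrite mxE.
  + apply/rowP => -[[|[|//]] Hi].
      rewrite mxE [LHS]/= acx.
      rewrite (_ : Ordinal Hi = 0); last exact: val_inj.
      exact: (scaleK _ (lt0r_neq0 pi0) (lt0r_neq0 a0)).
    rewrite mxE [LHS]/= X0 X1 angle_id.
    by congr (x _ _); exact: val_inj.
  + have nw : \forall p \near polar a x, 1 + (p : 'rV[R]_3) 0 i30 / rho p * cos (x 0 1) +
      p 0 i31 / rho p * sin (x 0 1) != 0.
      exact: near_neq0 dw _.
    have nz : \forall p \near polar a x, -1 < (p : 'rV[R]_3) 0 i32 < 1.
      have /andP[z2 z3] := z1.
      near=> p; apply/andP; split; last by near: p; exact: near_lt (dc3 i32) z3.
      rewrite ltrNl; near: p; apply: (near_lt (f := fun p : 'rV[R]_3 => - p 0 i32)); first exact: dfN.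
      by rewrite ltrNl.
    near=> p; move=> /S2E Sp.
    have /andP[pz1 pz2] : -1 < p 0 i32 < 1 by near: p.
    have pz : p 0 i32 \in `[-1, 1] by rewrite in_itv/= !ltW.
    have rp2 : rho p ^+ 2 = 1 - p 0 i32 ^+ 2.
      by rewrite /rho sin2cos2 acosK.
    have rp0 : 0 < rho p.
      apply: sin_gt0_pi; rewrite acos_gt0 ?acos_ltpi// ?pz1 ?pz2 ?ltW//.
    have [||cp sp] := @angle_cos_sin (x 0 1) (p 0 i30 / rho p) (p 0 i31 / rho p).
    * rewrite !exprMn -mulrDl exprVn.
      have -> : p 0 i30 ^+ 2 + p 0 i31 ^+ 2 = rho p ^+ 2 by rewrite rp2 -Sp; ring.
      by rewrite divff// expf_neq0// gt_eqF.
    * by near: p.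
    have acE : pi * (a / pi * acos (p 0 i32)) / a = acos (p 0 i32).
      exact: (scaleKV _ (lt0r_neq0 pi0) (lt0r_neq0 a0)).
    apply/rowP => -[[|[|[|//]]] Hi]; rewrite !mxE/= acE ?cp ?sp.
    - by rewrite -/(rho p) mulrC mulfVK ?gt_eqF//; congr (p _ _); exact: val_inj.
    - by rewrite -/(rho p) mulrC mulfVK ?gt_eqF//; congr (p _ _); exact: val_inj.
    - by rewrite acosK//; congr (p _ _); exact: val_inj.
Unshelve. all: by end_near. Qed.

(** For e = 1 or -1, the inverse of the stereographic projection (p0, p1) / (1 + e p2): its image is
    the sphere minus the pole of height - e, and the origin goes to the pole of height e. Polar
    coordinates degenerate at both poles; these charts reach them. *)
Definition stereo (e : R) (x : 'rV[R]_2) : 'rV[R]_3 :=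
  let q := 1 + x 0 0 ^+ 2 + x 0 1 ^+ 2 in
  \row_(i < 3) [:: 2 * x 0 0 / q; 2 * x 0 1 / q;
                   e * (1 - x 0 0 ^+ 2 - x 0 1 ^+ 2) / q]`_i.

Lemma stereo_chart (e : R) : e ^+ 2 = 1 -> good_chart S2 setT (stereo e).
Proof.
move=> e2; have e0 : e != 0 by rewrite -sqrf_eq0 e2 oner_eq0.
pose q (x : 'rV[R]_2) : R := 1 + x 0 0 ^+ 2 + x 0 1 ^+ 2.
have q0 x : 0 < q x by rewrite /q -addrA ltr_pwDl// addr_ge0// sqr_ge0.
have qn0 x : q x != 0 by rewrite gt_eqF.
have cX n (i : 'I_2) : Ck n setT (fun x : 'rV[R]_2 => x 0 i ^+ 2).
  rewrite (_ : (fun _ => _) = fun x : 'rV[R]_2 => x 0 i * x 0 i).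
    by apply: Ck_mul; [exact: openT|exact: Ck_coord|exact: Ck_coord].
  by apply/funext => x; rewrite expr2.
have cq n : Ck n setT q.
  apply: Ck_add; [exact: openT| |exact: cX].
  by apply: Ck_add; [exact: openT|exact: Ck_cst|exact: cX].
have cqV n : Ck n setT (fun x => (q x)^-1) by apply: Ck_V => //; exact: openT.
pose N (i : 'I_3) (x : 'rV[R]_2) : R :=
  [:: 2 * x 0 0; 2 * x 0 1; e * (1 - x 0 0 ^+ 2 - x 0 1 ^+ 2)]`_i.
have cN n i : Ck n setT (N i).
  case: i => -[|[|[|//]]] Hi; rewrite /N/=.
  - by apply: Ck_mul; [exact: openT|exact: Ck_cst|exact: Ck_coord].
  - by apply: Ck_mul; [exact: openT|exact: Ck_cst|exact: Ck_coord].
  - apply: Ck_mul; [exact: openT|exact: Ck_cst|].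
    apply: Ck_add; [exact: openT| |by apply: Ck_opp; [exact: openT|exact: cX]].
    by apply: Ck_add; [exact: openT|exact: Ck_cst|apply: Ck_opp; [exact: openT|exact: cX]].
have sE x i : stereo e x 0 i = N i x / q x.
  by case: i => -[|[|[|//]]] Hi; rewrite /N/stereo mxE.
have cs n : Ck n setT (stereo e).
  apply/Ck_mx; first exact: openT.
  move=> j i; rewrite (ord1 j) (_ : (fun _ => _) = fun x => N i x * (q x)^-1).
    by apply: Ck_mul => //; exact: openT.
  by apply/funext => x; rewrite sE.
have dq x : differentiable q x by exact: (Ck_diff (cq 0%N)).
have dN i x : differentiable (N i) x by exact: (Ck_diff (cN 0%N i)).
have z1 x : 1 + e * stereo e x 0 i32 = 2 / q x.
  rewrite sE /N/= mulrA mulrA -expr2 e2 mul1r -{1}(divff (qn0 x)) -mulrDl.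
  by congr (_ / _); rewrite /q; ring.
have inv1 x : stereo e x 0 i30 / (1 + e * stereo e x 0 i32) = x 0 0.
  by rewrite z1 sE /N/=; field; rewrite qn0.
have inv2 x : stereo e x 0 i31 / (1 + e * stereo e x 0 i32) = x 0 1.
  by rewrite z1 sE /N/=; field; rewrite qn0.
split.
- exact: openT.
- exact/smooth_openP.
- move=> x v _ Dv0.
  (* This is the quotient rule for a vanishing derivative of N / q. For the height z, where N = e (2
     - q), it yields (1 + e z) D q = 0 with 1 + e z = 2 / q nonzero; hence D q = 0, and the other
     two numerators then give v = 0. *)
  have key i : 'D_v (N i) x = N i x / q x * 'D_v q x.
    have ds : differentiable (stereo e) x by exact: (Ck_diff (cs 0%N)).
    have := derive_mxE v 0 i ds; rewrite Dv0 mxE.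
    rewrite (_ : (fun _ => _) = fun x => N i x * (q x)^-1); last first.
      by apply/funext => y; rewrite sE.
    rewrite derive_fM//; last by apply: dfV.
    rewrite derive_fV// => h.
    have : q x * 0 = q x * (N i x * (- q x ^- 2 * 'D_v q x) + (q x)^-1 * 'D_v (N i) x) by rewrite h.
    rewrite mulr0 mulrDr mulVKf// => h2.
    apply/eqP; rewrite -subr_eq0; apply/eqP; rewrite [RHS]h2; field.
    by rewrite qn0.
  have k0 := key i30; have k1 := key i31; have k2 := key i32.
  have D2 : 'D_v (N i32) x = - e * 'D_v q x.
    rewrite (_ : N i32 = fun y => e * 2 + - e * q y); last first.
      by apply/funext => y; rewrite /N/q/=; ring.
    rewrite derive_fD//; last by apply: dfM.
    rewrite derive_cst add0r derive_fM//.
    by rewrite derive_cst mulr0 addr0.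
  have Dq : 'D_v q x = 0.
    have : e * ('D_v q x * (2 / q x)) = 0.
      rewrite -z1 sE mulrDr mulrDr.
      have -> : e * ('D_v q x * (e * (N i32 x / q x))) = e ^+ 2 * (N i32 x / q x * 'D_v q x) by ring.
      by rewrite -k2 D2 e2; ring.
    by move/eqP; rewrite !mulf_eq0 (negbTE e0) invr_eq0 (negbTE (qn0 x)) pnatr_eq0 /= !orbF => /eqP.
  have D0 (i : 'I_2) : 'D_v (fun y : 'rV[R]_2 => 2 * y 0 i) x = 2 * v 0 i.
    rewrite derive_fM//; last exact: differentiable_coord.
    by rewrite derive_coord derive_cst mulr0 addr0.
  apply/rowP => -[[|[|//]] Hi]; rewrite mxE.
  + move: k0; rewrite Dq mulr0 /N/= D0 => /eqP; rewrite mulf_eq0 pnatr_eq0/= => /eqP v0.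
    by rewrite -[RHS]v0; congr (v _ _); exact: val_inj.
  + move: k1; rewrite Dq mulr0 /N/= D0 => /eqP; rewrite mulf_eq0 pnatr_eq0/= => /eqP v0.
    by rewrite -[RHS]v0; congr (v _ _); exact: val_inj.
- move=> x y _ _ exy; apply/rowP => -[[|[|//]] Hi].
    rewrite (_ : Ordinal Hi = 0); last exact: val_inj.
    by rewrite -inv1 -[RHS]inv1 exy.
  rewrite (_ : Ordinal Hi = 1); last exact: val_inj.
  by rewrite -inv2 -[RHS]inv2 exy.
- move=> x _; split.
    apply/S2E; rewrite !sE /N/= !exprMn exprVn -!mulrDl e2.
    by rewrite (_ : _ + _ = q x ^+ 2) ?divff ?expf_neq0//; rewrite /q; ring.
  pose w (p : 'rV[R]_3) := 1 + e * p 0 i32.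
  exists (fun p : 'rV[R]_3 => \row_(i < 2) [:: p 0 i30 / w p; p 0 i31 / w p]`_i).
  have w0 : w (stereo e x) != 0.
    by rewrite /w z1 mulf_neq0 ?invr_neq0// pnatr_eq0.
  have dc3 (i : 'I_3) p : differentiable (fun x : 'rV[R]_3 => x 0 i : R) p.
    exact: differentiable_coord.
  have dw p : differentiable w p by apply: dfD => //; exact: dfM.
  split.
  + apply: differentiable_continuous; apply: differentiable_mx => i -[[|[|//]] Hj].
      rewrite (_ : (fun _ => _) = fun p : 'rV[R]_3 => p 0 i30 / w p).
        by apply: dfM => //; exact: dfV.
      by apply/funext => p; rewrite mxE.
    rewrite (_ : (fun _ => _) = fun p : 'rV[R]_3 => p 0 i31 / w p).
      by apply: dfM => //; exact: dfV.
    by apply/funext => p; rewrite mxE.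
  + apply/rowP => -[[|[|//]] Hi]; rewrite mxE [LHS]/= ?inv1 ?inv2; congr (x _ _); exact: val_inj.
  + have nw : \forall p \near stereo e x, w p != 0.
      exact: near_neq0 (dw _) _.
    near=> p; move=> /S2E Sp; have wp : w p != 0 by near: p.
    set chi := \row_i _.
    have ch0 : chi 0 0 = p 0 i30 / w p by rewrite mxE.
    have ch1 : chi 0 1 = p 0 i31 / w p by rewrite mxE.
    have xy : p 0 i30 ^+ 2 + p 0 i31 ^+ 2 = w p * (1 - e * p 0 i32).
      rewrite /w (_ : _ * _ = 1 - e ^+ 2 * p 0 i32 ^+ 2); last by ring.
      by rewrite e2 mul1r -Sp; ring.
    have qc : q chi = 2 / w p.
      rewrite /q ch0 ch1 !exprMn -addrA -mulrDl xy exprVn.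
      by rewrite /w in wp *; field.
    have q1 : 1 - chi 0 0 ^+ 2 - chi 0 1 ^+ 2 = 2 - q chi by rewrite /q; ring.
    apply/rowP => i; rewrite sE /N q1 ch0 ch1 qc.
    have w2 : 2 != 0 :> R by rewrite pnatr_eq0.
    case: i => -[|[|[|//]]] Hi /=.
    * rewrite (_ : Ordinal Hi = i30); last exact: val_inj.
      by field; rewrite wp.
    * rewrite (_ : Ordinal Hi = i31); last exact: val_inj.
      by field; rewrite wp.
    * rewrite (_ : Ordinal Hi = i32); last exact: val_inj.
      have -> : 2 - 2 / w p = 2 * e * p 0 i32 / w p.
        by rewrite -{1}(divff wp) /w; field; exact: wp.
      by transitivity (e ^+ 2 * p 0 i32); [field; rewrite wp|rewrite e2 mul1r].
Unshelve. all: by end_near. Qed.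

End ConcreteCharts.

(** * Pullbacks of warped metrics *)

Section Pullbacks.
Context {R : realType}.

Lemma eq_mulmxl m n (A B : 'M[R]_(m, n)) :
  (forall v : 'rV_m, v *m A = v *m B) -> A = B.
Proof. by move=> AB; apply/row_matrixP => i; rewrite !rowE AB. Qed.

Lemma jacobian_prodchart m1 m2 n1 n2 (psi1 : 'rV[R]_m1 -> 'rV[R]_n1)
    (psi2 : 'rV[R]_m2 -> 'rV[R]_n2) (x : 'rV[R]_(m1 + m2)) :
  differentiable psi1 (lsubmx x) -> differentiable psi2 (rsubmx x) ->
  'J (prodchart psi1 psi2) x =
  block_mx ('J psi1 (lsubmx x)) 0 0 ('J psi2 (rsubmx x)).
Proof.
move=> d1 d2; apply: eq_mulmxl => v.
have dp : differentiable (prodchart psi1 psi2) x.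
  apply: differentiable_mx => i j; rewrite (ord1 i).
  case: (splitP j) => k jk.
    rewrite (_ : (fun _ => _) = fun y : 'rV[R]_(m1 + m2) => psi1 (lsubmx y) 0 k).
      apply: (differentiable_mxE (f := psi1 \o lsubmx)).
      by apply: differentiable_comp => //; exact: differentiable_lsubmx.
    by apply/funext => y; rewrite (_ : j = lshift _ k) ?row_mxEl//; exact: val_inj.
  rewrite (_ : (fun _ => _) = fun y : 'rV[R]_(m1 + m2) => psi2 (rsubmx y) 0 k).
    apply: (differentiable_mxE (f := psi2 \o rsubmx)).
    by apply: differentiable_comp => //; exact: differentiable_rsubmx.
  by apply/funext => y; rewrite (_ : j = rshift _ k) ?row_mxEr//; exact: val_inj.
rewrite -deriveEjacobian// derive_prodchart// !deriveEjacobian//.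
by rewrite -[in RHS](hsubmxK v) mul_row_block !mulmx0 addr0 add0r.
Qed.

Lemma pullback_warped m1 m2 (phi : 'rV[R]_3 -> R) (h : 'rV[R]_3 -> 'M[R]_3)
    (psi1 : 'rV[R]_m1 -> 'rV[R]_3) (psi2 : 'rV[R]_m2 -> 'rV[R]_2)
    (x : 'rV[R]_(m1 + m2)) :
  differentiable psi1 (lsubmx x) -> differentiable psi2 (rsubmx x) ->
  pullback (warped phi h) (prodchart psi1 psi2) x =
  block_mx (phi (psi1 (lsubmx x)) ^- 2 *: pullback h psi1 (lsubmx x)) 0
    0 (phi (psi1 (lsubmx x)) ^+ 2 *:
       ('J psi2 (rsubmx x) *m ('J psi2 (rsubmx x))^T)).
Proof.
move=> d1 d2; rewrite /pullback jacobian_prodchart//.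
rewrite /warped /prodchart row_mxKl mulmx_block tr_block_mx mulmx_block.
rewrite !(trmx0, mulmx0, mul0mx, addr0, add0r) mul_mx_scalar -!scalemxAl.
by rewrite -!scalemxAr -!scalemxAl.
Qed.

Lemma derive_circ (x v : 'rV[R]_1) :
  'D_v circ x = v 0 0 *: \row_(i < 2) [:: - sin (x 0 0); cos (x 0 0)]`_i.
Proof.
have dc : differentiable circ x.
  have [_ sc _ _ _] := circ_chart (x 0 0).
  apply: (smooth_open_diff sc); rewrite /= subrr normr0; exact: pi_gt0.
have dx : differentiable (fun x : 'rV[R]_1 => x 0 0 : R) x.
  exact: differentiable_coord.
apply/rowP => j; rewrite derive_mxE//; case: j => -[|[|//]] Hj; rewrite !mxE/=.
- rewrite (_ : (fun _ => _) = fun y : 'rV[R]_1 => cos (y 0 0)); last first.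
    by apply/funext => y; rewrite mxE.
  by rewrite derive_fcos// derive_coord mulrN.
- rewrite (_ : (fun _ => _) = fun y : 'rV[R]_1 => sin (y 0 0)); last first.
    by apply/funext => y; rewrite mxE.
  by rewrite derive_fsin// derive_coord.
Qed.

Lemma differentiable_circ (x : 'rV[R]_1) : differentiable circ x.
Proof.
have [_ sc _ _ _] := circ_chart (x 0 0).
apply: (smooth_open_diff sc); rewrite /= subrr normr0; exact: pi_gt0.
Qed.

Lemma jacobian_circ (x : 'rV[R]_1) :
  'J circ x = \row_(i < 2) [:: - sin (x 0 0); cos (x 0 0)]`_i.
Proof.
apply: eq_mulmxl => v; rewrite -deriveEjacobian; last exact: differentiable_circ.
by rewrite derive_circ {2}[v]mx11_scalar mul_scalar_mx.
Qed.

Lemma jacobian_circ_gram (x : 'rV[R]_1) : 'J circ x *m ('J circ x)^T = 1%:M.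
Proof.
apply/matrixP => i j; rewrite !ord1 jacobian_circ !mxE big_ord_recl big_ord1.
by rewrite !mxE/= -!expr2 sqrrN addrC cos2Dsin2.
Qed.

(** A point as a manifold of dimension 0: the slice over it can then be handled by the product
    constructions, like the product of the sphere with the circle. *)
Definition ptchart (q : 'rV[R]_2) : 'rV[R]_0 -> 'rV[R]_2 := fun=> q.

Lemma pt_chart (q : 'rV[R]_2) : good_chart [set q] setT (ptchart q).
Proof.
split.
- exact: openT.
- by apply/smooth_openP => n; exact: Ck_cst.
- by move=> x v _ _; apply/rowP => -[].
- by move=> x y _ _ _; apply/rowP => -[].
- move=> x _; split=> //; exists (fun=> x); split=> //; first exact: cst_continuous.
  by near=> p => /= ->.
Unshelve. all: by end_near. Qed.

(** The left inverse [B] is differentiable on the whole ambient space: composed with the local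
    inverses of the chart it gives new ones, and its differential recovers the derivative of [psi]
    from that of [E \o psi]. Circles of latitude are obtained in this way from the unit circle. *)
Lemma good_chart_embed m n n' (S : set 'rV[R]_n) (U : set 'rV[R]_m) psi
    (E : 'rV[R]_n -> 'rV[R]_n') (B : 'rV[R]_n' -> 'rV[R]_n) :
  (forall k, Ck k setT E) -> (forall p, differentiable B p) -> cancel E B ->
  good_chart S U psi -> good_chart (E @` S) U (E \o psi).
Proof.
move=> cE dB EB [ oU sU dU iU cU].
have dE p : differentiable E p by exact: (Ck_diff (cE 0%N)).
split=> //.
- apply/smooth_openP => k; apply/Ck_mx => // i j; rewrite (ord1 i).
  apply: (Ck_comp (F := fun q => E q 0 j) (D := setT)) => //.
    by move/(Ck_mx _ _ openT) : (cE k); exact.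
  by move/smooth_openP : sU; exact.
- move=> x v Ux Dv0; apply: (dU x) => //.
  have dpsi : differentiable psi x by exact: smooth_open_diff sU Ux.
  have : 'D_v psi x = 'D_('D_v (E \o psi) x) B (E (psi x)).
    have pE : B \o (E \o psi) = psi by apply/funext => y /=; rewrite EB.
    by rewrite -(derive_comp _ (differentiable_comp dpsi (dE _)))// pE.
  by rewrite Dv0 derive0.
- by move=> x y xU yU /(can_inj EB); exact: iU.
- move=> x /cU[Sx [chi [cc cx nx]]]; split; first by exists (psi x).
  exists (chi \o B); split.
  + apply: (@continuous_comp _ _ _ B chi); first exact: differentiable_continuous.
    by rewrite /= EB.
  + by rewrite /= EB.
  + have cB : B @ E (psi x) --> psi x.
      by rewrite -[X in _ --> X]EB; exact: differentiable_continuous (dB _).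
    near=> p => -[q Sq qp]; rewrite /= -qp EB; congr E.
    rewrite -(EB q) qp; have : S (B p) by rewrite -qp EB.
    by near: p; exact: cB nx.
Unshelve. all: by end_near. Qed.

Definition latchart (a r : R) (t : 'rV[R]_1) : 'rV[R]_3 :=
  polar a (row_mx (r%:M : 'rV[R]_1) t : 'rV[R]_(1 + 1)).

Lemma row_mx11E (r : R) (t : 'rV[R]_1) :
  ((row_mx (r%:M : 'rV[R]_1) t : 'rV[R]_(1 + 1)) 0 0 = r) *
  ((row_mx (r%:M : 'rV[R]_1) t : 'rV[R]_(1 + 1)) 0 1 = t 0 0).
Proof.
split.
  rewrite (_ : 0 = lshift 1 0 :> 'I_(1 + 1)); last exact: val_inj.
  by rewrite row_mxEl mxE eqxx.
rewrite (_ : 1 = rshift 1 0 :> 'I_(1 + 1)); last exact: val_inj.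
by rewrite row_mxEr.
Qed.

Lemma lat_chart (a r c : R) : 0 < r -> r < a ->
  good_chart [set p | exists t, p = latchart a r t]
    [set x : 'rV[R]_1 | `|x 0 0 - c| < pi] (latchart a r).
Proof.
move=> r0 ra; have s0 : 0 < sin (pi * r / a).
  by apply: sin_gt0_pi; exact: polar_angle_in.
pose s := sin (pi * r / a); pose z := cos (pi * r / a).
pose E (q : 'rV[R]_2) : 'rV[R]_3 := \row_(i < 3) [:: s * q 0 0; s * q 0 1; z]`_i.
pose B (p : 'rV[R]_3) : 'rV[R]_2 := \row_(i < 2) [:: s^-1 * p 0 i30; s^-1 * p 0 i31]`_i.
have latE t : latchart a r t = E (circ t).
  by apply/rowP => -[[|[|[|//]]] Hi]; rewrite mxE/= !row_mx11E /E mxE/= ?mxE.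
rewrite (_ : [set p | _] = E @` (@usphere R 2)); last first.
  apply/seteqP; split=> [_ [t ->]|_ [q Sq <-]] /=.
    exists (circ t); last by rewrite latE.
    by rewrite /usphere/= big_ord_recl big_ord1 !mxE/= cos2Dsin2.
  have S1 : q 0 0 ^+ 2 + q 0 1 ^+ 2 = 1.
    rewrite -Sq big_ord_recl big_ord1; congr (_ + q _ _ ^+ _); exact: val_inj.
  have [w0|w0] := eqVneq (1 + q 0 0 * cos 0 + q 0 1 * sin 0) 0.
    exists (pi%:M); rewrite latE; congr E.
    have q0 : q 0 0 = -1.
      by move: w0; rewrite cos0 sin0 mulr1 mulr0 addr0 => /eqP; rewrite addrC addr_eq0 => /eqP.
    have q1 : q 0 1 = 0.
      by move: S1; rewrite q0 sqrrN expr1n => /eqP; rewrite -subr_eq0 addrC addKr sqrf_eq0 => /eqP.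
    apply/rowP => -[[|[|//]] Hi]; rewrite !mxE/= ?cospi ?sinpi; [rewrite -q0|rewrite -q1];
      congr (q _ _); exact: val_inj.
  have [cq sq] := angle_cos_sin S1 w0.
  exists ((angle 0 (q 0 0) (q 0 1))%:M); rewrite latE; congr E.
  by apply/rowP => -[[|[|//]] Hi]; rewrite !mxE/= ?cq ?sq; congr (q _ _); exact: val_inj.
rewrite (_ : latchart a r = E \o circ); last exact/funext.
have dc n (i : 'I_n) (x : 'rV[R]_n) : differentiable (fun x : 'rV[R]_n => x 0 i : R) x.
  exact: differentiable_coord.
apply: (good_chart_embed (B := B)); last exact: circ_chart.
- move=> k; apply/Ck_mx; first exact: openT.
  move=> i [[|[|[|//]]] Hj].
  + rewrite (_ : (fun _ => _) = fun q : 'rV[R]_2 => s * q 0 0).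
      by apply: Ck_mul; [exact: openT|exact: Ck_cst|exact: Ck_coord].
    by apply/funext => q; rewrite mxE.
  + rewrite (_ : (fun _ => _) = fun q : 'rV[R]_2 => s * q 0 1).
      by apply: Ck_mul; [exact: openT|exact: Ck_cst|exact: Ck_coord].
    by apply/funext => q; rewrite mxE.
  + rewrite (_ : (fun _ => _) = fun q : 'rV[R]_2 => z); first exact: Ck_cst.
    by apply/funext => q; rewrite mxE.
- move=> p; apply: differentiable_mx => i [[|[|//]] Hj].
  + rewrite (_ : (fun _ => _) = fun q : 'rV[R]_3 => s^-1 * q 0 i30); first exact: dfM.
    by apply/funext => q; rewrite mxE.
  + rewrite (_ : (fun _ => _) = fun q : 'rV[R]_3 => s^-1 * q 0 i31); first exact: dfM.
    by apply/funext => q; rewrite mxE.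
- move=> q; apply/rowP => -[[|[|//]] Hi]; rewrite !mxE/= mulKf ?gt_eqF//;
    congr (q _ _); exact: val_inj.
Qed.

Lemma differentiable_lat (a r : R) t : differentiable (latchart a r) t.
Proof.
apply: (differentiable_comp (f := fun t => row_mx (r%:M : 'rV[R]_1) t : 'rV[R]_(1 + 1))
  (g := polar a)); last exact: differentiable_polar.
apply: differentiable_mx => i j; rewrite (ord1 i).
case: (splitP j) => k jk.
  have -> : j = lshift _ k by exact: val_inj.
  rewrite (_ : (fun _ => _) = cst r)//.
  by apply/funext => y; rewrite row_mxEl (ord1 k) mxE eqxx.
rewrite (_ : (fun _ => _) = fun y : 'rV[R]_1 => y 0 k); first exact: differentiable_coord.
by apply/funext => y; rewrite (_ : j = rshift _ k) ?row_mxEr//; exact: val_inj.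
Qed.

Lemma pullback_lat (a r : R) (h : 'rV[R]_3 -> 'M[R]_3) t :
  pullback h (latchart a r) t =
  (pullback h (polar a) (row_mx (r%:M : 'rV[R]_1) t : 'rV[R]_(1 + 1)) 1 1)%:M.
Proof.
set w := row_mx _ _.
pose e1 : 'rV[R]_2 := delta_mx 0 1.
have JE : 'J (latchart a r) t = e1 *m 'J (polar a) w.
  apply: eq_mulmxl => v; rewrite -deriveEjacobian; last exact: differentiable_lat.
  pose f (t : 'rV[R]_1) : 'rV[R]_(1 + 1) := row_mx (r%:M : 'rV[R]_1) t.
  have df : differentiable f t.
    apply: differentiable_mx => i j; rewrite (ord1 i).
    case: (splitP j) => k jk.
      have -> : j = lshift _ k by exact: val_inj.
      rewrite (_ : (fun _ => _) = cst r)//.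
      by apply/funext => y; rewrite row_mxEl (ord1 k) mxE eqxx.
    rewrite (_ : (fun _ => _) = fun y : 'rV[R]_1 => y 0 k); first exact: differentiable_coord.
    by apply/funext => y; rewrite (_ : j = rshift _ k) ?row_mxEr//; exact: val_inj.
  rewrite (derive_comp (f := f) (F := polar a)) => //; last exact: differentiable_polar.
  rewrite deriveEjacobian; last exact: differentiable_polar.
  rewrite mulmxA; congr (_ *m _).
  rewrite derive_row_mx//.
  rewrite derive_cst derive_id; apply/rowP => -[[|[|//]] Hj].
    rewrite (_ : Ordinal Hj = lshift 1 0); last exact: val_inj.
    by rewrite row_mxEl !mxE big_ord1 !mxE/= mulr0.
  rewrite (_ : Ordinal Hj = rshift 1 0); last exact: val_inj.
  by rewrite row_mxEr !mxE big_ord1 !mxE/= mulr1.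
rewrite /pullback JE.
have -> : e1 *m 'J (polar a) w *m h (latchart a r t) *m (e1 *m 'J (polar a) w)^T =
    e1 *m ('J (polar a) w *m h (polar a w) *m ('J (polar a) w)^T) *m e1^T.
  by rewrite trmx_mul !mulmxA.
set P := _ *m h _ *m _.
rewrite [LHS]mx11_scalar; congr (_%:M).
by rewrite /e1 trmx_delta -rowE -colE mxE mxE.
Qed.

End Pullbacks.

(** * Scalar curvature *)

Lemma invmx_diag (R : realType) n (d e : 'rV[R]_n) :
  (forall i, d 0 i * e 0 i = 1) -> invmx (diag_mx d) = diag_mx e.
Proof.
move=> de; have de1 : diag_mx d *m diag_mx e = 1%:M.
  rewrite mulmx_diag -diag_const_mx; congr diag_mx.
  by apply/rowP => i; rewrite !mxE de.
have [ud _] := mulmx1_unit de1.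
by rewrite -[RHS]mul1mx -(mulVmx ud) -mulmxA de1 mulmx1.
Qed.

Section WarpedCurvature.
Context {R : realType} (Om : set 'rV[R]_3) (I : set R) (F : 'rV[R]_3 -> R)
  (u : R -> R) (gam : 'rV[R]_3 -> 'M[R]_3).
Hypotheses (oOm : open Om) (OmI : forall x : 'rV[R]_3, Om x -> I (x 0 0)) (oI : open I)
  (cF : Ck 2 Om F) (cu : Ck 2 I u)
  (F0 : forall x, Om x -> F x != 0) (u0 : forall r, I r -> u r != 0)
  (F2 : forall x, Om x -> partial i32 F x = 0)
  (gamE : forall x, Om x -> gam x = diag_mx (\row_(i < 3)
     [:: F x ^- 2; F x ^- 2 * u (x 0 0) ^+ 2; F x ^+ 2]`_i)).

Let U (x : 'rV[R]_3) : R := u (x 0 0).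
Let U1 (x : 'rV[R]_3) : R := 'D_1 u (x 0 0).
Let Fa := partial i30 F.
Let Fb := partial i31 F.

(** The symbols Gamma^k_(ij) of F^-2 (dr^2 + u^2 dtheta^2) + F^2 dxi^2. The indices are natural
    numbers so that the match reduces on numerals, and powers are spelled out as products and
    inverses so that the rules for derivatives of products and inverses rewrite them directly. *)
Definition chris (k i j : nat) (x : 'rV[R]_3) : R :=
  match k, i, j with
  | 0, 0, 0 => - (Fa x * (F x)^-1)
  | 0, 0, 1 | 0, 1, 0 => - (Fb x * (F x)^-1)
  | 0, 1, 1 => Fa x * (F x)^-1 * (U x * U x) - U x * U1 x
  | 0, 2, 2 => - (Fa x * (F x * F x * F x))
  | 1, 0, 0 => Fb x * (F x)^-1 * ((U x)^-1 * (U x)^-1)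
  | 1, 0, 1 | 1, 1, 0 => - (Fa x * (F x)^-1) + U1 x * (U x)^-1
  | 1, 1, 1 => - (Fb x * (F x)^-1)
  | 1, 2, 2 => - (Fb x * (F x * F x * F x) * ((U x)^-1 * (U x)^-1))
  | 2, 0, 2 | 2, 2, 0 => Fa x * (F x)^-1
  | 2, 1, 2 | 2, 2, 1 => Fb x * (F x)^-1
  | _, _, _ => 0
  end.

Lemma partial_fM (f g : 'rV[R]_3 -> R) i x :
  differentiable f x -> differentiable g x ->
  partial i (fun y => f y * g y) x = f x * partial i g x + g x * partial i f x.
Proof. exact: derive_fM. Qed.

Lemma partial_fD (f g : 'rV[R]_3 -> R) i x :
  differentiable f x -> differentiable g x ->
  partial i (fun y => f y + g y) x = partial i f x + partial i g x.
Proof. exact: derive_fD. Qed.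

Lemma partial_fN (f : 'rV[R]_3 -> R) i x : differentiable f x ->
  partial i (fun y => - f y) x = - partial i f x.
Proof. exact: derive_fN. Qed.

Lemma partial_fV (f : 'rV[R]_3 -> R) i x : f x != 0 -> differentiable f x ->
  partial i (fun y => (f y)^-1) x = - (f x ^- 2) * partial i f x.
Proof. exact: derive_fV. Qed.

Lemma partial_near (f g : 'rV[R]_3 -> R) i x : Om x ->
  (forall y, Om y -> f y = g y) -> partial i f x = partial i g x.
Proof. by move=> Ox fg; apply: near_eq_derive; exact: near_open Ox fg. Qed.

Let dF x : Om x -> differentiable F x.
Proof. exact: Ck_diff cF. Qed.

Let dFa x : Om x -> differentiable Fa x.
Proof. have [_ /(_ (delta_mx 0 i30))[+ _]] := cF; exact. Qed.

Let dFb x : Om x -> differentiable Fb x.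
Proof. have [_ /(_ (delta_mx 0 i31))[+ _]] := cF; exact. Qed.

Let du r : I r -> differentiable u r.
Proof. exact: Ck_diff cu. Qed.

Let du1 r : I r -> differentiable ('D_1 u) r.
Proof. have [_ /(_ 1)[+ _]] := cu; exact. Qed.

Let dx0 (x : 'rV[R]_3) : differentiable (fun x : 'rV[R]_3 => x 0 0 : R) x.
Proof. exact: differentiable_coord. Qed.

Let dU x : Om x -> differentiable U x.
Proof. by move=> /OmI Ix; apply: differentiable_comp; [exact: dx0|exact: du]. Qed.

Let dU1 x : Om x -> differentiable U1 x.
Proof. by move=> /OmI Ix; apply: (differentiable_comp (f := fun y : 'rV[R]_3 => y 0 0 : R) (g := 'D_1 u)); [exact: dx0|exact: du1]. Qed.

Let de (i : 'I_3) : (delta_mx 0 i : 'rV[R]_3) 0 0 = (i == 0)%:R.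
Proof. by rewrite mxE eqxx eq_sym. Qed.

Let DU i x : Om x -> partial i U x = (i == 0)%:R * U1 x.
Proof.
move=> /OmI Ix; rewrite /partial /U derive_comp1; [|exact: dx0|exact: du].
by rewrite derive_coord de.
Qed.

Let DU1 i x : Om x -> partial i U1 x = (i == 0)%:R * 'D_1 ('D_1 u) (x 0 0).
Proof.
move=> /OmI Ix; rewrite /partial /U1 (derive_comp1 (f := fun y : 'rV[R]_3 => y 0 0 : R) (F := 'D_1 u)); [|exact: dx0|exact: du1].
by rewrite derive_coord de.
Qed.

Let ginv x : Om x -> invmx (gam x) = diag_mx (\row_(i < 3)
  [:: F x ^+ 2; F x ^+ 2 * U x ^- 2; F x ^- 2]`_i).
Proof.
move=> Ox; rewrite gamE//; apply: invmx_diag => -[[|[|[|//]]] Hi]; rewrite !mxE/=.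
- by rewrite mulVf// expf_neq0// F0.
- by rewrite /U; field; rewrite F0// u0//; exact: OmI.
- by rewrite mulfV// expf_neq0// F0.
Qed.

Definition gdiag (k : nat) (x : 'rV[R]_3) : R :=
  [:: (F x)^-1 * (F x)^-1; (F x)^-1 * (F x)^-1 * (U x * U x); F x * F x]`_k.

Definition dgdiag (l k : nat) (x : 'rV[R]_3) : R :=
  let Fl := [:: Fa x; Fb x; 0]`_l in let Ul := [:: U1 x; 0; 0]`_l in
  [:: - 2 * Fl * (F x)^-1 ^+ 3;
      - 2 * Fl * (F x)^-1 ^+ 3 * U x ^+ 2 + 2 * (F x)^-1 ^+ 2 * U x * Ul;
      2 * F x * Fl]`_k.

Lemma partial_gam (l i j : 'I_3) x : Om x ->
  partial l (fun y => gam y i j) x = (i == j)%:R * dgdiag l i x.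
Proof.
move=> Ox; have FO := F0 Ox; have UO : U x != 0 by apply: u0; exact: OmI.
have dFx := dF Ox; have dUx := dU Ox.
rewrite (@partial_near _ (fun y => (i == j)%:R * gdiag i y))//; last first.
  move=> y Oy; rewrite gamE// !mxE.
  have [->|_] := eqVneq i j; last by rewrite mulr0n mul0r.
  rewrite mulr1n mul1r; case: j => -[|[|[|//]]] Hj; rewrite /gdiag/= -?expr2 ?exprVn//.
have dV : differentiable (fun y => (F y)^-1) x by exact: dfV.
have DF m : partial m F x = [:: Fa x; Fb x; 0]`_m.
  case: m => -[|[|[|//]]] Hm.
  - by rewrite /Fa; congr (partial _ F x); exact: val_inj.
  - by rewrite /Fb; congr (partial _ F x); exact: val_inj.
  - by rewrite -[RHS](F2 Ox); congr (partial _ F x); exact: val_inj.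
have DUx : partial l U x = [:: U1 x; 0; 0]`_l.
  by rewrite DU//; case: l => -[|[|[|//]]] Hl; rewrite /= ?mul1r ?mul0r.
have DV : partial l (fun y => (F y)^-1) x = - (F x ^- 2) * [:: Fa x; Fb x; 0]`_l.
  by rewrite partial_fV// DF.
rewrite partial_fM//; last first.
  case: i => -[|[|[|//]]] Hi; rewrite /gdiag/=.
  - exact: dfM.
  - by apply: dfM; [exact: dfM|exact: dfM].
  - exact: dfM.
rewrite {2}/partial derive_cst mulr0 addr0; congr (_ * _).
case: i => -[|[|[|//]]] Hi; rewrite /gdiag /dgdiag [nth _ _ _]/=.
- by rewrite partial_fM// DV/= exprVn; field.
- rewrite partial_fM; [|exact: dfM|exact: dfM].
  rewrite partial_fM// (partial_fM _ dV)// DV DUx/=; field.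
  by rewrite FO.
- by rewrite partial_fM// DF; rewrite /=; ring.
Qed.

Lemma christoffelE (k i j : 'I_3) x : Om x ->
  christoffel gam k i j x = chris k i j x.
Proof.
move=> Ox; have FO := F0 Ox; have UO : U x != 0 by apply: u0; exact: OmI.
rewrite /christoffel (bigD1 k)//= big1 ?addr0; last first.
  by move=> l lk; rewrite ginv// !mxE eq_sym (negbTE lk) mulr0n mul0r.
rewrite !partial_gam// ginv// !mxE eqxx mulr1n.
case: k => -[|[|[|//]]] Hk; case: i => -[|[|[|//]]] Hi; case: j => -[|[|[|//]]] Hj;
  rewrite /dgdiag /chris /eq_op/=; field; by rewrite ?FO ?UO.
Qed.

(** No second derivative of [F] survives: the opposite exponents of [F] on the base and on the
    circle make the terms [f00] and [f11] cancel in the trace. This is why nonnegative scalar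
    curvature, divided by 2 F^2, becomes a pointwise bound on the gradient of ln F by - u'' / u. *)
Lemma scalar_curvature_warped x : Om x ->
  scalar_curvature gam x = 2 * (- (F x ^+ 2 * 'D_1 ('D_1 u) (x 0 0) / u (x 0 0))
    - partial i30 F x ^+ 2 - partial i31 F x ^+ 2 / u (x 0 0) ^+ 2).
Proof.
move=> Ox; have FO := F0 Ox; have UO : U x != 0 by apply: u0; exact: OmI.
have dFx := dF Ox; have dUx := dU Ox; have dU1x := dU1 Ox.
have dFax := dFa Ox; have dFbx := dFb Ox.
have dV : differentiable (fun y => (F y)^-1) x by exact: dfV.
have dUV : differentiable (fun y => (U y)^-1) x by exact: dfV.
have dUU : differentiable (fun y => (U y)^-1 * (U y)^-1) x by exact: dfM.
have dUxU : differentiable (fun y => U y * U y) x by exact: dfM.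
have dFF : differentiable (fun y => F y * F y) x by exact: dfM.
have dFFF : differentiable (fun y => F y * F y * F y) x by exact: dfM.
have dFaV : differentiable (fun y => Fa y * (F y)^-1) x by exact: dfM.
have dFbV : differentiable (fun y => Fb y * (F y)^-1) x by exact: dfM.
have Pc (i k l m : 'I_3) : partial i (christoffel gam k l m) x =
    partial i (chris k l m) x.
  by apply: partial_near => // y Oy; exact: christoffelE.
have P0 i : partial i (fun=> 0 : R) x = 0 by exact: derive_cst.
(* [T i j] below is the component R^i_(jij), and [q] gives its quadratic terms. As the inverse
   metric is diagonal, these components determine the scalar curvature. *)
pose q (s i j : 'I_3) := chris i i s x * chris s j j x - chris i j s x * chris s i j x.
pose T (i j : 'I_3) := partial i (chris i j j) x - partial j (chris i i j) x +
  (q i30 i j + q i31 i j + q i32 i j).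
have riemE i j : riemann gam i j i j x = T i j.
  rewrite /riemann !Pc /T; congr (_ + _).
  by rewrite sum3E !christoffelE.
have ricciE j : ricci gam j j x = T i30 j + T i31 j + T i32 j.
  by rewrite /ricci sum3E !riemE.
have scE : scalar_curvature gam x = F x ^+ 2 * (T i30 i30 + T i31 i30 + T i32 i30) +
    F x ^+ 2 * U x ^- 2 * (T i30 i31 + T i31 i31 + T i32 i31) +
    F x ^- 2 * (T i30 i32 + T i31 i32 + T i32 i32).
  rewrite /scalar_curvature.
  have -> : \sum_(j < 3) \sum_(k < 3) invmx (gam x) j k * ricci gam j k x =
      \sum_(j < 3) invmx (gam x) j j * ricci gam j j x.
    apply: eq_bigr => j _; rewrite (bigD1 j)//= big1 ?addr0// => k kj.
    by rewrite ginv// !mxE eq_sym (negbTE kj) mulr0n mul0r.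
  by rewrite sum3E !ricciE ginv// !mxE eqxx !mulr1n.
have Tii i : T i i = 0 by rewrite /T /q !subrr !addr0.
set f00 := partial i30 Fa x; set f11 := partial i31 Fb x.
set u2 := 'D_1 ('D_1 u) (x 0 0).
have z0 : i30 == 0 by [].
have D0U : partial i30 U x = U1 x by rewrite DU// mul1r.
have D0U1 : partial i30 U1 x = u2 by rewrite DU1// mul1r.
have D1U : partial i31 U x = 0 by rewrite DU// mul0r.
have D0F : partial i30 F x = Fa x by [].
have D1F : partial i31 F x = Fb x by [].
have E011 : partial i30 (chris i30 i31 i31) x = f00 / F x * U x ^+ 2 - Fa x ^+ 2 / F x ^+ 2 * U x ^+ 2
    + 2 * Fa x / F x * U x * U1 x - U1 x ^+ 2 - U x * u2.
  have -> : chris i30 i31 i31 = (fun y => Fa y * (F y)^-1 * (U y * U y) + - (U y * U1 y)) by [].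
  rewrite (partial_fD i30 (dfM dFaV dUxU) (dfN (dfM dUx dU1x))).
  rewrite (partial_fN i30 (dfM dUx dU1x)) (partial_fM i30 dFaV dUxU).
  rewrite (partial_fM i30 dFax dV) (partial_fM i30 dUx dUx) (partial_fM i30 dUx dU1x).
  rewrite (partial_fV i30 FO dFx) D0U D0U1 D0F -/f00; field.
  by rewrite FO.
have E022 : partial i30 (chris i30 i32 i32) x = - (f00 * F x ^+ 3) - 3 * Fa x ^+ 2 * F x ^+ 2.
  have -> : chris i30 i32 i32 = (fun y => - (Fa y * (F y * F y * F y))) by [].
  rewrite (partial_fN i30 (dfM dFax dFFF)) (partial_fM i30 dFax dFFF).
  by rewrite (partial_fM i30 dFF dFx) (partial_fM i30 dFx dFx) D0F -/f00; ring.
have E100 : partial i31 (chris i31 i30 i30) x = f11 / F x / U x ^+ 2 - Fb x ^+ 2 / F x ^+ 2 / U x ^+ 2.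
  have -> : chris i31 i30 i30 = (fun y => Fb y * (F y)^-1 * ((U y)^-1 * (U y)^-1)) by [].
  rewrite (partial_fM i31 dFbV dUU) (partial_fM i31 dFbx dV) (partial_fM i31 dUV dUV).
  rewrite (partial_fV i31 FO dFx) (partial_fV i31 UO dUx) D1U D1F -/f11; field.
  by rewrite FO UO.
have E122 : partial i31 (chris i31 i32 i32) x =
    - (f11 * F x ^+ 3 / U x ^+ 2) - 3 * Fb x ^+ 2 * F x ^+ 2 / U x ^+ 2.
  have -> : chris i31 i32 i32 = (fun y => - (Fb y * (F y * F y * F y) * ((U y)^-1 * (U y)^-1))) by [].
  rewrite (partial_fN i31 (dfM (dfM dFbx dFFF) dUU)) (partial_fM i31 (dfM dFbx dFFF) dUU).
  rewrite (partial_fM i31 dFbx dFFF) (partial_fM i31 dFF dFx) (partial_fM i31 dFx dFx).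
  rewrite (partial_fM i31 dUV dUV) (partial_fV i31 UO dUx) D1U D1F -/f11; field.
  by rewrite UO.
have E001 : partial i31 (chris i30 i30 i31) x = - (f11 / F x) + Fb x ^+ 2 / F x ^+ 2.
  have -> : chris i30 i30 i31 = (fun y => - (Fb y * (F y)^-1)) by [].
  rewrite (partial_fN i31 dFbV) (partial_fM i31 dFbx dV) (partial_fV i31 FO dFx).
  rewrite D1F -/f11; field.
  by rewrite FO.
have E110 : partial i30 (chris i31 i31 i30) x = - (f00 / F x) + Fa x ^+ 2 / F x ^+ 2 +
   u2 / U x - U1 x ^+ 2 / U x ^+ 2.
  have -> : chris i31 i31 i30 = (fun y => - (Fa y * (F y)^-1) + U1 y * (U y)^-1) by [].
  rewrite (partial_fD i30 (dfN dFaV) (dfM dU1x dUV)) (partial_fN i30 dFaV).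
  rewrite (partial_fM i30 dFax dV) (partial_fM i30 dU1x dUV).
  rewrite (partial_fV i30 FO dFx) (partial_fV i30 UO dUx) D0U D0U1 D0F -/f00; field.
  by rewrite FO UO.
have E220 : partial i30 (chris i32 i32 i30) x = f00 / F x - Fa x ^+ 2 / F x ^+ 2.
  have -> : chris i32 i32 i30 = (fun y => Fa y * (F y)^-1) by [].
  rewrite (partial_fM i30 dFax dV) (partial_fV i30 FO dFx) D0F -/f00; field.
  by rewrite FO.
have E221 : partial i31 (chris i32 i32 i31) x = f11 / F x - Fb x ^+ 2 / F x ^+ 2.
  have -> : chris i32 i32 i31 = (fun y => Fb y * (F y)^-1) by [].
  rewrite (partial_fM i31 dFbx dV) (partial_fV i31 FO dFx) D1F -/f11; field.
  by rewrite FO.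
have chrisE (k i j : 'I_3) : chris k i j = chris (val k) (val i) (val j) by [].
have Z200 : partial i32 (chris i32 i30 i30) x = 0 by exact: P0.
have Z211 : partial i32 (chris i32 i31 i31) x = 0 by exact: P0.
have Z002 : partial i32 (chris i30 i30 i32) x = 0 by exact: P0.
have Z112 : partial i32 (chris i31 i31 i32) x = 0 by exact: P0.
rewrite scE !Tii /T E011 E001 E022 E100 E122 E110 E220 E221 !Z200 ?Z211 ?Z002 ?Z112.
rewrite /q !chrisE /= D0F D1F -/(U x); field.
by rewrite FO UO.
Qed.

End WarpedCurvature.

(** * Mean curvature *)

Lemma jacobian_eq {R : realType} m n (f : 'rV[R]_m -> 'rV[R]_n) x (A : 'M[R]_(m, n)) :
  differentiable f x -> (forall v, 'D_v f x = v *m A) -> 'J f x = A.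
Proof. by move=> df fA; apply: eq_mulmxl => v; rewrite -deriveEjacobian. Qed.

Section Slices.
Context {R : realType}.

Definition slice_param (c : R) (y : 'rV[R]_2) : 'rV[R]_3 :=
  \row_(i < 3) [:: y 0 0; y 0 1; c]`_i.

Definition lat_param (r : R) (y : 'rV[R]_2) : 'rV[R]_3 :=
  \row_(i < 3) [:: r; y 0 0; y 0 1]`_i.

Lemma Ck_slice_param c n : Ck n setT (slice_param c).
Proof.
apply/Ck_mx; [exact: openT|move=> i [[|[|[|//]]] Hj]].
- rewrite (_ : (fun _ => _) = fun y : 'rV[R]_2 => y 0 0); first exact: Ck_coord.
  by apply/funext => y; rewrite mxE.
- rewrite (_ : (fun _ => _) = fun y : 'rV[R]_2 => y 0 1); first exact: Ck_coord.
  by apply/funext => y; rewrite mxE.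
- rewrite (_ : (fun _ => _) = fun y : 'rV[R]_2 => c); first exact: Ck_cst.
  by apply/funext => y; rewrite mxE.
Qed.

Lemma Ck_lat_param c n : Ck n setT (lat_param c).
Proof.
apply/Ck_mx; [exact: openT|move=> i [[|[|[|//]]] Hj]].
- rewrite (_ : (fun _ => _) = fun y : 'rV[R]_2 => c); first exact: Ck_cst.
  by apply/funext => y; rewrite mxE.
- rewrite (_ : (fun _ => _) = fun y : 'rV[R]_2 => y 0 0); first exact: Ck_coord.
  by apply/funext => y; rewrite mxE.
- rewrite (_ : (fun _ => _) = fun y : 'rV[R]_2 => y 0 1); first exact: Ck_coord.
  by apply/funext => y; rewrite mxE.
Qed.

Lemma derive_slice_param c x v :
  'D_v (slice_param c) x = \row_(i < 3) [:: v 0 0; v 0 1; 0]`_i.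
Proof.
have df : differentiable (slice_param c) x by exact: Ck_diff (Ck_slice_param c 0) _.
apply/rowP => j; rewrite derive_mxE// mxE; case: j => -[|[|[|//]]] Hj.
- rewrite (_ : (fun _ => _) = fun y : 'rV[R]_2 => y 0 0); first exact: derive_coord.
  by apply/funext => y; rewrite mxE.
- rewrite (_ : (fun _ => _) = fun y : 'rV[R]_2 => y 0 1); first exact: derive_coord.
  by apply/funext => y; rewrite mxE.
- rewrite (_ : (fun _ => _) = fun y : 'rV[R]_2 => c); first exact: derive_cst.
  by apply/funext => y; rewrite mxE.
Qed.

Lemma derive_lat_param c x v :
  'D_v (lat_param c) x = \row_(i < 3) [:: 0; v 0 0; v 0 1]`_i.
Proof.
have df : differentiable (lat_param c) x by exact: Ck_diff (Ck_lat_param c 0) _.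
apply/rowP => j; rewrite derive_mxE// mxE; case: j => -[|[|[|//]]] Hj.
- rewrite (_ : (fun _ => _) = fun y : 'rV[R]_2 => c); first exact: derive_cst.
  by apply/funext => y; rewrite mxE.
- rewrite (_ : (fun _ => _) = fun y : 'rV[R]_2 => y 0 0); first exact: derive_coord.
  by apply/funext => y; rewrite mxE.
- rewrite (_ : (fun _ => _) = fun y : 'rV[R]_2 => y 0 1); first exact: derive_coord.
  by apply/funext => y; rewrite mxE.
Qed.

Definition slice_mx : 'M[R]_(2, 3) := \matrix_(i < 2, j < 3) (j == i :> nat)%:R.
Definition lat_mx : 'M[R]_(2, 3) := \matrix_(i < 2, j < 3) (j == i.+1 :> nat)%:R.

Lemma sum2E (T : nmodType) (G : 'I_2 -> T) : \sum_(i < 2) G i = G 0 + G 1.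
Proof. by rewrite big_ord_recl big_ord1; congr (_ + G _); exact: val_inj. Qed.

Lemma jacobian_slice c x : 'J (slice_param c) x = slice_mx.
Proof.
apply: jacobian_eq => [|v]; first exact: Ck_diff (Ck_slice_param c 0) _.
rewrite derive_slice_param; apply/rowP => -[[|[|[|//]]] Hj];
  by rewrite !mxE sum2E !mxE/= ?(mulr0, mulr1, addr0, add0r).
Qed.

Lemma jacobian_lat c x : 'J (lat_param c) x = lat_mx.
Proof.
apply: jacobian_eq => [|v]; first exact: Ck_diff (Ck_lat_param c 0) _.
rewrite derive_lat_param; apply/rowP => -[[|[|[|//]]] Hj];
  by rewrite !mxE sum2E !mxE/= ?(mulr0, mulr1, addr0, add0r).
Qed.

(* The immersions are affine, so that their second derivatives vanish. *)
Lemma cov_partial_affine (gam : 'rV[R]_3 -> 'M[R]_3) (f : 'rV[R]_2 -> 'rV[R]_3)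
    (A : 'M[R]_(2, 3)) (e : 'I_2 -> 'I_3) x a b :
  (forall y v, 'D_v f y = v *m A) -> (forall i j, A i j = (j == e i)%:R) ->
  cov_partial gam f a b x = \row_l christoffel gam l (e a) (e b) (f x).
Proof.
move=> fA Ae; have pf c y : partial c f y = \row_j (j == e c)%:R.
  by rewrite /partial fA -rowE; apply/rowP => j; rewrite !mxE Ae.
rewrite /cov_partial.
have -> : partial a (partial b f) x = 0.
  rewrite (_ : partial b f = cst (\row_j (j == e b)%:R)); first exact: derive_cst.
  by apply/funext => y; rewrite pf.
rewrite add0r; apply/rowP => l; rewrite !mxE (bigD1 (e a))//= [X in _ + X]big1 ?addr0.
  rewrite (bigD1 (e b))//= big1 ?addr0.
    by rewrite !pf !mxE !eqxx !mulr1.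
  by move=> j jb; rewrite !pf !mxE (negbTE jb) mulr0.
move=> i ia; rewrite big1// => j _.
by rewrite !pf !mxE (negbTE ia) mulr0 mul0r.
Qed.

(** If the metric has no cross terms with dxi and its coefficients have no xi-derivative along the
    slice, then Gamma^xi_(ab) = 0 for a, b tangent to the slice, which is thus totally geodesic. The
    metric on the base is arbitrary, so that stereographic charts can be used. *)
Lemma mean_curvature_slice (gam : 'rV[R]_3 -> 'M[R]_3) c x nu :
  (forall i, i != i32 -> forall y, gam y i32 i = 0) ->
  (forall i, i != i32 -> forall y, gam y i i32 = 0) ->
  (forall i j, partial i32 (fun y => gam y i j) (slice_param c x) = 0) ->
  normal_to gam (slice_param c) x nu ->
  mean_curvature gam (slice_param c) x nu = 0.
Proof.
set p := slice_param c x => g1 g2 g3; rewrite /normal_to jacobian_slice -/p => nn.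
pose e (i : 'I_2) : 'I_3 := @widen_ord 2 3 isT i.
have fA y v : 'D_v (slice_param c) y = v *m slice_mx.
  rewrite deriveEjacobian ?jacobian_slice//; exact: Ck_diff (Ck_slice_param c 0) _.
have eA i j : slice_mx i j = (j == e i)%:R by rewrite mxE.
have e2 i : e i != i32 by rewrite -val_eqE/= ltn_eqF.
have g1' i : i != i32 -> gam p i32 i = 0 by move=> /g1.
have inv0 l : l != i32 -> invmx (gam p) i32 l = 0.
  (* On a singular matrix [invmx] returns the matrix itself, whose entry is 0 as well. *)
  move=> l2; have [ug|ug] := boolP (gam p \in unitmx); last by rewrite invmx_out// g1'.
  have dr : row i32 (gam p) = gam p i32 i32 *: delta_mx 0 i32.
    apply/rowP => j; rewrite !mxE eqxx /=; have [->|j2] := eqVneq j i32; first by rewrite mulr1.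
    by rewrite mulr0 g1'.
  have h : delta_mx 0 i32 = gam p i32 i32 *: row i32 (invmx (gam p)).
    rewrite [in RHS]rowE scalemxAl -dr rowE -mulmxA mulmxV// mulmx1//.
  have g0 : gam p i32 i32 != 0.
    apply/eqP => z; move: h; rewrite z scale0r => /rowP/(_ i32).
    by rewrite !mxE !eqxx => /eqP; rewrite oner_eq0.
  move/rowP/(_ l) : h; rewrite !mxE (negbTE l2) andbF => /eqP.
  by rewrite eq_sym mulf_eq0 (negbTE g0) => /eqP.
have ch0 a b : christoffel gam i32 (e a) (e b) p = 0.
  rewrite /christoffel big1 ?mulr0// => l _.
  have [->|l2] := eqVneq l i32; last by rewrite inv0// mul0r.
  rewrite g3 subr0.
  have z k : partial (e k) (fun y => gam y (e a) i32) p = 0 /\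
             partial (e k) (fun y => gam y (e b) i32) p = 0.
    by split; [rewrite (_ : (fun _ => _) = cst 0)|rewrite (_ : (fun _ => _) = cst 0)];
      rewrite /partial ?derive_cst//; apply/funext => y; rewrite g2.
  have [_ ->] := z a; have [-> _] := z b.
  by rewrite addr0 mulr0.
have gnu i : i != i32 -> (gam p *m nu^T) i 0 = 0.
  move=> i2; have iv : (i < 2)%N.
    by case: i i2 => -[|[|[|//]]] Hi //; rewrite -val_eqE.
  have := congr1 (fun M : 'cV[R]_2 => M (Ordinal iv) 0) nn.
  rewrite -mulmxA [LHS]mxE (bigD1 i)//= big1 ?addr0.
    by rewrite mxE eqxx mul1r => ->; rewrite mxE.
  by move=> j ji; rewrite mxE/= -[_ == _ :> nat]/(j == i) (negbTE ji) mul0r.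
rewrite /mean_curvature big1// => a _; rewrite big1// => b _.
rewrite (cov_partial_affine gam x a b fA eA) -mulmxA [X in _ * X]mxE big1 ?mulr0//.
move=> l _; rewrite mxE; have [->|l2] := eqVneq l i32.
  by rewrite ch0 mul0r.
by rewrite gnu// mulr0.
Qed.

(** Normal vectors point along r, and the trace of Gamma^r is g^(theta theta) Gamma^r_(theta theta)
    + g^(xi xi) Gamma^r_(xi xi) = (F F_r - F^2 u' / u) - F F_r: the derivatives of [F] cancel and a
    multiple of u' is left. *)
Lemma mean_curvature_lat (Om : set 'rV[R]_3) (I : set R) (F : 'rV[R]_3 -> R)
    (u : R -> R) (gam : 'rV[R]_3 -> 'M[R]_3) (r : R) x nu :
  open Om -> (forall x : 'rV[R]_3, Om x -> I (x 0 0)) -> Ck 2 Om F -> Ck 2 I u ->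
  (forall x, Om x -> F x != 0) -> (forall r, I r -> u r != 0) ->
  (forall x, Om x -> partial i32 F x = 0) ->
  (forall x, Om x -> gam x = diag_mx (\row_(i < 3)
     [:: F x ^- 2; F x ^- 2 * u (x 0 0) ^+ 2; F x ^+ 2]`_i)) ->
  'D_1 u r = 0 -> Om (lat_param r x) ->
  normal_to gam (lat_param r) x nu ->
  mean_curvature gam (lat_param r) x nu = 0.
Proof.
move=> oOm OmI cF cu F0 u0 F2 gamE ur Ox; set p := lat_param r x in Ox *.
rewrite /normal_to jacobian_lat -/p => nn.
pose e (i : 'I_2) : 'I_3 := lift i30 i.
have fA y v : 'D_v (lat_param r) y = v *m lat_mx.
  rewrite deriveEjacobian ?jacobian_lat//; exact: Ck_diff (Ck_lat_param r 0) _.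
have eA i j : lat_mx i j = (j == e i)%:R by rewrite mxE.
have p0 : p 0 0 = r by rewrite mxE.
have FO := F0 _ Ox; have UO : u r != 0 by rewrite -p0; apply: u0; exact: OmI.
have gp := gamE _ Ox.
have gE i j : gam p i j = (i == j)%:R * [:: F p ^- 2; F p ^- 2 * u r ^+ 2; F p ^+ 2]`_i.
  by rewrite gp !mxE -p0; case: eqVneq => [->|_]; rewrite ?mulr1n ?mul1r// mulr0n mul0r.
have gdi (i : 'I_3) : [:: F p ^- 2; F p ^- 2 * u r ^+ 2; F p ^+ 2]`_i != 0.
  case: i => -[|[|[|//]]] Hi /=; by rewrite ?mulf_neq0 ?invr_neq0 ?expf_neq0.
have nu0 (a : 'I_2) : nu 0 (e a) = 0.
  have := congr1 (fun M : 'cV[R]_2 => M a 0) nn.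
  rewrite -mulmxA [LHS]mxE (bigD1 (e a))//= big1 ?addr0.
    rewrite eA eqxx mul1r mxE (bigD1 (e a))//= big1 ?addr0.
      by rewrite gE eqxx mul1r !mxE => /eqP; rewrite mulf_eq0 (negbTE (gdi _)) => /eqP.
    by move=> j ja; rewrite gE eq_sym (negbTE ja) !mul0r.
  by move=> j ja; rewrite eA (negbTE ja) mul0r.
have pbE : pullback gam (lat_param r) x = diag_mx (\row_a gam p (e a) (e a)).
  rewrite /pullback jacobian_lat -/p; apply/matrixP => a b.
  rewrite mxE (bigD1 (e b))//= big1 ?addr0; last first.
    by move=> j jb; rewrite [X in _ * X]mxE eA (negbTE jb) mulr0.
  rewrite [X in _ * X]mxE eA eqxx mulr1 mxE (bigD1 (e a))//= big1 ?addr0; last first.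
    by move=> j ja; rewrite eA (negbTE ja) mul0r.
  rewrite eA eqxx mul1r !mxE; have [->|ab] := eqVneq a b; first by rewrite mulr1n.
  by rewrite gE (inj_eq lift_inj) (negbTE ab) mul0r mulr0n.
rewrite /mean_curvature -/p pbE (@invmx_diag _ _ _ (\row_a (gam p (e a) (e a))^-1)); last first.
  by move=> a; rewrite !mxE mulfV// gE eqxx mul1r.
have cE a b : (cov_partial gam (lat_param r) a b x *m gam p *m nu^T) 0 0 =
    christoffel gam i30 (e a) (e b) p * (F p ^- 2 * nu 0 i30).
  rewrite (cov_partial_affine gam x a b fA eA) -mulmxA mxE (bigD1 i30)//= big1 ?addr0.
    rewrite mxE -/p; congr (_ * _); rewrite mxE (bigD1 i30)//= big1 ?addr0.
      by rewrite gE eqxx mul1r mxE.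
    by move=> j j0; rewrite gE eq_sym (negbTE j0) !mul0r.
  move=> l l0; rewrite [X in _ * X]mxE big1 ?mulr0// => j _.
  have [->|j0] := eqVneq j i30; first by rewrite gE (negbTE l0) !mul0r.
  case: (unliftP i30 j) => [k ->|jE]; last by rewrite jE eqxx in j0.
  by rewrite [X in _ * X]mxE nu0 mulr0.
have chE a b := christoffelE oOm OmI cF cu F0 u0 F2 gamE a b.
rewrite (eq_bigr (fun a => (gam p (e a) (e a))^-1 *
  (christoffel gam i30 (e a) (e a) p * (F p ^- 2 * nu 0 i30)))); last first.
  move=> a _; rewrite (bigD1 a)//= big1 ?addr0.
    by rewrite cE; congr (_ * _); rewrite mxE eqxx mulr1n mxE.
  by move=> b ba; rewrite mxE eq_sym (negbTE ba) mulr0n mul0r.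
rewrite sum2E.
have -> : e 0 = i31 by exact: val_inj.
have -> : e 1 = i32 by exact: val_inj.
rewrite !gE !eqxx !mul1r.
rewrite (christoffelE oOm OmI cF cu F0 u0 F2 gamE i30 i31 i31 Ox).
rewrite (christoffelE oOm OmI cF cu F0 u0 F2 gamE i30 i32 i32 Ox).
rewrite /chris/= p0 ur; field.
by rewrite FO UO.
Qed.

End Slices.

(** * Minimal surfaces *)

Section SmoothComp.
Context {R : realType}.

(** [smooth] provides extensions that vary from point to point; since [psi] takes its values in [S],
    the composite agrees locally with the composite of any of them. *)
Lemma Ck_smooth_comp m n k (S : set 'rV[R]_m) (f : 'rV[R]_m -> R)
    (U : set 'rV[R]_n) (psi : 'rV[R]_n -> 'rV[R]_m) :
  smooth S f -> open U -> (forall j, Ck j U psi) -> (forall x, U x -> S (psi x)) ->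
  Ck k U (f \o psi).
Proof.
move=> sf oU cpsi US; apply: Ck_local => x Ux.
have [B [F [oB Bx sF FE]]] := sf _ (US _ Ux).
have oW : open (U `&` psi @^-1` B).
  rewrite openE => y [Uy By]; apply: filterI; first exact: open_nbhs_nbhs.
  have := differentiable_continuous (Ck_diff (cpsi 0%N) Uy); apply.
  exact: open_nbhs_nbhs.
exists (U `&` psi @^-1` B); split=> //.
apply: (@Ck_ext _ _ _ _ _ (F \o psi)) => // [y [Uy By]/=|].
  by rewrite FE//; exact: US.
apply: (Ck_comp oW (D := B)) => [y []//||].
  by move/smooth_openP : sF; exact.
by apply: CkS (cpsi k) => y [].
Qed.

Lemma Ck_smooth_itv (W : normedModType R) k (a : R) (u : R -> W) :
  smooth [set r : R | 0 <= r <= a] u -> Ck k [set r : R | 0 < r < a] u.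
Proof.
move=> su; apply: Ck_local => r /andP[r0 ra].
have [|B [F [oB Br sF FE]]] := su r; first by rewrite /= !ltW.
have oI : open [set r : R | 0 < r < a].
  by rewrite (_ : mkset _ = `]0, a[%classic); [exact: interval_open|rewrite set_itvoo].
have oW : open ([set r : R | 0 < r < a] `&` B) by exact: openI.
exists ([set r : R | 0 < r < a] `&` B); split=> //; first by split=> //=; rewrite r0.
apply: (@Ck_ext _ _ _ _ _ F) => // [y [/andP[y0 ya] By]|].
  by rewrite FE//= !ltW.
apply: (@CkS _ _ _ _ _ B) => [y []//|].
by move/smooth_openP : sF; exact.
Qed.

Lemma derive_cst_along (V W : normedModType R) (f : V -> W) (x v : V) :
  (forall t : R, f (t *: v + x) = f x) -> 'D_v f x = 0.
Proof.
move=> fx; rewrite /derive (_ : (fun h : R => _) = cst 0); first exact: lim_cst.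
by apply/funext => t /=; rewrite fx subrr scaler0.
Qed.

Definition row2 (t s : R) : 'rV[R]_2 := \row_(i < 2) [:: t; s]`_i.

Lemma row2E (t s : R) : (row2 t s 0 0 = t) * (row2 t s 0 1 = s).
Proof. by split; rewrite mxE. Qed.

Lemma derive_row2 (f : 'rV[R]_2 -> R) (r t : R) :
  differentiable f (row2 r t) ->
  is_derive r 1 (fun s => f (row2 s t)) (partial 0 f (row2 r t)) /\
  is_derive t 1 (fun s => f (row2 r s)) (partial 1 f (row2 r t)).
Proof.
move=> df; have d1 (i : 'I_2) (F : R -> 'rV[R]_2) s : differentiable F s ->
    'D_1 F s = delta_mx 0 i -> F s = row2 r t ->
    is_derive s 1 (fun s => f (F s)) (partial i f (row2 r t)).
  move=> dF DF Fs; have dfs : differentiable f (F s) by rewrite Fs.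
  have dc : differentiable (f \o F) s by exact: differentiable_comp.
  apply: DeriveDef; first exact: diff_derivable.
  by rewrite (derive_comp _ dF dfs) DF Fs.
have dmx (F : R -> 'rV[R]_2) s : (forall j, differentiable (fun s => F s 0 j) s) -> differentiable F s.
  by move=> dF; apply: differentiable_mx => i j; rewrite (ord1 i).
split; apply: d1 => //.
- apply: dmx => -[[|[|//]] Hj].
  + by rewrite (_ : (fun _ => _) = id)//; apply/funext => s; rewrite mxE.
  + by rewrite (_ : (fun _ => _) = cst t)//; apply/funext => s; rewrite mxE.
- apply/rowP => j; rewrite derive_mxE.
    case: j => -[|[|//]] Hj; rewrite mxE/=.
    + by rewrite (_ : (fun _ => _) = id) ?derive_id//; apply/funext => s; rewrite mxE.
    + by rewrite (_ : (fun _ => _) = cst t) ?derive_cst//; apply/funext => s; rewrite mxE.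
  apply: dmx => -[[|[|//]] Hj'].
  + by rewrite (_ : (fun _ => _) = id)//; apply/funext => s; rewrite mxE.
  + by rewrite (_ : (fun _ => _) = cst t)//; apply/funext => s; rewrite mxE.
- apply: dmx => -[[|[|//]] Hj].
  + by rewrite (_ : (fun _ => _) = cst r)//; apply/funext => s; rewrite mxE.
  + by rewrite (_ : (fun _ => _) = id)//; apply/funext => s; rewrite mxE.
- apply/rowP => j; rewrite derive_mxE.
    case: j => -[|[|//]] Hj; rewrite mxE/=.
    + by rewrite (_ : (fun _ => _) = cst r) ?derive_cst//; apply/funext => s; rewrite mxE.
    + by rewrite (_ : (fun _ => _) = id) ?derive_id//; apply/funext => s; rewrite mxE.
  apply: dmx => -[[|[|//]] Hj'].
  + by rewrite (_ : (fun _ => _) = cst r)//; apply/funext => s; rewrite mxE.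
  + by rewrite (_ : (fun _ => _) = id)//; apply/funext => s; rewrite mxE.
Qed.

End SmoothComp.

(** * The warped metric in the coordinates (r, theta, xi), and its minimal surfaces *)

Section Geometry.
Context {R : realType} (a : R) (u : R -> R) (h : 'rV[R]_3 -> 'M[R]_3)
  (phi : 'rV[R]_3 -> R).
Hypotheses (rs : rot_sym_metric a u h) (sphi : smooth S2 phi)
  (phi_gt0 : forall p, S2 p -> 0 < phi p).

Let a0 : 0 < a. Proof. by case: rs. Qed.

Lemma rot_u_gt0 r : 0 < r -> r < a -> 0 < u r.
Proof. by case: rs => _ [_ + _ _ _] _ _; exact. Qed.

Definition warpI : set R := [set r : R | 0 < r < a].
Definition warpOm : set 'rV[R]_3 := [set x | 0 < x 0 0 < a].
Definition warpF (x : 'rV[R]_3) : R := phi (polar a (lsubmx (x : 'rV[R]_(2 + 1)))).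
Definition warpgam : 'rV[R]_3 -> 'M[R]_3 :=
  pullback (warped phi h) (prodchart (polar a) circ : 'rV[R]_(2 + 1) -> _).

Lemma lsub21E (x : 'rV[R]_(2 + 1)) (i : 'I_2) (j : 'I_3) : i = j :> nat -> lsubmx x 0 i = x 0 j.
Proof. by move=> ij; rewrite mxE; congr (x _ _); exact: val_inj. Qed.

Lemma open_warpOm : open warpOm.
Proof.
rewrite (_ : warpOm = [set x : 'rV[R]_3 | - x 0 0 < 0] `&` [set x : 'rV[R]_3 | x 0 0 < a]).
  apply: openI; apply: open_rV_lt => x; last exact: differentiable_coord.
  by apply: dfN; exact: differentiable_coord.
by apply/seteqP; split=> x; rewrite /warpOm/= oppr_lt0; [move=> /andP[]|move=> [-> ->]].
Qed.

Lemma warpOmI (x : 'rV[R]_3) : warpOm x -> warpI (x 0 0).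
Proof. by []. Qed.

Lemma Ck_phi_polar k : Ck k setT (fun w : 'rV[R]_2 => phi (polar a w)).
Proof.
apply: (Ck_smooth_comp _ sphi openT) => [j|x _]; last exact: polar_S2.
exact: Ck_polar openT.
Qed.

Lemma Ck_warpF : Ck 2 warpOm warpF.
Proof.
apply: (@Ck_comp _ _ _ _ _ setT (fun w : 'rV[R]_2 => phi (polar a w))
  (lsubmx : 'rV[R]_(2 + 1) -> 'rV[R]_2)) => //.
- exact: open_warpOm.
- exact: Ck_phi_polar.
- by apply: Ck_linear; exact: continuous_lsubmx.
Qed.

Lemma Ck_u : Ck 2 warpI u.
Proof. by apply: Ck_smooth_itv; case: rs => _ []. Qed.

Lemma warpF_gt0 x : 0 < warpF x.
Proof. by apply: phi_gt0; exact: polar_S2. Qed.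

Lemma warpF_neq0 x : warpOm x -> warpF x != 0.
Proof. by move=> _; rewrite gt_eqF// warpF_gt0. Qed.

Lemma warpu_neq0 r : warpI r -> u r != 0.
Proof. by move=> /andP[r0 ra]; rewrite gt_eqF// rot_u_gt0. Qed.

Lemma lsub_e2 (t : R) (x : 'rV[R]_(2 + 1)) :
  lsubmx (t *: (delta_mx 0 i32 : 'rV[R]_(2 + 1)) + x) = lsubmx x.
Proof.
apply/rowP => i; rewrite !mxE eqxx/= (_ : _ == _ = false) ?mulr0 ?add0r//.
by rewrite -val_eqE/= ltn_eqF.
Qed.

Lemma warpF_xi x : warpOm x -> partial i32 warpF x = 0.
Proof. by move=> _; apply: derive_cst_along => t; rewrite /warpF lsub_e2. Qed.

Lemma warpgamE x : warpOm x -> warpgam x = diag_mx (\row_(i < 3)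
     [:: warpF x ^- 2; warpF x ^- 2 * u (x 0 0) ^+ 2; warpF x ^+ 2]`_i).
Proof.
move=> /andP[x0 xa]; rewrite /warpgam pullback_warped; last 2 first.
- exact: differentiable_polar.
- exact: differentiable_circ.
have lx0 : lsubmx (x : 'rV[R]_(2 + 1)) 0 0 = x 0 0 by exact: lsub21E.
have [_ _ _ ph] := rs; rewrite ph ?lx0// jacobian_circ_gram -/(warpF x).
apply/matrixP => i j; rewrite [RHS]mxE [in RHS]mxE.
case: (@splitP 2 1 i) => k ik; case: (@splitP 2 1 j) => l jl.
- have -> : i = @lshift 2 1 k by exact: val_inj.
  have -> : j = @lshift 2 1 l by exact: val_inj.
  rewrite (@block_mxEul _ 2 1 2 1) !mxE -!val_eqE /=.
  case: eqP => _; rewrite ?mulr1n ?mulr0n ?mulr0//.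
  by case: k {ik} => -[|[|//]] Hk /=; rewrite ?mulr1.
- have -> : i = @lshift 2 1 k by exact: val_inj.
  have -> : j = @rshift 2 1 l by exact: val_inj.
  by rewrite (@block_mxEur _ 2 1 2 1) mxE -val_eqE/= ltn_eqF ?mulr0n// ltn_addr.
- have -> : i = @rshift 2 1 k by exact: val_inj.
  have -> : j = @lshift 2 1 l by exact: val_inj.
  by rewrite (@block_mxEdl _ 2 1 2 1) mxE -val_eqE/= gtn_eqF ?mulr0n// ltn_addr.
- have -> : i = @rshift 2 1 k by exact: val_inj.
  have -> : j = @rshift 2 1 l by exact: val_inj.
  by rewrite (@block_mxEdr _ 2 1 2 1) !mxE !ord1 eqxx mulr1n mulr1.
Qed.

Lemma warp_local_param (c c' : R) :
  local_param S2xS1 (prodset (polar_dom a c) [set x : 'rV[R]_1 | `|x 0 0 - c'| < pi])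
    (prodchart (polar a) circ).
Proof.
apply: good_chart_local_param; apply: good_chart_prod; last exact: circ_chart.
exact: polar_chart.
Qed.

Lemma gradient_bound r t : scalar_ge0 3 S2xS1 (warped phi h) -> 0 < r -> r < a ->
  partial 0 (fun w => phi (polar a w)) (row2 r t) ^+ 2 +
  partial 1 (fun w => phi (polar a w)) (row2 r t) ^+ 2 / u r ^+ 2 <=
  - (phi (polar a (row2 r t)) ^+ 2 * 'D_1 ('D_1 u) r / u r).
Proof.
(* The polar chart is centred at the angle [t] itself, so that the bound is obtained for every real
   [t]. *)
move=> sc r0 ra; pose x : 'rV[R]_(2 + 1) := row_mx (row2 r t) (0 : 'rV[R]_1).
have lx : lsubmx x = row2 r t by rewrite row_mxKl.
have x0 : x 0 i30 = r by rewrite -(@lsub21E x 0 i30)// lx row2E.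
have Ox : warpOm x by rewrite /warpOm/= (_ : 0 = i30)// ?x0 ?r0 ?ra//; exact: val_inj.
have Ux : prodset (polar_dom a t) [set x : 'rV[R]_1 | `|x 0 0 - 0| < pi] x.
  split; first by rewrite lx /polar_dom/= !row2E subrr normr0 pi_gt0.
  by rewrite row_mxKr /= mxE subr0 normr0 pi_gt0.
have := sc _ _ (warp_local_param t 0) x Ux.
rewrite -/warpgam (scalar_curvature_warped open_warpOm warpOmI Ck_warpF Ck_u
  warpF_neq0 warpu_neq0 warpF_xi warpgamE Ox).
have dphi : differentiable (fun w => phi (polar a w)) (row2 r t).
  exact: Ck_diff (Ck_phi_polar 0) _.
have dl : differentiable (lsubmx : 'rV[R]_(2 + 1) -> 'rV[R]_2) x by exact: differentiable_lsubmx.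
have pE (i : 'I_3) (j : 'I_2) : i = j :> nat ->
    partial i warpF x = partial j (fun w => phi (polar a w)) (row2 r t).
  move=> ij; rewrite /partial.
  have := derive_comp (f := lsubmx) (F := fun w => phi (polar a w)) (delta_mx 0 i) dl.
  rewrite lx => /(_ dphi); rewrite -[_ \o _]/warpF => ->.
  rewrite derive_lsubmx; congr derive; apply/rowP => k; rewrite !mxE eqxx/=.
  by rewrite -!val_eqE/= ij.
rewrite (pE i30 0)// (pE i31 1)//.
have -> : x 0 0 = r by rewrite -x0; congr (x _ _); exact: val_inj.
rewrite [warpF x]/warpF lx; lra.
Qed.

Lemma lat_param_chart (r : R) (y : 'rV[R]_(1 + 1)) :
  prodchart (polar a) circ (lat_param r y : 'rV[R]_(2 + 1)) =
  prodchart (latchart a r) circ y.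
Proof.
rewrite /prodchart /latchart; congr (row_mx (polar a _) (circ _)).
  apply/rowP => -[[|[|//]] Hi].
    rewrite mxE mxE/= (_ : Ordinal Hi = 0); last exact: val_inj.
    by rewrite row_mx11E.
  rewrite mxE mxE/= (_ : Ordinal Hi = 1); last exact: val_inj.
  by rewrite row_mx11E mxE; congr (y _ _); exact: val_inj.
apply/rowP => i; rewrite (ord1 i) !mxE/=; congr (y _ _); exact: val_inj.
Qed.

Definition latset (r : R) : set 'rV[R]_3 := [set p | exists t, p = latchart a r t].

Lemma circ_surj (q : 'rV[R]_2) : @usphere R 2 q -> exists t, q = circ t.
Proof.
rewrite /usphere/= sum2E => S1.
have [w0|w0] := eqVneq (1 + q 0 0 * cos 0 + q 0 1 * sin 0) 0.
  exists (pi%:M).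
  have q0 : q 0 0 = -1.
    by move: w0; rewrite cos0 sin0 mulr1 mulr0 addr0 => /eqP; rewrite addrC addr_eq0 => /eqP.
  have q1 : q 0 1 = 0.
    by apply/eqP; rewrite -sqrf_eq0; apply/eqP; move: S1; rewrite q0; lra.
  apply/rowP => -[[|[|//]] Hi]; rewrite !mxE/= ?cospi ?sinpi; [rewrite -q0|rewrite -q1];
    congr (q _ _); exact: val_inj.
have [cq sq] := angle_cos_sin S1 w0.
exists ((angle 0 (q 0 0) (q 0 1))%:M).
by apply/rowP => -[[|[|//]] Hi]; rewrite !mxE/= ?cq ?sq; congr (q _ _); exact: val_inj.
Qed.

Lemma circ_usphere (t : 'rV[R]_1) : @usphere R 2 (circ t).
Proof. by rewrite /usphere/= sum2E !mxE/= cos2Dsin2. Qed.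

Lemma lat_minimal (r : R) : 0 < r -> r < a -> 'D_1 u r = 0 ->
  minimal 2 3 S2xS1 (warped phi h) (prodset (latset r) (@usphere R 2)).
Proof.
move=> r0 ra ur p [[t pt] /circ_surj[s ps]].
(* The charts are centred at the angles of the given point, so that no point of the torus falls on a
   cut. *)
pose U := prodset (polar_dom a (t 0 0)) [set x : 'rV[R]_1 | `|x 0 0 - s 0 0| < pi].
pose V := prodset [set x : 'rV[R]_1 | `|x 0 0 - t 0 0| < pi]
  [set x : 'rV[R]_1 | `|x 0 0 - s 0 0| < pi].
exists U, (prodchart (polar a) circ), V, (lat_param r), (row_mx t s).
have VOm y : warpOm (lat_param r y).
  by rewrite /warpOm/= mxE/= r0.
have Vx : V (row_mx t s).
  by split; rewrite ?row_mxKl ?row_mxKr/= subrr normr0 pi_gt0.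
split.
- exact: warp_local_param.
- split; first by apply/smooth_openP => n; apply: CkS (Ck_lat_param r n).
  move=> _ [y [y1 y2] <-]; split.
    rewrite /polar_dom/= !mxE/=; split=> //.
    have := y1; rewrite /= mxE; congr (is_true (`|y _ _ - _| < _)); exact: val_inj.
  have := y2; rewrite /= !mxE/=; congr (is_true (`|y _ _ - _| < _)); exact: val_inj.
- rewrite (_ : _ \o _ = prodchart (latchart a r) circ); last first.
    by apply/funext => y /=; exact: lat_param_chart.
  apply: good_chart_local_param; apply: (@good_chart_prod _ 1 1 3 2); last exact: circ_chart.
  exact: lat_chart.
- split=> //; rewrite lat_param_chart /prodchart row_mxKl row_mxKr -pt -ps.
  exact: hsubmxK.
- move=> nu; exact: (mean_curvature_lat open_warpOm warpOmI Ck_warpF Ck_u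
    warpF_neq0 warpu_neq0 warpF_xi warpgamE ur (VOm _)).
Qed.

Lemma compact_prodset m n (S1 : set 'rV[R]_m) (S2 : set 'rV[R]_n) :
  compact S1 -> compact S2 -> compact (prodset S1 S2).
Proof.
move=> c1 c2; apply: bounded_closed_compact.
  have [M1 [_ b1]] := compact_bounded c1; have [M2 [_ b2]] := compact_bounded c2.
  exists (Num.max M1 M2); split; first exact: num_real.
  move=> M; rewrite gt_max => /andP[/b1 {}b1 /b2 {}b2] z [z1 z2] /=.
  have h1 := b1 _ z1; have h2 := b2 _ z2.
  have M0 : 0 <= M by exact: le_trans h1.
  rewrite [leLHS]/Num.Def.normr/= mx_normrE.
  apply: bigmax_le => // -[i j] _ /=; rewrite (ord1 i).
  case: (splitP j) => k jk.
    apply: le_trans h1; rewrite [leRHS]/Num.Def.normr/= mx_normrE.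
    rewrite (_ : z 0 j = lsubmx z 0 k); last by rewrite mxE; congr (z _ _); exact: val_inj.
    exact: (le_bigmax _ _ (0, k)).
  apply: le_trans h2; rewrite [leRHS]/Num.Def.normr/= mx_normrE.
  rewrite (_ : z 0 j = rsubmx z 0 k); last by rewrite mxE; congr (z _ _); exact: val_inj.
  exact: (le_bigmax _ _ (0, k)).
apply: closedI.
- apply: closed_comp => [x _|]; first exact: continuous_lsubmx.
  by apply: compact_closed => //; exact: norm_hausdorff.
- apply: closed_comp => [x _|]; first exact: continuous_rsubmx.
  by apply: compact_closed => //; exact: norm_hausdorff.
Qed.

Lemma compact_usphere n : compact (@usphere R n).
Proof.
apply: bounded_closed_compact.
  exists 1; split; first exact: num_real.
  move=> M M1 p Sp /=; rewrite [leLHS]/Num.Def.normr/= mx_normrE.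
  apply: bigmax_le => [|[i j] _ /=]; first exact: le_trans (ltW M1).
  rewrite (ord1 i) (le_trans _ (ltW M1))// -(@ler_pXn2r _ 2) ?nnegrE// expr1n.
  rewrite real_normK ?num_real// -Sp (bigD1 j)//= lerDl.
  by apply: sumr_ge0 => k _; exact: sqr_ge0.
apply: (@closed_comp _ _ (fun p : 'rV[R]_n => \sum_i p 0 i ^+ 2) [set r | r = 1]).
  move=> p _; apply: differentiable_continuous.
  have dsum (k : nat) (g : 'I_k -> 'rV[R]_n -> R) :
      (forall i, differentiable (g i) p) ->
      differentiable (fun y => \sum_(i < k) g i y) p.
    move=> dg; rewrite (_ : (fun _ => _) = \sum_(i < k) g i).
      exact: differentiable_sum.
    by apply/funext => y; rewrite fct_sumE.
  apply: dsum => i; rewrite (_ : (fun _ => _) = fun y : 'rV[R]_n => y 0 i * y 0 i).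
    by apply: dfM; exact: differentiable_coord.
  by apply/funext => y; rewrite expr2.
exact: closed_eq.
Qed.

Lemma compact_latset (r : R) : compact (latset r).
Proof.
rewrite (_ : latset r = (fun q : 'rV[R]_2 => \row_(i < 3) [:: sin (pi * r / a) * q 0 0;
    sin (pi * r / a) * q 0 1; cos (pi * r / a)]`_i) @` @usphere R 2).
  apply: continuous_compact; last exact: compact_usphere.
  apply: continuous_subspaceT => q; apply: differentiable_continuous.
  apply: differentiable_mx => i [[|[|[|//]]] Hj].
  + rewrite (_ : (fun _ => _) = fun q : 'rV[R]_2 => sin (pi * r / a) * q 0 0).
      by apply: dfM => //; exact: differentiable_coord.
    by apply/funext => y; rewrite mxE.
  + rewrite (_ : (fun _ => _) = fun q : 'rV[R]_2 => sin (pi * r / a) * q 0 1).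
      by apply: dfM => //; exact: differentiable_coord.
    by apply/funext => y; rewrite mxE.
  + rewrite (_ : (fun _ => _) = cst (cos (pi * r / a)))//.
    by apply/funext => y; rewrite mxE.
have latE t : latchart a r t = \row_(i < 3) [:: sin (pi * r / a) * circ t 0 0;
    sin (pi * r / a) * circ t 0 1; cos (pi * r / a)]`_i.
  by apply/rowP => -[[|[|[|//]]] Hi]; rewrite mxE/= !row_mx11E mxE/= ?mxE.
apply/seteqP; split=> [_ [t ->]|_ [q /circ_surj[t ->] <-]] /=.
  by exists (circ t); [exact: circ_usphere|rewrite latE].
by exists t; rewrite latE.
Qed.

Lemma lat_closed_minimal (r : R) : 0 < r -> r < a -> 'D_1 u r = 0 ->
  closed_minimal_surface S2xS1 (warped phi h) (prodset (latset r) (@usphere R 2)).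
Proof.
move=> r0 ra ur; split.
- exists (prodchart (latchart a r) circ (0 : 'rV[R]_(1 + 1))).
  rewrite /prodset/prodchart/= row_mxKl row_mxKr; split; last exact: circ_usphere.
  by exists (lsubmx (0 : 'rV[R]_(1 + 1))).
- by apply: compact_prodset; [exact: compact_latset|exact: compact_usphere].
- by move=> p [[t pt] ps]; split=> //; rewrite pt; exact: polar_S2.
- move=> p [[t pt] /circ_surj[s ps]].
  exists (prodset [set x : 'rV[R]_1 | `|x 0 0 - t 0 0| < pi]
    [set x : 'rV[R]_1 | `|x 0 0 - s 0 0| < pi]), (prodchart (latchart a r) circ).
  split.
    apply: good_chart_local_param; apply: (@good_chart_prod _ 1 1 3 2); last exact: circ_chart.
    exact: lat_chart.
  exists (row_mx t s).
    by split; rewrite ?row_mxKl ?row_mxKr/= subrr normr0 pi_gt0.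
  by rewrite /prodchart row_mxKl row_mxKr -pt -ps hsubmxK.
- exact: lat_minimal.
Qed.

Lemma stereo_cover (p : 'rV[R]_3) : S2 p ->
  exists e w, e ^+ 2 = 1 /\ p = stereo e w.
Proof.
move=> Sp; have : exists e, e ^+ 2 = 1 /\ 1 + e * p 0 i32 != 0.
  (* The chart with e = 1 misses only the pole of height -1, which the chart with e = -1 reaches. *)
  have [z0|z0] := eqVneq (1 + 1 * p 0 i32) 0; last by exists 1; rewrite expr1n.
  exists (-1); rewrite sqrrN expr1n; split=> //.
  by move: z0; rewrite mul1r mulN1r => /eqP; rewrite addrC addr_eq0 => /eqP ->;
    rewrite opprK -[1 + 1]/(2%:R) pnatr_eq0.
move=> [e [e2 w0]]; exists e.
have /S2E S1 := Sp.
exists (row2 (p 0 i30 / (1 + e * p 0 i32)) (p 0 i31 / (1 + e * p 0 i32))).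
split=> //; set w := 1 + e * p 0 i32 in w0 *.
have xy : p 0 i30 ^+ 2 + p 0 i31 ^+ 2 = w * (2 - w).
  have -> : w * (2 - w) = 1 - e ^+ 2 * p 0 i32 ^+ 2 by rewrite /w; ring.
  by rewrite e2 mul1r -S1; ring.
have xy1 : (p 0 i30 / w) ^+ 2 + (p 0 i31 / w) ^+ 2 = (2 - w) / w.
  by rewrite !exprMn -mulrDl xy; field.
have q0 : 1 + (p 0 i30 / w) ^+ 2 + (p 0 i31 / w) ^+ 2 = 2 / w.
  by rewrite -addrA xy1; field.
have n0 : 1 - (p 0 i30 / w) ^+ 2 - (p 0 i31 / w) ^+ 2 = 2 * (w - 1) / w.
  by rewrite -addrA -opprD xy1; field.
have w2 : 2 != 0 :> R by rewrite pnatr_eq0.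
apply/rowP => -[[|[|[|//]]] Hi]; rewrite mxE/= !row2E q0 ?n0.
- by rewrite (_ : Ordinal Hi = i30); [field; rewrite w0|exact: val_inj].
- by rewrite (_ : Ordinal Hi = i31); [field; rewrite w0|exact: val_inj].
- rewrite (_ : Ordinal Hi = i32); last exact: val_inj.
  transitivity (e ^+ 2 * p 0 i32); first by rewrite e2 mul1r.
  by rewrite /w; field; exact: w0.
Qed.

Lemma lsub20 (y : 'rV[R]_(2 + 0)) : lsubmx y = y.
Proof. by apply/rowP => i; rewrite mxE; congr (y _ _); exact: val_inj. Qed.

Lemma slice_chart (e : R) q : e ^+ 2 = 1 ->
  good_chart (prodset S2 [set q]) (prodset setT setT) (prodchart (stereo e) (ptchart q)).
Proof. by move=> e2; apply: good_chart_prod; [exact: stereo_chart|exact: pt_chart]. Qed.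

Lemma slice_minimal (c : R) :
  minimal 2 3 S2xS1 (warped phi h) (prodset S2 [set circ (c%:M)]).
Proof.
move=> p [/stereo_cover[e [w [e2 pw]]] /= ps].
pose U := prodset (setT : set 'rV[R]_2) [set x : 'rV[R]_1 | `|x 0 0 - c| < pi].
have lsl y : lsubmx (slice_param c y : 'rV[R]_(2 + 1)) = y.
  by apply/rowP => -[[|[|//]] Hi]; rewrite !mxE/=; congr (y _ _); exact: val_inj.
have rsl y : rsubmx (slice_param c y : 'rV[R]_(2 + 1)) = c%:M.
  by apply/rowP => i; rewrite (ord1 i) !mxE.
have chE y : prodchart (stereo e) circ (slice_param c y : 'rV[R]_(2 + 1)) =
    prodchart (stereo e) (ptchart (circ c%:M)) (y : 'rV[R]_(2 + 0)).
  by rewrite /prodchart lsl rsl lsub20.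
have dst x : differentiable (stereo e) x.
  by have [_ ss _ _ _] := stereo_chart e2; exact: smooth_open_diff ss _.
exists U, (prodchart (stereo e) circ), (prodset (setT : set 'rV[R]_2) (setT : set 'rV[R]_0)),
  (slice_param c), w.
split.
- apply: good_chart_local_param; apply: (@good_chart_prod _ 2 1 3 2); last exact: circ_chart.
  exact: stereo_chart.
- split; first by apply/smooth_openP => n; apply: CkS (Ck_slice_param c n).
  by move=> _ [y _ <-]; split=> //; rewrite /= rsl mxE eqxx subrr normr0 pi_gt0.
- rewrite (_ : _ \o _ = prodchart (stereo e) (ptchart (circ c%:M))); last first.
    by apply/funext => y /=; exact: chE.
  by apply: good_chart_local_param; exact: slice_chart.
- split=> //; rewrite chE /prodchart lsub20 -pw /ptchart -ps; exact: hsubmxK.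
- move=> nu; apply: mean_curvature_slice => [i i2 y|i i2 y|i j].
  + rewrite (@pullback_warped _ 2 1); [|exact: dst|exact: differentiable_circ].
    case: (@splitP 2 1 i) => k ik.
      have -> : i = @lshift 2 1 k by exact: val_inj.
      have -> : i32 = @rshift 2 1 0 by exact: val_inj.
      by rewrite (@block_mxEdl _ 2 1 2 1) mxE.
    by move: i2; rewrite -val_eqE/= ik (ord1 k).
  + rewrite (@pullback_warped _ 2 1); [|exact: dst|exact: differentiable_circ].
    case: (@splitP 2 1 i) => k ik.
      have -> : i = @lshift 2 1 k by exact: val_inj.
      have -> : i32 = @rshift 2 1 0 by exact: val_inj.
      by rewrite (@block_mxEur _ 2 1 2 1) mxE.
    by move: i2; rewrite -val_eqE/= ik (ord1 k).
  + apply: derive_cst_along => t.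
    pose K (l : 'rV[R]_2) : 'M[R]_(2 + 1) := block_mx
      (phi (stereo e l) ^- 2 *: pullback h (stereo e) l) 0 0
      (phi (stereo e l) ^+ 2 *: 1%:M).
    have gE (y : 'rV[R]_(2 + 1)) :
        pullback (warped phi h) (prodchart (stereo e) circ) y = K (lsubmx y).
      rewrite (@pullback_warped _ 2 1); [|exact: dst|exact: differentiable_circ].
      by rewrite jacobian_circ_gram.
    by rewrite (gE (t *: delta_mx 0 i32 + _)) lsub_e2 -gE.
Qed.

Lemma slice_closed_minimal (c : R) :
  closed_minimal_surface S2xS1 (warped phi h) (prodset S2 [set circ (c%:M)]).
Proof.
split.
- exists (row_mx (polar a 0) (circ c%:M)); rewrite /prodset/= row_mxKl row_mxKr.
  by split=> //; exact: polar_S2.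
- by apply: compact_prodset; [exact: compact_usphere|exact: compact_set1].
- by move=> p [Sp /= ps]; split=> //; rewrite ps; exact: circ_usphere.
- move=> p [/stereo_cover[e [w [e2 pw]]] /= ps].
  exists (prodset (setT : set 'rV[R]_2) (setT : set 'rV[R]_0)),
    (prodchart (stereo e) (ptchart (circ c%:M))).
  split; first by apply: good_chart_local_param; exact: slice_chart.
  exists w => //; rewrite /prodchart lsub20 -pw /ptchart -ps; exact: hsubmxK.
- exact: slice_minimal.
Qed.

End Geometry.

(** * Volumes *)

Section Integrals.
Context {R : realType}.
Notation L := (@lebesgue_measure R).
Local Open Scope ereal_scope.

(* The integral of a nonnegative function is a supremum over simple functions
   below it, so that monotonicity does not need measurability. *)
Lemma ge0_le_integralT (f g : R -> \bar R) :
  (forall x, 0 <= f x) -> (forall x, f x <= g x) ->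
  \int[L]_(x in setT) f x <= \int[L]_(x in setT) g x.
Proof.
move=> f0 fg; have g0 x : 0 <= g x by exact: le_trans (fg x).
rewrite !ge0_integralTE//; apply: le_ereal_sup => _ [s /= sf <-].
by exists s => // x; exact: le_trans (fg x).
Qed.

Lemma integral_cst_itv (c l r : R) : (0 <= c)%R -> (l <= r)%R ->
  \int[L]_(x in setT) (c * \1_`]l, r[ x)%:E = (c * (r - l))%:E.
Proof.
move=> c0 lr; rewrite (@integralZl_indic _ _ _ L setT measurableT (fun=> `]l, r[%classic))//.
  rewrite integral_indic//= setIT lebesgue_measure_itv/= lte_fin.
  case: ltP => [_|rl]; first by rewrite EFinM EFinB.
  by rewrite (le_anti (introT andP (conj lr rl))) subrr mulr0 mule0.
by move=> c1; have := lt_le_trans c1 c0; rewrite ltxx.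
Qed.

(** The function equals its own restriction to a singleton, over which every integral vanishes,
    whatever the value at the point. *)
Lemma integral_off_point (c : R) (f : R -> \bar R) :
  (forall x, x != c -> f x = 0) -> \int[L]_(x in setT) f x = 0.
Proof.
move=> fc; rewrite -[RHS](integral_set1 f c) [RHS]integral_mkcond.
apply: eq_integral => x _; rewrite patchE.
case: ifPn => // /negP; rewrite inE /= => xc.
by apply: fc; apply/eqP.
Qed.

Lemma lebesgue_int_ge0 m (f : 'rV[R]_m -> \bar R) :
  (forall x, 0 <= f x) -> 0 <= lebesgue_int f.
Proof. by elim: m f => [|m IH] f f0 //=; apply: integral_ge0 => t _; exact: IH. Qed.

Lemma lebesgue_int2E (f : 'rV[R]_2 -> \bar R) :
  lebesgue_int f = \int[L]_(t in setT) \int[L]_(s in setT) f (row2 t s).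
Proof.
apply: eq_integral => t _; apply: eq_integral => s _ /=; congr f.
apply/rowP => -[[|[|//]] Hi]; rewrite [RHS]mxE/=.
  rewrite (_ : Ordinal Hi = @lshift 1 1 0%R); last exact: val_inj.
  by rewrite (@row_mxEl _ 1 1 1) mxE ?eqxx.
rewrite (_ : Ordinal Hi = @rshift 1 1 0%R); last exact: val_inj.
rewrite (@row_mxEr _ 1 1 1) (_ : 0%R = @lshift 1 0 0%R :> 'I_(1 + 0)); last exact: val_inj.
by rewrite (@row_mxEl _ 1 1 0) mxE ?eqxx.
Qed.

Definition row3 (t s w : R) : 'rV[R]_3 := \row_(i < 3) [:: t; s; w]`_i.

Lemma lebesgue_int3E (f : 'rV[R]_3 -> \bar R) :
  lebesgue_int f = \int[L]_(t in setT) \int[L]_(s in setT) \int[L]_(w in setT) f (row3 t s w).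
Proof.
apply: eq_integral => t _; apply: eq_integral => s _; apply: eq_integral => w _ /=; congr f.
apply/rowP => -[[|[|[|//]]] Hi]; rewrite [RHS]mxE/=.
- rewrite (_ : Ordinal Hi = @lshift 1 2 0%R); last exact: val_inj.
  by rewrite (@row_mxEl _ 1 1 2) mxE eqxx.
- rewrite (_ : Ordinal Hi = @rshift 1 2 0%R); last exact: val_inj.
  rewrite (@row_mxEr _ 1 1 2) (_ : 0%R = @lshift 1 1 0%R :> 'I_2); last exact: val_inj.
  by rewrite (@row_mxEl _ 1 1 1) mxE eqxx.
- rewrite (_ : Ordinal Hi = @rshift 1 2 1%R); last exact: val_inj.
  rewrite (@row_mxEr _ 1 1 2) (_ : 1%R = @rshift 1 1 0%R :> 'I_2); last exact: val_inj.
  rewrite (@row_mxEr _ 1 1 1) (_ : 0%R = @lshift 1 0 0%R :> 'I_1); last exact: val_inj.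
  by rewrite (@row_mxEl _ 1 1 0) mxE ?eqxx.
Qed.

(** A bound by a product of functions of one variable passes through the iterated integral one
    variable at a time, by monotonicity alone. *)
Lemma lebesgue_int2_le (f : 'rV[R]_2 -> \bar R) (b : R -> R) (l r : R) : (l <= r)%R ->
  (forall x, 0 <= f x) -> (forall t, 0 <= b t)%R ->
  (forall t s, f (row2 t s) <= (b t * \1_`]l, r[ s)%:E) ->
  lebesgue_int f <= \int[L]_(t in setT) (b t * (r - l))%:E.
Proof.
move=> lr f0 b0 fb; rewrite lebesgue_int2E; apply: ge0_le_integralT => t.
  exact: integral_ge0.
by rewrite -integral_cst_itv//; exact: ge0_le_integralT.
Qed.

Lemma lebesgue_int3_ge (f : 'rV[R]_3 -> \bar R) (c l1 r1 l r : R) :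
  (0 <= c)%R -> (l1 <= r1)%R -> (l <= r)%R -> (forall x, 0 <= f x) ->
  (forall t s w, (c * \1_`]l1, r1[ t * \1_`]l, r[ s * \1_`]l, r[ w)%:E <= f (row3 t s w)) ->
  (c * (r - l) * (r - l) * (r1 - l1))%:E <= lebesgue_int f.
Proof.
move=> c0 lr1 lr f0 cf; rewrite lebesgue_int3E.
have rl : (0 <= r - l)%R by rewrite subr_ge0.
have i0 (A : set R) x : (0 <= \1_A x :> R)%R by rewrite indicE.
rewrite -integral_cst_itv ?mulr_ge0//; apply: ge0_le_integralT => t.
  by rewrite lee_fin !mulr_ge0.
rewrite (_ : (_ * _)%R = (c * \1_`]l1, r1[ t * (r - l) * (r - l))%R); last by ring.
rewrite -integral_cst_itv ?mulr_ge0//; apply: ge0_le_integralT => s.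
  by rewrite lee_fin !mulr_ge0.
rewrite (_ : (_ * _)%R = (c * \1_`]l1, r1[ t * \1_`]l, r[ s * (r - l))%R); last by ring.
rewrite -integral_cst_itv ?mulr_ge0//; apply: ge0_le_integralT => w; last exact: cf.
by rewrite lee_fin !mulr_ge0.
Qed.

(** This and the next lemma discard the pieces of a partition that lie on a line of the parameter
    plane: the cuts theta = pi and xi = pi, and the poles. *)
Lemma lebesgue_int2_null0 (f : 'rV[R]_2 -> \bar R) c :
  (forall x : 'rV[R]_2, x 0%R 0%R != c -> f x = 0) -> lebesgue_int f = 0.
Proof.
move=> fc; rewrite lebesgue_int2E; apply: (@integral_off_point c) => t tc.
by apply: integral0_eq => s _; apply: fc; rewrite row2E.
Qed.

Lemma lebesgue_int2_null1 (f : 'rV[R]_2 -> \bar R) c :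
  (forall x : 'rV[R]_2, x 0%R 1%R != c -> f x = 0) -> lebesgue_int f = 0.
Proof.
move=> fc; rewrite lebesgue_int2E; apply: integral0_eq => t _.
by apply: (@integral_off_point c) => s sc; apply: fc; rewrite row2E.
Qed.

End Integrals.

(** * Partitions into Borel pieces, and the volumes they compute *)

Section Decompositions.
Context {R : realType}.

(** A class of Borel sets that contains all the pieces below and is visibly stable under
    [prodset]. *)
Definition locally_closed n (D : set 'rV[R]_n) : Prop :=
  exists O C, [/\ open O, closed C & D = O `&` C].

Lemma locally_closed_borel n (D : set 'rV[R]_n) :
  locally_closed D -> <<s @open 'rV[R]_n >> D.
Proof.
move=> [ O [ C [oO cC ->]]].
have mO (A : set 'rV[R]_n) : open A -> measurable (A : set (g_sigma_algebraType (@open 'rV[R]_n))).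
  by move=> oA; exact: sub_sigma_algebra.
apply: (@measurableI _ (g_sigma_algebraType (@open 'rV[R]_n))); first exact: mO.
by rewrite -(setCK C); apply: measurableC; apply: mO; rewrite openC.
Qed.

Lemma locally_closed_prod m n (D : set 'rV[R]_m) (D' : set 'rV[R]_n) :
  locally_closed D -> locally_closed D' -> locally_closed (prodset D D').
Proof.
move=> [ O [ C [oO cC ->]]] [ O' [ C' [oO' cC' ->]]].
exists (prodset O O'), (prodset C C'); split; first exact: open_prodset.
  apply: closedI; apply: closed_comp => // x _;
    [exact: continuous_lsubmx|exact: continuous_rsubmx].
by apply/seteqP; split=> x [[? ?] [? ?]].
Qed.

Lemma open_locally_closed n (D : set 'rV[R]_n) : open D -> locally_closed D.
Proof. by move=> oD; exists D, setT; rewrite setIT. Qed.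

(** A stronger form of the partitions in [has_volume], with [good_chart], locally closed pieces and
    an arbitrary finite index type: the product of two of them is again one, indexed by pairs. *)
Definition decomp m n (T : finType) (S : set 'rV[R]_n) (U : T -> set 'rV[R]_m)
    (psi : T -> 'rV[R]_m -> 'rV[R]_n) (D : T -> set 'rV[R]_m) : Prop :=
  [/\ forall t, good_chart S (U t) (psi t),
      forall t, D t `<=` U t /\ locally_closed (D t),
      forall t t' x x', D t x -> D t' x' -> psi t x = psi t' x' -> t = t' &
      forall p, S p -> exists t x, D t x /\ psi t x = p].

Lemma decomp_prod m1 m2 n1 n2 (T1 T2 : finType) (S1 : set 'rV[R]_n1) (S2 : set 'rV[R]_n2)
    (U1 : T1 -> set 'rV[R]_m1) psi1 D1 (U2 : T2 -> set 'rV[R]_m2) psi2 D2 :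
  decomp S1 U1 psi1 D1 -> decomp S2 U2 psi2 D2 ->
  decomp (prodset S1 S2) (fun t : T1 * T2 => prodset (U1 t.1) (U2 t.2))
    (fun t => prodchart (psi1 t.1) (psi2 t.2)) (fun t => prodset (D1 t.1) (D2 t.2)).
Proof.
move=> [c1 d1 i1 s1] [c2 d2 i2 s2]; split.
- by move=> t; apply: good_chart_prod.
- move=> t; have [D1U l1] := d1 t.1; have [D2U l2] := d2 t.2.
  split; last exact: locally_closed_prod.
  by move=> x [/D1U ? /D2U].
- move=> [t1 t2] [t1' t2'] x x' [/= x1 x2] [/= x1' x2'] /eq_row_mx[e1 e2].
  by rewrite (i1 _ _ _ _ x1 x1' e1) (i2 _ _ _ _ x2 x2' e2).
- move=> p [/s1[t1 [x1 [Dx1 px1]]] /s2[t2 [x2 [Dx2 px2]]]].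
  exists (t1, t2), (row_mx x1 x2); rewrite /prodset/prodchart/= row_mxKl row_mxKr.
  by split=> //; rewrite px1 px2 hsubmxK.
Qed.

Definition piece_volume m n (G : 'rV[R]_n -> 'M[R]_n) (psi : 'rV[R]_m -> 'rV[R]_n)
    (D : set 'rV[R]_m) : \bar R :=
  lebesgue_int (fun x => (\1_D x * Num.sqrt (\det (pullback G psi x)))%:E).

Lemma piece_volume_ge0 m n (G : 'rV[R]_n -> 'M[R]_n) (psi : 'rV[R]_m -> 'rV[R]_n) D :
  (0 <= piece_volume G psi D)%E.
Proof.
by apply: lebesgue_int_ge0 => x; rewrite lee_fin mulr_ge0 ?sqrtr_ge0// indicE.
Qed.

Lemma decomp_volume m n (T : finType) (G : 'rV[R]_n -> 'M[R]_n) (S : set 'rV[R]_n)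
    (U : T -> set 'rV[R]_m) psi D : decomp S U psi D ->
  has_volume m G S (\sum_(t : T) piece_volume G (psi t) (D t))%E.
Proof.
move=> [c d i s]; exists #|T|, (U \o enum_val), (psi \o enum_val), (D \o enum_val); split.
- by move=> k; apply: good_chart_local_param; exact: c.
- by move=> k; have [DU /locally_closed_borel] := d (enum_val k).
- move=> k k' _ _ [p [[x Dx xp] [x' Dx' xp']]].
  by apply: enum_val_inj; apply: (i _ _ _ _ Dx Dx'); move: xp xp' => /= -> ->.
- apply/seteqP; split=> [p [k _ [x Dx <-]]|p /s[t [x [Dx px]]]].
    have [DU _] := d (enum_val k); have [_ _ _ _ cS] := c (enum_val k).
    by have [] := cS _ (DU _ Dx).
  by exists (enum_rank t) => //; exists x; rewrite /= enum_rankK.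
- by rewrite (reindex (fun k : 'I_#|T| => enum_val k))//=; exists enum_rank => t _; [exact: enum_valK|exact: enum_rankK].
Qed.

(** The circle is cut into the arc ]- pi, pi[ and the single point at angle pi; the chart of that
    point is centred at pi, since the first chart does not contain it. *)
Definition circ_U (b : bool) : set 'rV[R]_1 :=
  [set x | `|x 0 0 - (if b then 0 else pi)| < pi].
Definition circ_D (b : bool) : set 'rV[R]_1 :=
  if b then [set x | `|x 0 0 - 0| < pi] else [set x | x 0 0 = pi].

Lemma open_circ_dom c : open [set x : 'rV[R]_1 | `|x 0 0 - c| < pi].
Proof. by have [] := circ_chart c. Qed.

Lemma circ_pieces_inj b b' x x' : circ_D b x -> circ_D b' x' -> circ x = circ x' -> b = b'.
Proof.
have key (y y' : 'rV[R]_1) : `|y 0 0 - 0| < pi -> y' 0 0 = pi -> circ y = circ y' -> False.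
  rewrite subr0 => ypi y'pi /rowP e.
  have := e 0; have := e 1; rewrite !mxE/= y'pi sinpi cospi => e1 e0.
  have := @cos_sin_inj R (y 0 0) pi; rewrite sinpi cospi => /(_ _ e0 e1) yE.
  have yE' : y 0 0 = pi.
    by apply: yE; rewrite (le_lt_trans (ler_normB _ _))// (ger0_norm (pi_ge0 R)) ltrD2r.
  by move: ypi; rewrite yE' ger0_norm ?pi_ge0// ltxx.
case: b; case: b' => //= xb xb' e.
- by have := key _ _ xb xb' e.
- by have := key _ _ xb' xb (esym e).
Qed.

Lemma circ_pieces_cover (q : 'rV[R]_2) : @usphere R 2 q ->
  exists b x, circ_D b x /\ circ x = q.
Proof.
rewrite /usphere/= sum2E => S1.
have [w0|w0] := eqVneq (1 + q 0 0 * cos 0 + q 0 1 * sin 0) 0.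
  exists false, (pi%:M); split; first by rewrite /= mxE eqxx.
  have q0 : q 0 0 = -1.
    by move: w0; rewrite cos0 sin0 mulr1 mulr0 addr0 => /eqP; rewrite addrC addr_eq0 => /eqP.
  have q1 : q 0 1 = 0.
    by apply/eqP; rewrite -sqrf_eq0; apply/eqP; move: S1; rewrite q0; lra.
  apply/rowP => -[[|[|//]] Hi]; rewrite !mxE/= ?cospi ?sinpi; [rewrite -q0|rewrite -q1];
    congr (q _ _); exact: val_inj.
have [cq sq] := angle_cos_sin S1 w0.
exists true, ((angle 0 (q 0 0) (q 0 1))%:M); split.
  rewrite /= mxE eqxx subr0 /angle add0r normrM ger0_norm// -ltr_pdivlMl//.
  by rewrite ltr_norml (mulrC _ pi) atan_gtNpi2 atan_ltpi2.
by apply/rowP => -[[|[|//]] Hi]; rewrite !mxE/= ?cq ?sq; congr (q _ _); exact: val_inj.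
Qed.

Lemma circ_pieces_dom b : circ_D b `<=` circ_U b /\ locally_closed (circ_D b).
Proof.
case: b; rewrite /circ_D /circ_U; split=> //.
- exact/open_locally_closed/open_circ_dom.
- by move=> x /= ->; rewrite subrr normr0 pi_gt0.
- exists setT, [set x : 'rV[R]_1 | x 0 0 = pi]; split; [exact: openT| |by rewrite setTI].
  apply: (@closed_comp _ _ (fun p : 'rV[R]_1 => p 0 0) [set r | r = pi]); last exact: closed_eq.
  by move=> x _; exact: coord_continuous.
Qed.

Lemma circ_decomp : decomp (@usphere R 2) circ_U (fun=> circ) circ_D.
Proof.
split; [by move=> b; exact: circ_chart|exact: circ_pieces_dom| |exact: circ_pieces_cover].
by move=> b b' x x'; exact: circ_pieces_inj.
Qed.

Lemma pt_decomp (q : 'rV[R]_2) :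
  decomp [set q] (fun _ : unit => setT) (fun=> ptchart q) (fun=> setT).
Proof.
split; [by move=> _; exact: pt_chart| |by case; case|].
- by move=> _; split=> //; exact/open_locally_closed/openT.
- by move=> p /= ->; exists tt, 0.
Qed.

Lemma latchartE (a r : R) t : latchart a r t = \row_(i < 3)
  [:: sin (pi * r / a) * cos (t 0 0); sin (pi * r / a) * sin (t 0 0);
      cos (pi * r / a)]`_i.
Proof. by rewrite /latchart /polar !row_mx11E. Qed.

Lemma latchart_inj_circ (a r : R) t t' : 0 < r -> r < a ->
  latchart a r t = latchart a r t' -> circ t = circ t'.
Proof.
move=> r0 ra /rowP e.
have s0 : 0 < sin (pi * r / a) by apply: sin_gt0_pi; exact: polar_angle_in.
have := e i30; have := e i31; rewrite !latchartE !mxE/=.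
move=> /(mulfI (lt0r_neq0 s0)) e1 /(mulfI (lt0r_neq0 s0)) e0.
by apply/rowP => -[[|[|//]] Hi]; rewrite !mxE/= ?e0 ?e1.
Qed.

Lemma lat_decomp (a r : R) : 0 < r -> r < a ->
  decomp (latset a r) circ_U (fun=> latchart a r) circ_D.
Proof.
move=> r0 ra; split.
- by move=> b; exact: lat_chart.
- exact: circ_pieces_dom.
- move=> b b' x x' Dx Dx' /(latchart_inj_circ r0 ra); exact: circ_pieces_inj.
- move=> p [t ->]; have [b [x [Dx xt]]] := circ_pieces_cover (circ_usphere t).
  exists b, x; split=> //; rewrite !latchartE; have /rowP e := xt.
  by have := e 0; have := e 1; rewrite !mxE/= => -> ->.
Qed.

(** The sphere is cut into four pieces: the polar domain with theta in ]- pi, pi[, the open meridian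
    theta = pi, and the two poles, each the origin of a stereographic chart. The index [inr false]
    is the pole r = 0 and [inr true] the pole r = a. *)
Definition sphere_U (a : R) (t : bool + bool) : set 'rV[R]_2 :=
  match t with
  | inl b => polar_dom a (if b then 0 else pi)
  | inr _ => setT
  end.
Definition sphere_chart (a : R) (t : bool + bool) : 'rV[R]_2 -> 'rV[R]_3 :=
  match t with inl _ => polar a | inr b => stereo ((-1) ^+ b) end.
Definition sphere_D (a : R) (t : bool + bool) : set 'rV[R]_2 :=
  match t with
  | inl true => polar_dom a 0
  | inl false => [set x | [/\ 0 < x 0 0, x 0 0 < a & x 0 1 = pi]]
  | inr _ => [set 0]
  end.

Lemma stereo0 (e : R) : stereo e 0 0 i32 = e.
Proof. by rewrite !mxE/= expr0n/= !subr0 !addr0 mulr1 divr1. Qed.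

Lemma polar_z (a : R) (x : 'rV[R]_2) : polar a x 0 i32 = cos (pi * x 0 0 / a).
Proof. by rewrite mxE. Qed.

Lemma polar_z_lt1 (a : R) (x : 'rV[R]_2) : 0 < x 0 0 -> x 0 0 < a ->
  polar a x 0 i32 ^+ 2 < 1.
Proof.
move=> x0 xa; rewrite polar_z -(cos2Dsin2 (pi * x 0 0 / a)) ltrDl exprn_gt0//.
by apply: sin_gt0_pi; exact: polar_angle_in.
Qed.

Lemma sphere_decomp (a : R) : 0 < a ->
  decomp S2 (sphere_U a) (sphere_chart a) (sphere_D a).
Proof.
move=> a0.
have lat_D b x : sphere_D a (inl b) x ->
    [/\ 0 < x 0 0, x 0 0 < a & exists2 y : 'rV[R]_1, y 0 0 = x 0 1 & circ_D b y].
  case: b => -[x0 xa xc]; split=> //; exists ((x 0 1)%:M); rewrite ?mxE ?eqxx//=;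
    by rewrite mxE eqxx.
split.
- by case=> b; [exact: polar_chart|apply: stereo_chart; rewrite sqrr_sign].
- case=> -[] /=; split=> //.
  + by apply: open_locally_closed; have [] := polar_chart 0 a0.
  + by move=> x [x0 xa xp]; split=> //; rewrite xp subrr normr0 pi_gt0.
  + exists (polar_dom a pi), [set x : 'rV[R]_2 | x 0 1 = pi]; split.
    * by have [] := polar_chart pi a0.
    * apply: (@closed_comp _ _ (fun p : 'rV[R]_2 => p 0 1) [set r | r = pi]); last exact: closed_eq.
      by move=> x _; exact: coord_continuous.
    * apply/seteqP; split=> [x [x0 xa xp]|x [[x0 xa _] xp]]; split=> //.
      by split=> //; rewrite xp subrr normr0 pi_gt0.
  + exists setT, [set 0]; split; [exact: openT| |by rewrite setTI].
    apply: compact_closed; [exact: norm_hausdorff|exact: compact_set1].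
  + exists setT, [set 0]; split; [exact: openT| |by rewrite setTI].
    apply: compact_closed; [exact: norm_hausdorff|exact: compact_set1].
- have pole_lat b b' x x' : sphere_D a (inl b) x -> sphere_D a (inr b') x' ->
      polar a x = stereo ((-1) ^+ b') x' -> False.
    move=> /lat_D[x0 xa _] /= -> e; have := polar_z_lt1 x0 xa.
    by rewrite e stereo0 sqrr_sign ltxx.
  case=> b [] b' x x' Dx Dx' /= e.
  + have [x0 xa [y yx Dy]] := lat_D _ _ Dx; have [x0' xa' [y' yx' Dy']] := lat_D _ _ Dx'.
    congr inl; apply: (circ_pieces_inj Dy Dy').
    have sx0 : 0 < sin (pi * x 0 0 / a) by apply: sin_gt0_pi; exact: polar_angle_in.
    have /rowP er := e.
    have xy0 : x 0 0 = x' 0 0.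
      have := er i32; rewrite !polar_z => /cos_inj; rewrite !in_itv/=.
      have /andP[/ltW -> /ltW ->] := polar_angle_in x0 xa.
      have /andP[/ltW -> /ltW ->] := polar_angle_in x0' xa'.
      move=> /(_ isT isT)/(mulIf (invr_neq0 (lt0r_neq0 a0))).
      exact/mulfI/lt0r_neq0/pi_gt0.
    have := er i30; have := er i31; rewrite !mxE/= -xy0.
    move=> /(mulfI (lt0r_neq0 sx0)) e1 /(mulfI (lt0r_neq0 sx0)) e0.
    by apply/rowP => -[[|[|//]] Hi]; rewrite !mxE/= yx yx'.
  + by have := pole_lat _ _ _ _ Dx Dx' e.
  + by have := pole_lat _ _ _ _ Dx' Dx (esym e).
  + move: Dx Dx' => /= x0 x0'; move: e; rewrite x0 x0' => /rowP/(_ i32).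
    rewrite !stereo0; case: b; case: b' => //= /eqP; rewrite ?expr1 ?expr0.
      by rewrite -subr_eq0 -opprD oppr_eq0 -[1 + 1]/(2%:R) pnatr_eq0.
    by rewrite -subr_eq0 opprK -[1 + 1]/(2%:R) pnatr_eq0.
- move=> p Sp; have /S2E S1 := Sp.
  have [z1|zn1] := eqVneq (p 0 i32 ^+ 2) 1.
    have [b pb] : exists b : bool, p 0 i32 = (-1) ^+ b.
      move/eqP : z1; rewrite sqrf_eq1 => /orP[] /eqP ->; first by exists false.
      by exists true; rewrite expr1.
    exists (inr b), 0; split=> //=.
    have xy : p 0 i30 ^+ 2 + p 0 i31 ^+ 2 = 0 by move: S1; rewrite z1; lra.
    have x0 : p 0 i30 = 0 by nra.
    have y0 : p 0 i31 = 0 by nra.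
    apply/rowP => -[[|[|[|//]]] Hi].
    * by rewrite !mxE/= mulr0 mul0r -x0; congr (p _ _); exact: val_inj.
    * by rewrite !mxE/= mulr0 mul0r -y0; congr (p _ _); exact: val_inj.
    * rewrite (_ : Ordinal Hi = i32); last exact: val_inj.
      by rewrite stereo0.
  have z1 : p 0 i32 ^+ 2 < 1.
    by rewrite lt_neqAle zn1 -S1 lerDr addr_ge0// sqr_ge0.
  have /andP[zN1 zp1] : -1 < p 0 i32 < 1 by apply/andP; split; nra.
  have zin : p 0 i32 \in `[-1, 1] by rewrite in_itv/= !ltW.
  pose al := acos (p 0 i32); have al0 : 0 < al by rewrite acos_gt0// zp1 ltW.
  have alpi : al < pi by rewrite acos_ltpi// zN1 ltW.
  have s0 : 0 < sin al by apply: sin_gt0_pi; rewrite al0.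
  have s2 : sin al ^+ 2 = p 0 i30 ^+ 2 + p 0 i31 ^+ 2.
    by rewrite sin2cos2 acosK// -S1; ring.
  have [b [y [Dy yq]]] : exists b y, circ_D b y /\
      circ y = row2 (p 0 i30 / sin al) (p 0 i31 / sin al).
    apply: circ_pieces_cover; rewrite /usphere/= sum2E !row2E !exprMn -mulrDl exprVn s2.
    by rewrite divff// -s2 expf_neq0// gt_eqF.
  have r0 : 0 < a * al / pi by rewrite divr_gt0 ?mulr_gt0 ?pi_gt0.
  have ra : a * al / pi < a by rewrite ltr_pdivrMr ?pi_gt0// ltr_pM2l.
  have alE : pi * (a * al / pi) / a = al.
    by have := @pi_gt0 R; move: (pi : R) => P P0; field; rewrite !gt_eqF.
  exists (inl b), (row2 (a * al / pi) (y 0 0)); split.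
    by case: b Dy => /= Dy; rewrite /polar_dom/= !row2E.
  have /rowP e := yq; have := e 0; have := e 1; rewrite !mxE/= => e1 e0.
  apply/rowP => -[[|[|[|//]]] Hi]; rewrite !mxE/= alE ?e0 ?e1.
  + by rewrite mulrC mulfVK ?gt_eqF//; congr (p _ _); exact: val_inj.
  + by rewrite mulrC mulfVK ?gt_eqF//; congr (p _ _); exact: val_inj.
  + by rewrite acosK//; congr (p _ _); exact: val_inj.
Qed.

End Decompositions.

(** * Estimates for the profile functions *)

Section OneVariable.
Context {R : realType}.

Lemma mean_value (g g1 : R -> R) (p q : R) : p < q ->
  (forall x, p <= x <= q -> is_derive x 1 g (g1 x)) ->
  exists c, p < c < q /\ g q - g p = g1 c * (q - p).
Proof.
move=> pq dg; have [||c] := @MVT R g g1 p q pq.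
- by move=> x; rewrite in_itv/= => /andP[px xq]; apply: dg; rewrite !ltW.
- apply: derivable_within_continuous => x; rewrite in_itv/= => xpq.
  by have [] := dg _ xpq.
- by rewrite in_itv/= => cpq gE; exists c.
Qed.

Lemma mean_value_le (g g1 : R -> R) (p q : R) : p <= q ->
  (forall x, p <= x <= q -> is_derive x 1 g (g1 x)) ->
  (forall x, p < x < q -> 0 <= g1 x) -> g p <= g q.
Proof.
rewrite le_eqVlt => /predU1P[->//|pq] dg g1p.
have [c [cpq gE]] := mean_value pq dg.
by rewrite -subr_ge0 gE mulr_ge0 ?subr_ge0 ?(ltW pq) ?g1p.
Qed.

Lemma smooth_within_continuous (a : R) (u : R -> R) :
  smooth [set r : R | 0 <= r <= a] u -> {within `[0, a], continuous u}.
Proof.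
move=> su; apply/subspace_continuousP => r; rewrite /= in_itv/= => r0a.
have [B [F [oB Br sF FE]]] := su r r0a.
have cF : F @ r --> F r by exact/differentiable_continuous/(smooth_open_diff sF Br).
suff : u x @[x --> within `[0, a] (nbhs r)] --> u r by [].
rewrite -(FE r r0a Br) => A /cF nA.
have nB : nbhs r B by exact: open_nbhs_nbhs.
suff : nbhs r (fun y => y \in `[0, a] -> A (u y)) by [].
apply: (@filterS2 _ (nbhs r) _ (fun y => A (F y)) B) nA nB => y Ay By y0a.
by rewrite -(FE y).
Qed.

End OneVariable.

(** * Concave profiles between a pole and the critical radius *)

Section OneSide.
Context {R : realType} (a r0 : R) (v v1 v2 : R -> R).
Hypotheses (r0_gt0 : 0 < r0) (r0a : r0 < a)
  (dv : forall r, 0 < r < a -> is_derive r 1 v (v1 r))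
  (dv1 : forall r, 0 < r < a -> is_derive r 1 v1 (v2 r))
  (v2_le0 : forall r, 0 < r < a -> v2 r <= 0)
  (v_gt0 : forall r, 0 < r < a -> 0 < v r)
  (v0 : v 0 = 0) (cv : {within `[0, a], continuous v})
  (v10 : (fun t => t^-1 * (v t - v 0)) @ 0^'+ --> (1 : R))
  (v1r0 : v1 r0 = 0).

Lemma v1_nincr r s : 0 < r -> r <= s -> s < a -> v1 s <= v1 r.
Proof.
move=> rp rs sa; rewrite -lerN2.
apply: (@mean_value_le _ (fun x => - v1 x) (fun x => - v2 x)) => //.
- move=> x /andP[rx xs]; have xa : 0 < x < a by rewrite (lt_le_trans rp)// (le_lt_trans xs).
  by have d := dv1 xa; exact: is_deriveN.
- move=> x /andP[rx xs]; rewrite oppr_ge0 v2_le0// (lt_trans rp)//= (lt_trans xs)//.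
Qed.

Lemma v_secant r : 0 < r -> r < a -> exists c, 0 < c < r /\ v r = v1 c * r.
Proof.
move=> rp ra; have [||c] := @MVT R v v1 0 r rp.
- move=> x; rewrite in_itv/= => /andP[xp xr]; apply: dv.
  by rewrite xp (lt_trans xr).
- apply: continuous_subspaceW cv => x; rewrite /= !in_itv/= => /andP[-> xr].
  by rewrite (le_trans xr)// ltW.
- by rewrite in_itv/= v0 !subr0 => cr vE; exists c.
Qed.

Lemma v1_le r : 0 < r -> r < a -> r * v1 r <= v r.
Proof.
move=> rp ra; have [c [/andP[cp cr] ->]] := v_secant rp ra.
by rewrite mulrC ler_pM2r// v1_nincr// ltW.
Qed.

(** As v' decreases, v'(r) is below the secant slopes v(t) / t for t < r, and these tend to 1.
    Derivatives are only taken in the open interval, so the slope at the pole enters as this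
    limit. *)
Lemma v1_le1 r : 0 < r -> r < a -> v1 r <= 1.
Proof.
move=> rp ra; apply: (cvgr_to_ge v10).
near=> t; have tp : 0 < t by near: t; exact: nbhs_right_gt.
have tr : t < r by near: t; exact: nbhs_right_lt.
have [c [/andP[cp ct] vt]] := v_secant tp (lt_trans tr ra).
rewrite v0 subr0 vt mulrC mulfK ?gt_eqF//.
by rewrite v1_nincr// ltW// (lt_trans ct).
Unshelve. all: by end_near. Qed.

Lemma v_le_id r : 0 < r -> r < a -> v r <= r.
Proof.
move=> rp ra; have [c [/andP[cp cr] ->]] := v_secant rp ra.
by rewrite ger_pMl// v1_le1// (lt_trans cr).
Qed.

Lemma v1_ge0 r : 0 < r -> r <= r0 -> 0 <= v1 r.
Proof. by move=> rp rr0; rewrite -v1r0 v1_nincr. Qed.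

Lemma v_le_max r : 0 < r -> r <= r0 -> v r <= v r0.
Proof.
move=> rp rr0; apply: (@mean_value_le _ v v1) => //.
- by move=> x /andP[rx xr]; apply: dv; rewrite (lt_le_trans rp)//= (le_lt_trans xr).
- by move=> x /andP[rx xr]; apply: v1_ge0; [exact: lt_trans rx|exact: ltW].
Qed.

(** The quotient v / r is nonincreasing, its derivative being (r v' - v) / r^2 <= 0. *)
Lemma v_ge_chord r : 0 < r -> r <= r0 -> v r0 * r / r0 <= v r.
Proof.
move=> rp rr0; rewrite mulrAC -ler_pdivlMr// -lerN2.
apply: (@mean_value_le _ (fun x => - (v x / x)) (fun x => (v x - x * v1 x) / x ^+ 2)) => //.
- move=> x /andP[rx xr]; have xp : 0 < x by exact: lt_le_trans rx.
  have xa : 0 < x < a by rewrite xp (le_lt_trans xr).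
  have d := dv xa; have x0 : x != 0 by rewrite gt_eqF.
  have dV : is_derive x 1 (fun y : R => y^-1) (- x ^- 2).
    apply: DeriveDef; first by apply: (@derivableV _ _ id).
    by rewrite (@deriveV _ _ id)// derive_id /=; exact: mulr1.
  apply: is_derive_eq; rewrite /GRing.scale/=.
  by field.
- move=> x /andP[rx xr]; have xp : 0 < x by exact: lt_trans rx.
  by rewrite divr_ge0 ?sqr_ge0// subr_ge0 v1_le// (lt_trans xr).
Qed.

(* The radial bound |f1| <= sqrt (- v2 / v) integrates to a growth exponent 1/2:
   with p = r v1 / v one has p' = (p - p^2) / r + r v2 / v, hence
   1 / (2 r) - p' >= ((p - 1/2)^2 + 1/4) / r + r f1^2 >= |f1|. *)
Lemma radial_oscillation (f f1 : R -> R) :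
  (forall r, 0 < r < a -> is_derive r 1 f (f1 r)) ->
  (forall r, 0 < r < a -> f1 r ^+ 2 <= - (v2 r / v r)) ->
  forall r s, 0 < r -> r <= s -> s <= r0 -> `|f s - f r| <= 2^-1 * ln (s / r) + 1.
Proof.
move=> df f1b r s rp rs sr0; have sp : 0 < s by exact: lt_le_trans rs.
have sa : s < a by exact: le_lt_trans r0a.
(* The values e = 1 and e = -1 give the two signs of f(s) - f(r); [G e] is nondecreasing for
   both. *)
pose G (e x : R) := 2^-1 * ln x - x * v1 x / v x + e * f x.
pose G1 (e x : R) := 2^-1 * x^-1 - (v1 x / v x + x * v2 x / v x - x * v1 x ^+ 2 / v x ^+ 2) + e * f1 x.
have dG e x : 0 < x < a -> is_derive x 1 (G e) (G1 e x).
  move=> xa; have /andP[xp _] := xa.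
  have d := dv xa; have d1 := dv1 xa; have d2 := df _ xa.
  have vx := v_gt0 xa; have vn0 : v x != 0 by rewrite gt_eqF.
  have dl : is_derive x 1 (@ln R) x^-1 by exact: is_derive1_ln.
  have dV : is_derive x 1 (fun y : R => (v y)^-1) (- (v x ^- 2) * v1 x).
    apply: DeriveDef; first by apply: derivableV => //; have [] := d.
    by have [dd dE] := d; rewrite deriveV// dE.
  apply: is_derive_eq; rewrite /G1 /GRing.scale/=.
  by field; rewrite vn0 gt_eqF.
have G1p e x : e ^+ 2 = 1 -> 0 < x < a -> 0 <= G1 e x.
  move=> e2 xa; have /andP[xp _] := xa; have vx := v_gt0 xa.
  pose p := x * v1 x / v x; have := f1b _ xa; set q := v2 x / v x => fq.
  have -> : G1 e x = x^-1 * ((p - 2^-1) ^+ 2 + (e * x * f1 x + 2^-1) ^+ 2) + x * (- q - f1 x ^+ 2 * e ^+ 2).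
    rewrite /G1 /p /q; field.
    by rewrite !gt_eqF.
  rewrite e2 mulr1; apply: addr_ge0; apply: mulr_ge0.
  - by rewrite invr_ge0 ltW.
  - by rewrite addr_ge0 ?sqr_ge0.
  - exact: ltW.
  - by rewrite subr_ge0.
have Gm e : e ^+ 2 = 1 -> G e r <= G e s.
  move=> e2; apply: (@mean_value_le _ (G e) (G1 e)) => //.
  - by move=> x /andP[rx xs]; apply: dG; rewrite (lt_le_trans rp)//= (le_lt_trans xs).
  - by move=> x /andP[rx xs]; apply: G1p => //; rewrite (lt_trans rp)//= (lt_trans xs).
have ra : r < a by exact: le_lt_trans sa.
(* Up to the critical radius p = r v' / v lies in [0, 1]: its boundary values cost the additive
   constant 1. *)
have pr : r * v1 r / v r <= 1 by rewrite ler_pdivrMr ?mul1r ?v1_le// v_gt0// rp.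
have ps : 0 <= s * v1 s / v s.
  by rewrite divr_ge0 ?mulr_ge0 ?v1_ge0 ?(ltW sp)// ltW// v_gt0// sp.
rewrite ln_div ?posrE//.
have := Gm 1 (expr1n _ _); have := Gm (-1); rewrite sqrrN expr1n => /(_ erefl).
rewrite /G => g1 g2; rewrite ler_norml; apply/andP; split; lra.
Qed.

End OneSide.

(** * Estimates on both sides of the critical radius *)

Section TwoSides.
Context {R : realType}.

Lemma is_derive_reflect (a r y : R) (g : R -> R) :
  is_derive (a - r) 1 g y -> is_derive r 1 (fun x => g (a - x)) (- y).
Proof.
move=> [dg gE]; have df : differentiable (fun x : R => a - x) r.
  by apply: dfD => //; exact: dfN.
have Df : 'D_1 (fun x : R => a - x) r = -1.
  have dN : differentiable (fun x : R => - x) r by exact: dfN.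
  by rewrite derive_fD// derive_cst add0r derive_fN// derive_id.
have dgr : differentiable g (a - r) by exact/derivable1_diffP.
apply: DeriveDef.
  by apply/derivable1_diffP; exact: (differentiable_comp df dgr).
by rewrite derive_comp1// Df gE mulN1r.
Qed.

(** [f] plays the role of ln phi, and [fu] is the form taken by the nonnegativity of the scalar
    curvature. *)
Context (a : R) (u u1 u2 : R -> R) (f fr ft : R -> R -> R).
Hypotheses (a_gt0 : 0 < a)
  (du : forall r, 0 < r < a -> is_derive r 1 u (u1 r))
  (du1 : forall r, 0 < r < a -> is_derive r 1 u1 (u2 r))
  (u_gt0 : forall r, 0 < r < a -> 0 < u r)
  (u0 : u 0 = 0) (ua : u a = 0) (cu : {within `[0, a], continuous u})
  (u10 : (fun t => t^-1 * (u t - u 0)) @ 0^'+ --> (1 : R))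
  (u1a : (fun t => t^-1 * (u (a + t) - u a)) @ 0^'- --> (-1 : R))
  (df : forall r t : R, 0 < r < a -> is_derive r 1 (f ^~ t) (fr r t))
  (dft : forall r t : R, 0 < r < a -> is_derive t 1 (f r) (ft r t))
  (fu : forall r t : R, 0 < r < a ->
     fr r t ^+ 2 + ft r t ^+ 2 / u r ^+ 2 <= - (u2 r / u r)).

Lemma exists_critical : exists2 r0, 0 < r0 < a & u1 r0 = 0.
Proof.
have [c] := EVT_max (ltW a_gt0) cu.
rewrite in_itv/= => /andP[c0 ca] cmax.
have h2 : 0 < a / 2 < a by rewrite divr_gt0//= ltr_pdivrMr// mulr_natr mulr2n ltrDl.
have uc : 0 < u c.
  apply: lt_le_trans (u_gt0 h2) _; apply: cmax.
  by rewrite in_itv/=; case/andP: h2 => *; rewrite !ltW.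
have c0a : 0 < c < a.
  rewrite !lt_neqAle c0 ca !andbT; apply/andP; split; apply/eqP => cE.
    by move: uc; rewrite -cE u0 ltxx.
  by move: uc; rewrite cE ua ltxx.
exists c => //.
have [|||_ d0] := @derive1_at_max R u 0 a c (ltW a_gt0).
- by move=> t; rewrite in_itv/= => t0a; have [] := du t0a.
- by rewrite in_itv.
- by move=> t; rewrite in_itv/= => /andP[t0 ta]; apply: cmax; rewrite in_itv/= !ltW.
- by have [_ <-] := du c0a.
Qed.

Lemma fr_bound r t : 0 < r < a -> fr r t ^+ 2 <= - (u2 r / u r).
Proof.
by move=> ra; apply: le_trans (fu t ra); rewrite lerDl divr_ge0 ?sqr_ge0.
Qed.

Lemma u2_le0 r : 0 < r < a -> u2 r <= 0.
Proof.
move=> ra; have := le_trans (sqr_ge0 _) (fr_bound 0 ra).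
by rewrite -mulNr pmulr_lge0 ?invr_gt0 ?u_gt0// oppr_ge0.
Qed.

Variables (r0 : R) (r0_gt0 : 0 < r0) (r0a : r0 < a) (u1r0 : u1 r0 = 0).

(** The reflection r -> a - r reduces the side of the pole r = a to the previous section: the
    reflected profile [v] starts at 0 with slope 1 and is critical at [s0]. *)
Let s0 := a - r0.
Let v r := u (a - r).
Let v1 r := - u1 (a - r).
Let v2 r := u2 (a - r).

Let refl r : 0 < r < a -> 0 < a - r < a.
Proof. by move=> /andP[? ?]; rewrite subr_gt0 gtrBl; apply/andP. Qed.

Let s0_gt0 : 0 < s0. Proof. by rewrite subr_gt0. Qed.
Let s0a : s0 < a. Proof. by rewrite gtrBl. Qed.
Let dv r : 0 < r < a -> is_derive r 1 v (v1 r).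
Proof. by move=> /refl ra; apply: is_derive_reflect; exact: du. Qed.
Let dv1 r : 0 < r < a -> is_derive r 1 v1 (v2 r).
Proof.
move=> /refl ra; rewrite /v1 /v2 -(opprK (u2 (a - r))).
have := is_derive_reflect (du1 ra) => d; exact: is_deriveN.
Qed.
Let v_gt0 r : 0 < r < a -> 0 < v r. Proof. by move=> /refl; exact: u_gt0. Qed.
Let v2_le0 r : 0 < r < a -> v2 r <= 0. Proof. by move=> /refl; exact: u2_le0. Qed.
Let v0 : v 0 = 0. Proof. by rewrite /v subr0. Qed.
Let v1s0 : v1 s0 = 0. Proof. by rewrite /v1 /s0 subKr u1r0 oppr0. Qed.
Let cv : {within `[0, a], continuous v}.
Proof.
apply/subspace_continuousP => r; rewrite /= in_itv/= => r0a'.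
suff : v x @[x --> within `[0, a] (nbhs r)] --> v r by [].
have r0a'' : a - r \in `[0, a].
  by rewrite in_itv/= subr_ge0 gerBl andbC.
have := (subspace_continuousP _ _).1 cu (a - r) r0a'' => cur.
have {}cur : u x @[x --> within `[0, a] (nbhs (a - r))] --> u (a - r) by [].
move=> A /cur; rewrite /fmap/= /within /= => nA.
have cs : (fun x : R => a - x) @ r --> a - r.
  by apply: cvgB; [exact: cvg_cst|exact: cvg_id].
have nA' : nbhs r (fun x : R => a - x \in `[0, a] -> A (u (a - x))) := cs _ nA.
suff : nbhs r (fun x : R => x \in `[0, a] -> A (v x)) by [].
apply: filterS nA' => x; rewrite /= !in_itv/= => xA /andP[x0 xa].
by apply: xA; rewrite subr_ge0 gerBl xa x0.
Qed.
Let v10 : (fun t => t^-1 * (v t - v 0)) @ 0^'+ --> (1 : R).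
Proof.
have -> : (fun t => t^-1 * (v t - v 0)) =
    (fun t => - ((fun t => t^-1 * (u (a + t) - u a)) (- t))).
  by apply/funext => t; rewrite /v subr0 invrN mulNr opprK.
rewrite -[X in _ --> X]opprK; apply: cvgN.
by have := u1a; rewrite -{1}oppr0 at_leftN.
Qed.

Let f_refl t r : 0 < r < a -> is_derive r 1 (fun r => f (a - r) t) (- fr (a - r) t).
Proof. by move=> /refl ra; apply: (is_derive_reflect (g := f ^~ t)); exact: df. Qed.

Lemma radial_left t r : 0 < r -> r <= r0 ->
  `|f r0 t - f r t| <= 2^-1 * ln (r0 / r) + 1.
Proof.
move=> rp rr0; apply: (radial_oscillation r0a du du1 u2_le0 u_gt0 u0 cu u1r0
  (f := f ^~ t) (f1 := fun x => fr x t)) => //.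
by move=> x xa; exact: fr_bound.
Qed.

Lemma radial_right t r : r0 <= r -> r < a ->
  `|f r0 t - f r t| <= 2^-1 * ln ((a - r0) / (a - r)) + 1.
Proof.
move=> rr0 ra; have := @radial_oscillation R a s0 v v1 v2 s0a dv dv1 v2_le0
  v_gt0 v0 cv v1s0 (fun r => f (a - r) t) (fun r => - fr (a - r) t) (@f_refl t) _ (a - r) s0.
rewrite !subKr subr_gt0 lerB// lexx; apply=> // x /refl xa.
by rewrite sqrrN; exact: fr_bound.
Qed.

Lemma max_le_r0 : u r0 <= r0.
Proof. exact: (v_le_id du du1 u2_le0 u0 cu u10). Qed.

Lemma max_le_s0 : u r0 <= a - r0.
Proof.
by have := v_le_id dv dv1 v2_le0 v0 cv v10 s0_gt0 s0a; rewrite /v subKr.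
Qed.

Lemma u_le_max r : 0 < r < a -> u r <= u r0.
Proof.
move=> /andP[rp ra]; have [rr0|r0r] := leP r r0.
  exact: (v_le_max r0a du du1 u2_le0 u1r0).
have := v_le_max s0a dv dv1 v2_le0 v1s0 (r := a - r); rewrite /v !subKr.
by apply; [rewrite subr_gt0|rewrite lerB// ltW].
Qed.

(** Here ln (x / y) <= x / y - 1 <= 1. Consequently, on the half of each side that is next to [r0],
    the radial oscillation of [f] is at most 2. *)
Lemma half_ln_le1 (x y : R) : 0 < x -> 0 < y -> x <= 2 * y -> 2^-1 * ln (x / y) + 1 <= 2.
Proof.
move=> xp yp xy; have h : x / y <= 2 by rewrite ler_pdivrMr.
have l : ln (x / y) <= x / y - 1.
  have := @le_ln1Dx R (x / y - 1); rewrite (_ : 1 + (_ - 1) = x / y); last by ring.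
  by apply; rewrite ltrBrDr addNr divr_gt0.
lra.
Qed.

(* The slope of [u] drops by at most u r0 / ((a - r0) / 2) over [r0, (r0 + a) / 2],
   so that - u2 u <= 4 at some radius of that interval. *)
Lemma exists_good_radius : exists2 r, r0 < r < (r0 + a) / 2 & - u2 r * u r <= 4.
Proof.
have h0 : 0 < r0 := r0_gt0; have ha : r0 < a := r0a.
pose b := (r0 + a) / 2; have r0b : r0 < b by rewrite /b ltr_pdivlMr//; lra.
have ba : b < a by rewrite /b ltr_pdivrMr//; lra.
have [x|c [/andP[r0c cb]]] := mean_value (g := u1) (g1 := u2) r0b.
  by move=> /andP[r0x xb]; apply: du1; rewrite (lt_le_trans r0_gt0)//= (le_lt_trans xb).
rewrite u1r0 subr0 => u1b; exists c; first by rewrite r0c.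
have c0a : 0 < c < a by rewrite (lt_trans r0_gt0)//= (lt_trans cb).
have b0a : 0 < a - b < a by apply: refl; rewrite (lt_trans r0_gt0)//=.
have /andP[b0 bxa] := b0a.
have := v1_le dv dv1 v2_le0 v0 cv b0 bxa; rewrite /v1 /v subKr u1b => hb.
have ub : u b <= u r0 by apply: u_le_max; rewrite (lt_trans r0_gt0).
have uc : u c <= u r0 by exact: u_le_max.
have us := max_le_s0; have u2c := u2_le0 c0a; have uc0 := u_gt0 c0a.
have bE : b - r0 = (a - r0) / 2 by rewrite /b; field.
have aE : a - b = (a - r0) / 2 by rewrite /b; field.
rewrite bE aE in hb; set s := a - r0 in us hb *.
have sp : 0 < s by rewrite subr_gt0.
have hb' : - u2 c * s ^+ 2 <= 4 * u r0 by nra.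
(* Both u(c) and u(r0) are at most s, which goes back to the slope bound 1 at the pole; this makes
   the length s disappear from the estimate. *)
have h1 : - u2 c * u c * s ^+ 2 <= 4 * s ^+ 2.
  apply: (@le_trans _ _ (4 * u r0 * u c)).
    by rewrite mulrAC ler_wpM2r// ltW.
  rewrite expr2 -!mulrA ler_wpM2l//; apply: ler_pM => //.
  - by rewrite ltW// u_gt0// h0.
  - exact: ltW.
  - exact: le_trans uc us.
by move: h1; rewrite ler_pM2r// exprn_gt0.
Qed.

(** At [r0] itself there is no upper bound on - u''. The comparison goes along a ray to the good
    radius, at cost 2, then along the circle there, where f_theta^2 <= - u'' u <= 4, at cost 2 pi,
    and back along another ray, at cost 2. *)
Lemma angular_oscillation t : `|t| < pi -> `|f r0 t - f r0 0| <= 4 + 2 * pi.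
Proof.
have h0 : 0 < r0 := r0_gt0; have ha : r0 < a := r0a.
move=> tpi; have [r /andP[r0r rb] ur] := exists_good_radius.
have ra : r < a by apply: lt_trans rb _; rewrite ltr_pdivrMr//; lra.
have r0a' : 0 < r < a by rewrite (lt_trans r0_gt0).
have half x : `|f r0 x - f r x| <= 2.
  apply: le_trans (radial_right _ (ltW r0r) ra) _; apply: half_ln_le1;
    rewrite ?subr_gt0//; move: rb; rewrite ltr_pdivlMr//; lra.
have ftb x : `|ft r x| <= 2.
  have := fu x r0a'; have uc := u_gt0 r0a' => fux.
  have h : ft r x ^+ 2 <= - u2 r * u r.
    have : ft r x ^+ 2 / u r ^+ 2 <= - (u2 r / u r).
      by apply: le_trans fux; rewrite lerDr sqr_ge0.
    rewrite ler_pdivrMr ?exprn_gt0// (_ : _ * _ ^+ 2 = - u2 r * u r)//.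
    by field; rewrite gt_eqF.
  rewrite -(@ler_pXn2r _ 2) ?nnegrE// real_normK ?num_real//.
  by apply: le_trans h (le_trans ur _); rewrite expr2; lra.
have fr0 : `|f r t - f r 0| <= 2 * pi.
  have [t0|t0|<-] := ltgtP 0 t; last by rewrite subrr normr0 mulr_ge0// pi_ge0.
  - have [x _|c [_ ->]] := mean_value (g := f r) (g1 := ft r) t0; first exact: dft.
    by rewrite subr0 normrM ler_pM// ltW.
  - have [x _|c [_ e]] := mean_value (g := f r) (g1 := ft r) t0; first exact: dft.
    by rewrite distrC e sub0r normrM normrN ler_pM// ltW.
have h1 := half t; have h2 := half 0.
rewrite (_ : _ - _ = (f r0 t - f r t) + (f r t - f r 0) - (f r0 0 - f r 0)); last by ring.
apply: le_trans (ler_normB _ _) _; apply: le_trans (lerD (ler_normD _ _) (lexx _)) _; lra.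
Qed.

(** The exponent 6 + 2 pi is 2 for the radial and 4 + 2 pi for the angular oscillation. On this
    interval, which has length a / 2, a chord from a pole to the maximum keeps at least half of its
    height. *)
Lemma volume_density_ge r t : `|t| < pi -> r0 / 2 < r -> r < (r0 + a) / 2 ->
  expR (- f r0 0 - (6 + 2 * pi)) * (u r0 / 2) <= expR (- f r t) * u r.
Proof.
have h0 : 0 < r0 := r0_gt0; have ha : r0 < a := r0a.
move=> tpi r1 r2; have ang := angular_oscillation tpi.
move: r1 r2; rewrite ltr_pdivrMr// ltr_pdivlMr// => r1 r2.
have rp : 0 < r by lra.
have ra : r < a by lra.
have rad : `|f r0 t - f r t| <= 2.
  have [rr0|r0r] := leP r r0.
    by apply: le_trans (radial_left _ rp rr0) (half_ln_le1 _ _ _) => //; lra.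
  apply: le_trans (radial_right _ (ltW r0r) ra) (half_ln_le1 _ _ _);
    rewrite ?subr_gt0//; lra.
have ur0 : 0 < u r0 by rewrite u_gt0// h0.
have ug : u r0 / 2 <= u r.
  have [rr0|r0r] := leP r r0.
    apply: le_trans (v_ge_chord r0a du du1 u2_le0 u0 cu rp rr0).
    rewrite -mulrA ler_wpM2l ?(ltW ur0)//.
    by rewrite ler_pdivlMr//; lra.
  have arp : 0 < a - r by rewrite subr_gt0.
  have ars : a - r <= s0 by rewrite lerB// ltW.
  have := v_ge_chord s0a dv dv1 v2_le0 v0 cv arp ars.
  rewrite /v !subKr; apply: le_trans.
  rewrite -mulrA ler_wpM2l ?(ltW ur0)//.
  by rewrite ler_pdivlMr// /s0; lra.
have u00 : 0 <= u r0 / 2 by rewrite divr_ge0// ltW// u_gt0// r0_gt0.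
apply: ler_pM => //.
rewrite ler_expR; move: ang rad; rewrite !ler_norml => /andP[? ?] /andP[? ?]; lra.
Qed.

(** Let q and w be the distances of r and r0 to the pole on the side of r. Doubling the radial
    estimate gives a factor w / q, and 10 + 4 pi is 2 (4 + 2 pi) + 2. Since u <= q and u <= u(r0),
    the product of u with w / q is at most w <= a for q < d, and at most a u(r0) / d for q >= d; the
    indicators merge these cases. *)
Lemma area_density_le d r t : 0 < d -> `|t| < pi -> 0 < r < a ->
  expR (- 2 * f r t) * u r <= expR (- 2 * f r0 0 + (10 + 4 * pi)) * a *
    (\1_`]0, d[ r + \1_`](a - d), a[ r + u r0 / d).
Proof.
have h0 : 0 < r0 := r0_gt0; have ha : r0 < a := r0a.
move=> dp tpi /andP[rp ra]; have ang := angular_oscillation tpi.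
have i0 (A : set R) x : (0 <= \1_A x :> R)%R by rewrite indicE.
have ur : 0 < u r by rewrite u_gt0// rp.
have key q w : 0 < q -> q <= w -> w <= a -> `|f r0 t - f r t| <= 2^-1 * ln (w / q) + 1 ->
    u r <= q -> (\1_`]0, d[ r + \1_`](a - d), a[ r + u r0 / d) >= (if q < d then 1 else u r0 / d) ->
    expR (- 2 * f r t) * u r <= expR (- 2 * f r0 0 + (10 + 4 * pi)) * a *
      (\1_`]0, d[ r + \1_`](a - d), a[ r + u r0 / d).
  move=> qp qw wa fq uq hI; have wp : 0 < w by exact: lt_le_trans qw.
  have e1 : expR (- 2 * f r t) <= expR (- 2 * f r0 0 + (10 + 4 * pi)) * (w / q).
    have wq : 0 < w / q by rewrite divr_gt0.
    have wqE : expR (ln (w / q)) = w / q by rewrite lnK// posrE.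
    rewrite -wqE -expRD ler_expR.
    move: ang fq; rewrite !ler_norml => /andP[? ?] /andP[? ?]; lra.
  apply: le_trans (ler_wpM2r (ltW ur) e1) _.
  rewrite -!mulrA ler_wpM2l ?expR_ge0// [X in X <= _](_ : _ = w * (u r / q)); last by field; rewrite gt_eqF.
  apply: ler_pM => //; [exact: ltW|by rewrite divr_ge0 ?ltW|].
  apply: le_trans hI; case: ltP => qd.
    by rewrite ler_pdivrMr// mul1r.
  apply: ler_pM; rewrite ?invr_ge0 ?(ltW ur) ?(ltW qp)//.
    by rewrite u_le_max// rp.
  by rewrite lef_pV2 ?posrE.
have ud0 : 0 <= u r0 / d by rewrite divr_ge0 ?ltW// u_gt0// r0_gt0.
have [rr0|r0r] := leP r r0.
  apply: (key r r0) => //; [exact: ltW|exact: radial_left| |].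
    exact: (v_le_id du du1 u2_le0 u0 cu u10).
  case: ltP => rd.
    have -> : \1_`]0, d[ r = 1 :> R by rewrite indicE mem_set//= in_itv/= rp.
    by rewrite -addrA lerDl addr_ge0.
  by rewrite lerDr addr_ge0.
apply: (key (a - r) (a - r0)).
- by rewrite subr_gt0.
- by rewrite lerB// ltW.
- by rewrite gerBl ltW.
- exact: radial_right (ltW r0r) ra.
- have arp : 0 < a - r by rewrite subr_gt0.
  have ara : a - r < a by rewrite gtrBl.
  by have := v_le_id dv dv1 v2_le0 v0 cv v10 arp ara; rewrite /v subKr.
- case: ltP => rd.
    have -> : \1_`](a - d), a[ r = 1 :> R.
      by rewrite indicE mem_set//= in_itv/= ra andbT; lra.
    by rewrite addrC addrA lerDr addr_ge0.
  by rewrite lerDr addr_ge0.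
Qed.

End TwoSides.

(** * The bounds on a *)

Lemma eq_lerW (R : realType) (x y : R) : x = y -> x <= y.
Proof. by move->. Qed.

Section Estimates.
Context {R : realType} (a : R) (u : R -> R) (h : 'rV[R]_3 -> 'M[R]_3)
  (phi : 'rV[R]_3 -> R).
Hypotheses (rs : rot_sym_metric a u h) (sphi : smooth S2 phi)
  (phi_gt0 : forall p, S2 p -> 0 < phi p).

Let a_gt0 : 0 < a. Proof. by case: rs. Qed.
Let Phi (r t : R) : R := phi (polar a (row2 r t)).

Let Phi_gt0 r t : 0 < Phi r t. Proof. by apply: phi_gt0; exact: polar_S2. Qed.

(** The factor phi^-2 along theta and the factor phi^2 along xi cancel in the determinant, so the
    area of the torus does not depend on phi. An upper bound is all that a comparison with [MinA]
    requires. *)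
Lemma lat_volume r0 : 0 < r0 -> r0 < a ->
  exists2 A, has_volume 2 (warped phi h) (prodset (latset a r0) (@usphere R 2)) A &
    (A <= (4 * pi ^+ 2 * u r0)%:E)%E.
Proof.
move=> r0p r0a; have dec := decomp_prod (lat_decomp r0p r0a) (@circ_decomp R).
exists (\sum_(t : bool * bool) @piece_volume R (1 + 1) _ (warped phi h)
    (prodchart (latchart a r0) circ) (prodset (circ_D t.1) (circ_D t.2)))%E.
  exact: (decomp_volume (warped phi h) dec).
have up : 0 < u r0 by exact: rot_u_gt0 rs _ _ _.
rewrite (bigD1 (true, true))//= big1 ?adde0; last first.
  move=> [[] []]//= _.
  - apply: (@lebesgue_int2_null1 R _ pi) => x xpi.
    rewrite indicE memNset ?mul0r// => -[_ /=]; rewrite mxE => xe.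
    by move/eqP : xpi; apply; rewrite -xe; congr (x _ _); exact: val_inj.
  - apply: (@lebesgue_int2_null0 R _ pi) => x xpi.
    rewrite indicE memNset ?mul0r// => -[/= + _]; rewrite mxE => xe.
    by move/eqP : xpi; apply; rewrite -xe; congr (x _ _); exact: val_inj.
  - apply: (@lebesgue_int2_null0 R _ pi) => x xpi.
    rewrite indicE memNset ?mul0r// => -[/= + _]; rewrite mxE => xe.
    by move/eqP : xpi; apply; rewrite -xe; congr (x _ _); exact: val_inj.
have pi0 := @pi_gt0 R; have Npi : - pi <= pi :> R by rewrite ge0_cp ?ltW.
have i0 (A : set R) x : (0 <= \1_A x :> R)%R by rewrite indicE.
have detE (x : 'rV[R]_(1 + 1)) :
    \det (pullback (warped phi h) (prodchart (latchart a r0) circ) x) = u r0 ^+ 2.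
  rewrite pullback_warped; [|exact: differentiable_lat|exact: differentiable_circ].
  rewrite jacobian_circ_gram pullback_lat det_ublock !detZ det1 !det_scalar1 mulr1.
  have [_ _ _ ph] := rs; rewrite ph row_mx11E// !mxE/= !expr1 mulr1n.
  have p0 : phi (latchart a r0 (lsubmx x)) != 0.
    by rewrite gt_eqF// phi_gt0//; exact: polar_S2.
  by field.
apply: le_trans (lebesgue_int2_le (b := fun t => u r0 * \1_`](- pi), pi[ t) Npi _ _ _) _.
- by move=> x; rewrite lee_fin mulr_ge0 ?sqrtr_ge0// indicE.
- by move=> t; rewrite mulr_ge0// ltW.
- move=> t s; rewrite detE sqrtr_sqr ger0_norm ?(ltW up)// lee_fin.
  rewrite indicE; case: (boolP (_ \in _)); last by rewrite mul0r !mulr_ge0// ltW.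
  rewrite inE => -[/= ]; rewrite !mxE/= !subr0 => tpi spi.
  rewrite !indicE !mem_set/= ?in_itv/= -?ltr_norml// ?mulr1 ?mul1r//.
- under eq_integral do rewrite mulrAC.
  rewrite integral_cst_itv//; last by rewrite mulr_ge0 ?ltW// opprK addr_gt0.
  by rewrite lee_fin; apply: eq_lerW; ring.
Qed.

Lemma sphere_density (x : 'rV[R]_(2 + 0)) (q : 'rV[R]_2) :
  0 < (x : 'rV[R]_2) 0 0 < a ->
  Num.sqrt (\det (pullback (warped phi h) (prodchart (polar a) (ptchart q)) x)) =
  Phi ((x : 'rV[R]_2) 0 0) ((x : 'rV[R]_2) 0 1) ^- 2 * u ((x : 'rV[R]_2) 0 0).
Proof.
move=> /andP[x0 xa]; rewrite pullback_warped; [|exact: differentiable_polar|exact: differentiable_cst].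
rewrite lsub20; have -> : phi (polar a x) = Phi ((x : 'rV[R]_2) 0 0) ((x : 'rV[R]_2) 0 1).
  rewrite /Phi; congr (phi (polar a _)).
  by apply/rowP => -[[|[|//]] Hi]; rewrite mxE/=; congr (x _ _); exact: val_inj.
have [_ _ _ ph] := rs; rewrite ph// det_ublock det_mx00 mulr1 detZ det_diag.
rewrite big_ord_recl big_ord1 !mxE/= mul1r -exprMn sqrtr_sqr ger0_norm//.
by rewrite mulr_ge0 ?invr_ge0 ?sqr_ge0// ltW// (rot_u_gt0 rs).
Qed.

(** The density is dominated by a step function of r: the caps of width [d] at the two poles
    contribute 2 d, the constant term m a, and theta the factor 2 pi. *)
Lemma slice_volume (c d B m : R) : 0 < d -> d <= a -> 0 <= B -> 0 <= m ->
  (forall r t, 0 < r < a -> `|t| < pi ->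
    Phi r t ^- 2 * u r <= B * (\1_`]0, d[ r + \1_`](a - d), a[ r + m)) ->
  exists2 A, has_volume 2 (warped phi h) (prodset S2 [set circ (c%:M)]) A &
    (A <= (B * (2 * d + m * a) * (2 * pi))%:E)%E.
Proof.
move=> dp da B0 m0 hB.
have dec := decomp_prod (sphere_decomp a_gt0) (pt_decomp (circ (c%:M))).
exists (\sum_(t : (bool + bool) * unit) @piece_volume R (2 + 0) _ (warped phi h)
    (prodchart (sphere_chart a t.1) (ptchart (circ c%:M))) (prodset (sphere_D a t.1) setT))%E.
  exact: (decomp_volume (warped phi h) dec).
rewrite (bigD1 (inl true, tt))//= big1 ?adde0; last first.
  move=> [[[]|b] []]//= _.
  - apply: (@lebesgue_int2_null1 R _ pi) => x xpi.
    rewrite indicE memNset ?mul0r// => -[[_ _ +] _]; rewrite lsub20 => xe.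
    by rewrite xe eqxx in xpi.
  - apply: (@lebesgue_int2_null0 R _ 0) => x xpi.
    rewrite indicE memNset ?mul0r// => -[/= + _]; rewrite lsub20 => xe.
    by rewrite xe mxE eqxx in xpi.
have pi0 := @pi_gt0 R; have Npi : - pi <= pi :> R by rewrite ge0_cp ?ltW.
have i0 (A : set R) x : (0 <= \1_A x :> R)%R by rewrite indicE.
pose b (t : R) : R := B * (\1_`]0, d[ t + \1_`](a - d), a[ t + m * \1_`]0, a[ t).
have b0 t : 0 <= b t by rewrite mulr_ge0// !addr_ge0// mulr_ge0.
apply: le_trans (lebesgue_int2_le (b := b) Npi _ b0 _) _.
- by move=> x; rewrite lee_fin mulr_ge0 ?sqrtr_ge0// indicE.
- move=> t s; rewrite lee_fin indicE; case: (boolP (_ \in _)); last by rewrite mul0r mulr_ge0.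
  rewrite inE => -[[]]; rewrite lsub20 !row2E subr0 => t0 ta spi _.
  rewrite mul1r sphere_density ?row2E ?t0// indicE mem_set/= ?in_itv/= -?ltr_norml// mulr1.
  apply: le_trans (hB _ _ _ spi) _; first by rewrite t0.
  by rewrite /b [\1_`]0, a[ t]indicE mem_set/= ?in_itv/= ?t0// mulr1.
pose k := B * (pi - - pi).
have k0 : 0 <= k by rewrite mulr_ge0// subr_ge0.
(* Additivity of the integral is used for the dominating step function only, whose measurability is
   clear. *)
rewrite [leLHS](_ : _ = \int[@lebesgue_measure R]_(t in setT)
    ((k * \1_`]0, d[ t)%:E + (k * \1_`](a - d), a[ t)%:E
     + (k * m * \1_`]0, a[ t)%:E))%E; last first.
  by apply: eq_integral => t _; rewrite -!EFinD; congr EFin; rewrite /b /k; ring.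
rewrite ge0_integralD//; last 4 first.
- by move=> t _; rewrite adde_ge0// lee_fin mulr_ge0.
- by apply: emeasurable_funD; (apply/measurable_EFinP; apply: measurable_funM => //; exact: measurable_indic).
- by move=> t _; rewrite lee_fin (mulr_ge0 (mulr_ge0 k0 m0)).
- by (apply/measurable_EFinP; apply: measurable_funM => //; exact: measurable_indic).
rewrite ge0_integralD//; last 4 first.
- by move=> t _; rewrite lee_fin mulr_ge0.
- by (apply/measurable_EFinP; apply: measurable_funM => //; exact: measurable_indic).
- by move=> t _; rewrite lee_fin mulr_ge0.
- by (apply/measurable_EFinP; apply: measurable_funM => //; exact: measurable_indic).
have d0 : 0 <= d by exact: ltW.
have ad : a - d <= a by rewrite gerBl.
have a0 : 0 <= a by exact: ltW.
have km : 0 <= k * m by exact: mulr_ge0.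
rewrite !integral_cst_itv//.
by rewrite -!EFinD lee_fin; apply: eq_lerW; rewrite /k; ring.
Qed.

Lemma total_volume (c l r : R) : 0 <= c -> 0 <= l -> l <= r -> r <= a ->
  (forall x t, l < x < r -> `|t| < pi -> c <= (Phi x t)^-1 * u x) ->
  exists2 V, has_volume 3 (warped phi h) S2xS1 V &
    ((c * (r - l) * (4 * pi ^+ 2))%:E <= V)%E.
Proof.
move=> c0 l0 lr ra hc; have dec := decomp_prod (sphere_decomp a_gt0) (@circ_decomp R).
exists (\sum_(t : (bool + bool) * bool) @piece_volume R (2 + 1) _ (warped phi h)
    (prodchart (sphere_chart a t.1) circ) (prodset (sphere_D a t.1) (circ_D t.2)))%E.
  exact: (decomp_volume (warped phi h) dec).
rewrite (bigD1 (inl true, true))//=.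
(* For a lower bound the main piece suffices, the other ones having nonnegative volume. *)
apply: le_trans (leeDl _ _); last by apply: sume_ge0 => t _; exact: piece_volume_ge0.
have pi0 := @pi_gt0 R; have Npi : - pi <= pi :> R by rewrite ge0_cp ?ltW.
rewrite (_ : _ * _ = c * (pi - - pi) * (pi - - pi) * (r - l)); last by ring.
rewrite /piece_volume; apply: lebesgue_int3_ge => //.
move=> t s w; rewrite lee_fin.
have rhs0 : 0 <= \1_(prodset (polar_dom a 0) [set x : 'rV[R]_1 | `|x 0 0 - 0| < pi])
    (row3 t s w) * Num.sqrt (\det (pullback (warped phi h) (prodchart (polar a) circ) (row3 t s w : 'rV[R]_(2 + 1)))).
  by rewrite mulr_ge0 ?sqrtr_ge0// indicE.
have [tlr|tlr] := boolP (l < t < r); last first.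
  by rewrite [X in _ * X * _ * _]indicE memNset ?(mulr0, mul0r)//= in_itv/=; exact/negP.
have [spi|spi] := boolP (- pi < s < pi); last first.
  by rewrite [X in _ * X * _]indicE memNset ?(mulr0, mul0r)//= in_itv/=; exact/negP.
have [wpi|wpi] := boolP (- pi < w < pi); last first.
  by rewrite [X in _ * X]indicE memNset ?(mulr0, mul0r)//= in_itv/=; exact/negP.
rewrite !indicE !mem_set/= ?in_itv/= ?tlr ?spi ?wpi//; last first.
  split=> /=; last by rewrite !mxE/= subr0 ltr_norml.
  case/andP: tlr => lt tr; rewrite /polar_dom/= !mxE/= subr0 ltr_norml spi.
  by split=> //; [exact: le_lt_trans lt|exact: lt_le_trans ra].
have /andP[lt tr] := tlr.
have Ox : warpOm a (row3 t s w).
  by rewrite /warpOm/= mxE/= (le_lt_trans l0)//= (lt_le_trans tr).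
have up : 0 < u t by apply: (rot_u_gt0 rs); [exact: le_lt_trans lt|exact: lt_le_trans ra].
rewrite -/(warpgam a h phi) (warpgamE phi rs Ox) det_diag.
have -> : warpF a phi (row3 t s w) = Phi t s.
  rewrite /warpF /Phi; congr (phi (polar a _)).
  by apply/rowP => -[[|[|//]] Hi]; rewrite !mxE.
have P0 := Phi_gt0 t s.
rewrite !big_ord_recl big_ord0 !mxE/=.
rewrite [X in Num.sqrt X](_ : _ = ((Phi t s)^-1 * u t) ^+ 2); last first.
  by field; rewrite gt_eqF.
rewrite sqrtr_sqr ger0_norm; last by rewrite mulr_ge0 ?invr_ge0 ?ltW.
by rewrite !mulr1 mul1r; apply: hc => //; rewrite ltr_norml.
Qed.

Let Phi_diff r t : differentiable (fun w => phi (polar a w)) (row2 r t).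
Proof. exact: (Ck_diff (Ck_phi_polar a sphi 0)). Qed.

Let du r : 0 < r < a -> is_derive r 1 u ('D_1 u r).
Proof.
by move=> ra; apply: DeriveDef => //; apply: diff_derivable; exact: Ck_diff (Ck_u rs) _.
Qed.

Let du1 r : 0 < r < a -> is_derive r 1 ('D_1 u) ('D_1 ('D_1 u) r).
Proof.
move=> ra; apply: DeriveDef => //; apply: diff_derivable.
by have [_ /(_ 1)[+ _]] := Ck_u rs; exact.
Qed.

Let lnPhi (r t : R) : R := ln (Phi r t).
Let lnPhi_r (r t : R) : R := partial 0 (fun w => phi (polar a w)) (row2 r t) / Phi r t.
Let lnPhi_t (r t : R) : R := partial 1 (fun w => phi (polar a w)) (row2 r t) / Phi r t.

Let dln (g : R -> R) (x y : R) : 0 < g x -> is_derive x 1 g y ->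
  is_derive x 1 (fun z => ln (g z)) (y / g x).
Proof.
move=> gx [dg gE]; have [dl lE] := is_derive1_ln gx.
have dg' : differentiable g x by exact/derivable1_diffP.
have dl' : differentiable (@ln R) (g x) by exact/derivable1_diffP.
apply: DeriveDef; last by rewrite derive_comp1// gE lE.
by apply/derivable1_diffP; exact: (differentiable_comp dg' dl').
Qed.

Let dlnPhi_r (r t : R) : 0 < r < a -> is_derive r 1 (lnPhi ^~ t) (lnPhi_r r t).
Proof. by move=> _; have [d _] := derive_row2 (Phi_diff r t); exact: dln. Qed.

Let dlnPhi_t (r t : R) : 0 < r < a -> is_derive t 1 (lnPhi r) (lnPhi_t r t).
Proof. by move=> _; have [_ d] := derive_row2 (Phi_diff r t); exact: dln. Qed.

Let lnPhi_bound (sc : scalar_ge0 3 S2xS1 (warped phi h)) r t : 0 < r < a ->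
  lnPhi_r r t ^+ 2 + lnPhi_t r t ^+ 2 / u r ^+ 2 <= - ('D_1 ('D_1 u) r / u r).
Proof.
move=> /andP[r0 ra]; have := gradient_bound rs sphi phi_gt0 t sc r0 ra.
rewrite -/(Phi r t) /lnPhi_r /lnPhi_t !exprMn; set p := partial _ _ _; set q := partial _ _ _.
have P0 := Phi_gt0 r t; have u0 := rot_u_gt0 rs r0 ra.
move=> H; rewrite -(@ler_pM2l _ (Phi r t ^+ 2)) ?exprn_gt0//.
by congr (_ <= _) : H; field; rewrite !gt_eqF.
Qed.

Let uc : {within `[0, a], continuous u}.
Proof. by apply: smooth_within_continuous; case: rs => _ []. Qed.

Let Phi_inv r t : (Phi r t)^-1 = expR (- lnPhi r t).
Proof. by rewrite expRN lnK// posrE. Qed.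

(** [m] is the lower bound for u(r0) given by the area of the torus. [k] gathers the constants of
    the volume and slice estimates, which lead to a <= k^2 / (A0^2 m^3); the summand m^-1 takes care
    of the lower bound a >= m. *)
Definition diam_bound (V0 A0 : R) : R :=
  let m := A0 / (4 * pi ^+ 2) in
  let k := (V0 / (expR (- (6 + 2 * pi)) * pi ^+ 2)) ^+ 2 *
    (expR (10 + 4 * pi) * (6 * pi)) in
  k ^+ 2 / (A0 ^+ 2 * m ^+ 3) + m^-1.

Lemma diam_bound_gt0 V0 A0 : 0 < A0 -> 0 < diam_bound V0 A0.
Proof.
move=> A0p; have pi0 := @pi_gt0 R.
have mp : 0 < A0 / (4 * pi ^+ 2) by rewrite divr_gt0// mulr_gt0// exprn_gt0.
rewrite /diam_bound ltr_wpDl ?invr_gt0// divr_ge0 ?sqr_ge0//.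
by rewrite mulr_ge0 ?sqr_ge0// exprn_ge0// ltW.
Qed.

Lemma a_bounds (V0 A0 : R) : 0 < V0 -> 0 < A0 ->
  scalar_ge0 3 S2xS1 (warped phi h) ->
  (forall V, has_volume 3 (warped phi h) S2xS1 V -> (V <= V0%:E)%E) ->
  (A0%:E <= MinA S2xS1 (warped phi h))%E ->
  (diam_bound V0 A0)^-1 <= a /\ a <= diam_bound V0 A0.
Proof.
move=> V0p A0p sc hV hA; have pi0 := @pi_gt0 R.
have [_ [_ _ [u0 ua] u10 u1a] _ _] := rs.
have ug r : 0 < r < a -> 0 < u r by move=> /andP[]; exact: rot_u_gt0 rs r.
have bnd := lnPhi_bound sc.
have [r0 /andP[r0p r0a] cr] := exists_critical a_gt0 du ug u0 ua uc.
have up : 0 < u r0 by rewrite ug// r0p.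
have MA (S : set 'rV[R]_(3 + 2)) A x :
    closed_minimal_surface S2xS1 (warped phi h) S ->
    has_volume 2 (warped phi h) S A -> (A <= x%:E)%E -> A0 <= x.
  move=> cS vS Ax; rewrite -lee_fin; apply: le_trans Ax; apply: le_trans hA _.
  by apply: ereal_inf_lbound; exists S.
set m := A0 / (4 * pi ^+ 2).
have mp : 0 < m by rewrite divr_gt0// mulr_gt0// exprn_gt0.
have mu : m <= u r0.
  have [A vA Ab] := lat_volume r0p r0a.
  have := MA _ _ _ (lat_closed_minimal rs sphi phi_gt0 r0p r0a cr) vA Ab.
  by rewrite /m ler_pdivrMr ?mulr_gt0 ?exprn_gt0// mulrC.
have ur0 : u r0 <= r0.
  exact: (max_le_r0 du du1 ug u0 uc u10 bnd r0p r0a).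
set E := expR (- lnPhi r0 0); set M := u r0 in up mu ur0 *.
pose K1 : R := expR (- (6 + 2 * pi)); pose K2 : R := expR (10 + 4 * pi).
have E0 : 0 < E by exact: expR_gt0.
have K10 : 0 < K1 by exact: expR_gt0.
have K20 : 0 < K2 by exact: expR_gt0.
(* Here a / 2 is the length of the interval from r0 / 2 to (r0 + a) / 2, and 4 pi^2 comes from the
   two angles. *)
have hvol : E * K1 * (M / 2) * (a / 2) * (4 * pi ^+ 2) <= V0.
  have l0 : 0 <= r0 / 2 by rewrite divr_ge0// ltW.
  have lr : r0 / 2 <= (r0 + a) / 2 by lra.
  have ra : (r0 + a) / 2 <= a by lra.
  have c0 : 0 <= E * K1 * (M / 2) by rewrite !mulr_ge0 ?ltW ?invr_gt0.
  have [|V vV Vb] := total_volume c0 l0 lr ra.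
    move=> x t /andP[lx xr] tpi; rewrite Phi_inv -expRD.
    exact: (volume_density_ge du du1 ug u0 ua uc u1a dlnPhi_r dlnPhi_t bnd r0p r0a cr).
  have := le_trans Vb (hV _ vV); rewrite lee_fin; apply: le_trans.
  by apply: eq_lerW; ring.
(* This width balances the caps against the rest of the slice: M a / d = d, so that 2 d + (M / d) a
   becomes 3 d. *)
pose d := Num.sqrt (M * a).
have d2 : d ^+ 2 = M * a by rewrite sqr_sqrtr// mulr_ge0// ltW.
have dp : 0 < d by rewrite sqrtr_gt0 mulr_gt0.
have Ma : M <= a by exact: le_trans (ltW r0a).
have da : d <= a.
  rewrite -(@ler_pXn2r _ 2) ?nnegrE ?(ltW dp) ?(ltW a_gt0)// d2 expr2.
  by rewrite ler_wpM2r// ltW.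
have harea : A0 <= E ^+ 2 * K2 * a * (3 * d) * (2 * pi).
  have B0 : 0 <= E ^+ 2 * K2 * a by rewrite !mulr_ge0 ?sqr_ge0 ?ltW.
  have m0 : 0 <= M / d by rewrite divr_ge0// ltW.
  have [|A vA Ab] := slice_volume 0 dp da B0 m0.
    move=> r t ra tpi.
    have e2 x : expR (- x) ^+ 2 = expR (- 2 * x) :> R.
      by rewrite -expRM_natl; congr expR; ring.
    rewrite -exprVn Phi_inv e2 /E e2 -expRD.
    exact: (area_density_le du du1 ug u0 ua uc u10 u1a dlnPhi_r dlnPhi_t bnd r0p r0a cr).
  have cS : closed_minimal_surface S2xS1 (warped phi h) (prodset S2 [set circ 0%:M]).
    exact: slice_closed_minimal.
  have := MA _ _ _ cS vA Ab.
  rewrite (_ : 2 * d + M / d * a = 3 * d)//.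
  rewrite mulrAC -d2 expr2 mulfK ?gt_eqF//; ring.
have pi2 : 0 < pi ^+ 2 :> R by rewrite exprn_gt0.
have hv : E * M * a <= V0 / (K1 * pi ^+ 2).
  rewrite ler_pdivlMr ?mulr_gt0//; apply: le_trans hvol.
  by apply: eq_lerW; field.
set v := V0 / (K1 * pi ^+ 2) in hv.
have vp : 0 < v by rewrite divr_gt0// mulr_gt0.
pose k := v ^+ 2 * (K2 * (6 * pi)).
have kp : 0 < k by rewrite mulr_gt0 ?exprn_gt0// mulr_gt0// mulr_gt0.
(* Multiplication by M^2 a turns the uncontrolled factor E^2 a into (E M a)^2, which the volume
   bounds. *)
have h1 : A0 * M ^+ 2 * a <= k * d.
  apply: (@le_trans _ _ ((E * M * a) ^+ 2 * (K2 * (6 * pi)) * d)).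
    rewrite [leRHS](_ : _ = E ^+ 2 * K2 * a * (3 * d) * (2 * pi) * (M ^+ 2 * a)); last by ring.
    by rewrite -[leLHS]mulrA ler_wpM2r// mulr_ge0 ?sqr_ge0// ltW.
  have EMa : 0 <= E * M * a by rewrite !mulr_ge0// ltW.
  apply: ler_wpM2r; first exact: ltW.
  apply: ler_wpM2r; first by rewrite !mulr_ge0// ltW.
  by rewrite ler_pXn2r// nnegrE// ltW.
have h2 : (A0 * M ^+ 2 * a) ^+ 2 <= k ^+ 2 * (M * a).
  have AM0 : 0 <= A0 * M ^+ 2 * a by rewrite !mulr_ge0 ?sqr_ge0// ltW.
  have kd0 : 0 <= k * d by rewrite mulr_ge0// ltW.
  by rewrite -d2 -exprMn ler_pXn2r.
have h3 : A0 ^+ 2 * M ^+ 3 * a <= k ^+ 2.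
  rewrite -(@ler_pM2r _ (M * a)) ?mulr_gt0//; apply: le_trans h2.
  by apply: eq_lerW; ring.
have h4 : A0 ^+ 2 * m ^+ 3 * a <= k ^+ 2.
  apply: le_trans h3; rewrite ler_wpM2r ?(ltW a_gt0)// ler_wpM2l ?sqr_ge0//.
  by rewrite ler_pXn2r// nnegrE ltW.
have cE : diam_bound V0 A0 = k ^+ 2 / (A0 ^+ 2 * m ^+ 3) + m^-1 by [].
have Am : 0 < A0 ^+ 2 * m ^+ 3 by rewrite mulr_gt0 ?exprn_gt0.
split.
  have mD : m^-1 <= diam_bound V0 A0 by rewrite cE lerDr divr_ge0 ?sqr_ge0// ltW.
  apply: (@le_trans _ _ m); last exact: le_trans mu Ma.
  by rewrite -[leRHS]invrK lef_pV2 ?posrE ?invr_gt0// diam_bound_gt0.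
rewrite cE; apply: (@le_trans _ _ (k ^+ 2 / (A0 ^+ 2 * m ^+ 3))).
  by rewrite ler_pdivlMr// mulrC.
by rewrite lerDl invr_ge0 ltW.
Qed.

End Estimates.

(** * The diameter *)

Lemma quad_scale (R : realType) n (c : R) (v : 'rV[R]_n) (G : 'M[R]_n) :
  ((c *: v) *m G *m (c *: v)^T) 0 0 = c ^+ 2 * (v *m G *m v^T) 0 0.
Proof. by rewrite linearZ/= -!scalemxAl -scalemxAr scalerA -expr2 mxE. Qed.

Lemma quad_row (R : realType) m n (A : 'M[R]_(m.+1, n)) (G : 'M[R]_n) :
  (row 0 A *m G *m (row 0 A)^T) 0 0 = (A *m G *m A^T) 0 0.
Proof. by rewrite -row_mul mxE [RHS]mxE; apply: eq_bigr => j _; rewrite !mxE. Qed.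

Section Diameter.
Context {R : realType} (a : R) (u : R -> R) (h : 'rV[R]_3 -> 'M[R]_3).
Hypothesis (rs : rot_sym_metric a u h).

Let a_gt0 : 0 < a. Proof. by case: rs. Qed.

Definition meridian (t r s : R) (x : R) : 'rV[R]_3 := polar a (row2 (r + (s - r) * x) t).

Lemma Ck_meridian t r s n : Ck n setT (meridian t r s).
Proof.
have cr : Ck n setT (fun x : R => row2 (r + (s - r) * x) t).
  apply/Ck_mx; first exact: openT.
  move=> i [[|[|//]] Hj].
  - rewrite (_ : (fun _ => _) = fun x : R => r + (s - r) * x); last first.
      by apply/funext => x; rewrite mxE.
    apply: Ck_add; [exact: openT|exact: Ck_cst|].
    apply: Ck_mul; [exact: openT|exact: Ck_cst|].
    by apply: (@Ck_linear R R n setT R idfun) => x; exact: cvg_id.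
  - rewrite (_ : (fun _ => _) = cst t); first exact: Ck_cst.
    by apply/funext => x; rewrite mxE.
apply/Ck_mx; first exact: openT.
move=> i j; rewrite (ord1 i).
apply: (@Ck_comp _ _ _ _ _ setT (fun w => polar a w 0 j)) => //; first exact: openT.
by move/Ck_mx : (Ck_polar a n openT); apply; exact: openT.
Qed.

Lemma smooth_meridian t r s : smooth [set x : R | 0 <= x <= 1] (meridian t r s).
Proof.
move=> x _; exists setT, (meridian t r s); split=> //; first exact: openT.
by apply/smooth_openP => n; exact: Ck_meridian.
Qed.

Lemma derive_meridian t r s x :
  derive1 (meridian t r s) x =
  (s - r) *: row 0 ('J (polar a) (row2 (r + (s - r) * x) t)).
Proof.
pose F (x : R) := row2 (r + (s - r) * x) t.
have dl : differentiable (fun x : R => r + (s - r) * x) x.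
  by apply: dfD => //; apply: dfM.
have dF : differentiable F x.
  apply: differentiable_mx => i [[|[|//]] Hj].
  - by rewrite (_ : (fun _ => _) = fun x : R => r + (s - r) * x)//; apply/funext => y; rewrite mxE.
  - by rewrite (_ : (fun _ => _) = cst t)//; apply/funext => y; rewrite mxE.
have DF : 'D_1 F x = (s - r) *: delta_mx 0 0.
  apply/rowP => j; rewrite derive_mxE//; case: j => -[|[|//]] Hj; rewrite !mxE/=.
  - rewrite (_ : (fun _ => _) = fun x : R => r + (s - r) * x); last first.
      by apply/funext => y; rewrite mxE.
    rewrite (derive_fD (f := cst r) (g := fun y : R => cst (s - r) y * id y))//.
    rewrite (derive_fM (f := cst (s - r)) (g := id))//.
    rewrite !derive_cst derive_id mulr0 add0r addr0.
    by rewrite ?mulr1n ?mulr1.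
  - rewrite (_ : (fun _ => _) = cst t); last by apply/funext => y; rewrite mxE.
    by rewrite derive_cst mulr0n mulr0.
have dp := differentiable_polar a (F x).
rewrite derive1E -[meridian t r s]/(polar a \o F) (derive_comp _ dF dp) DF.
by rewrite deriveEjacobian// -scalemxAl -rowE.
Qed.

Lemma meridian_length t r s : 0 <= r <= a -> 0 <= s <= a ->
  arc_length h (meridian t r s) = `|s - r|%:E.
Proof.
move=> /andP[r0 ra] /andP[s0 sa]; rewrite /arc_length.
rewrite (eq_integral (cst (`|s - r|%:E))); last first.
  move=> x; rewrite inE /= in_itv/= => /andP[x0 x1]; congr EFin.
  rewrite derive_meridian quad_scale quad_row -[meridian t r s x]/(polar a (row2 (r + (s - r) * x) t)).
  have [->|rns] := eqVneq s r; first by rewrite subrr expr0n/= mul0r sqrtr0 normr0.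
  set w := row2 _ _.
  (* For 0 < x < 1 and distinct r, s, the radius is strictly between two points of [0, a]: the curve
     is off the poles, where the polar form of [h] applies. *)
  have [w0 wa] : 0 < w 0 0 /\ w 0 0 < a.
    rewrite row2E (_ : r + (s - r) * x = (1 - x) * r + x * s); last by ring.
    have [rs'|sr|e] := ltgtP r s; last by rewrite e eqxx in rns.
      by split; nra.
    by split; nra.
  have [_ _ _ ph] := rs; have := ph w w0 wa.
  rewrite /pullback => ->.
  by rewrite !mxE/= mulr1n mulr1 sqrtr_sqr.
by rewrite integral_cst//= lebesgue_measure_itv/= lte_fin ltr01 -EFinD subr0 mule1.
Qed.

Lemma polar_surj (p : 'rV[R]_3) : S2 p ->
  exists r t, 0 <= r <= a /\ p = polar a (row2 r t).
Proof.
move=> Sp; have [_ _ _ cov] := sphere_decomp a_gt0.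
have [[b|b] [x [Dx px]]] := cov _ Sp.
  exists (x 0 0), (x 0 1).
  have [x0 xa] : 0 < x 0 0 /\ x 0 0 < a by case: b Dx px => -[].
  rewrite !ltW//; split=> //; rewrite -px; congr (polar a _).
  by apply/rowP => -[[|[|//]] Hi]; rewrite mxE/=; congr (x _ _); exact: val_inj.
move: Dx => /= Dx; rewrite Dx in px.
exists (if b then a else 0), 0; split; first by case: b {px}; rewrite lexx ltW.
rewrite -px; apply/rowP => -[[|[|[|//]]] Hi]; rewrite !mxE/=.
- by case: b {px}; rewrite ?mulr0 ?mul0r ?sin0 ?mul0r// mulfK ?gt_eqF// sinpi !mul0r.
- by rewrite sin0 !mulr0 mul0r.
- rewrite expr0n/= !subr0 !addr0 divr1 mulr1.
  by case: b {px}; rewrite ?expr1 ?expr0 ?mulr0 ?mul0r ?cos0// mulfK ?gt_eqF// cospi.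
Qed.

Lemma polar_pole0 t t' : polar a (row2 0 t) = polar a (row2 0 t').
Proof. by apply/rowP => -[[|[|[|//]]] Hi]; rewrite !mxE/= !mulr0 mul0r ?sin0 ?mul0r. Qed.

Lemma polar_polea t t' : polar a (row2 a t) = polar a (row2 a t').
Proof.
by apply/rowP => -[[|[|[|//]]] Hi]; rewrite !mxE/= mulfK ?gt_eqF// ?sinpi ?mul0r.
Qed.

Lemma riem_dist_le (p q : 'rV[R]_3) : S2 p -> S2 q -> (riem_dist S2 h p q <= a%:E)%E.
Proof.
move=> /polar_surj[r [t [r0a ->]]] /polar_surj[s [t' [s0a ->]]].
have cs x : 0 <= x <= a -> polar a (row2 x t) = polar a (row2 x t') ->
    (riem_dist S2 h (polar a (row2 r t)) (polar a (row2 s t')) <= (`|x - r| + `|s - x|)%:E)%E.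
  move=> xa xt; apply: ereal_inf_lbound => /=.
  exists [:: meridian t r x; meridian t' x s]; split; last first.
    have l1 := meridian_length t r0a xa; have l2 := meridian_length t' xa s0a.
    rewrite big_cons.
    rewrite big_cons.
    rewrite big_nil.
    by rewrite l1 l2 adde0 EFinD.
  rewrite /= /meridian !mulr0 !addr0 !mulr1 !subrKC xt; split=> //.
  - exact: smooth_meridian.
  - by move=> ? _; exact: polar_S2.
  - split=> //; first exact: smooth_meridian.
    by move=> ? _; exact: polar_S2.
move: (r0a) (s0a) => /andP[r0 ra] /andP[s0 sa].
have h0 := cs 0 _ (polar_pole0 t t'); have ha := cs a _ (polar_polea t t').
(* The ways through the two poles have lengths r + s and 2 a - r - s, whose sum is 2 a: one of them
   is at most a. *)
have [rsa|ars] := leP (r + s) a.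
  apply: le_trans (h0 _) _; first by rewrite lexx ltW.
  by rewrite lee_fin sub0r normrN subr0 !ger0_norm.
apply: le_trans (ha _) _; first by rewrite lexx ltW.
by rewrite lee_fin ger0_norm ?subr_ge0// distrC ger0_norm ?subr_ge0//; lra.
Qed.

(* For [v] tangent at [p] this is h(v, v) >= dr(v)^2, written in terms of the
   height z = cos (pi r / a), which, unlike r, is smooth at the poles. *)
Lemma tangent_norm_ge (p v : 'rV[R]_3) : S2 p -> p 0 i32 ^+ 2 < 1 ->
  p 0 i30 * v 0 i30 + p 0 i31 * v 0 i31 + p 0 i32 * v 0 i32 = 0 ->
  (a / pi) ^+ 2 * v 0 i32 ^+ 2 <= (1 - p 0 i32 ^+ 2) * (v *m h p *m v^T) 0 0.
Proof.
move=> Sp z1 orth; have [r [t [r0a pE]]] := polar_surj Sp.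
have zE : p 0 i32 = cos (pi * r / a) by rewrite pE polar_z row2E.
have pi0 := @pi_gt0 R.
have [r0 ra] : 0 < r /\ r < a.
  move: r0a => /andP[r0 ra]; split; rewrite lt_neqAle ?r0 ?ra andbT; apply/eqP => re;
    move: z1; rewrite zE.
    by rewrite -re mulr0 mul0r cos0 expr1n ltxx.
  by rewrite re mulfK ?gt_eqF// cospi sqrrN expr1n ltxx.
set s := pi * r / a in zE.
have s0 : 0 < sin s by apply: sin_gt0_pi; exact: polar_angle_in.
have cs := cos2Dsin2 s; have ct := cos2Dsin2 t.
have p0 : p 0 i30 = sin s * cos t by rewrite pE mxE/= !row2E.
have p1 : p 0 i31 = sin s * sin t by rewrite pE mxE/= !row2E.
(* [al] and [be] are the components of [v] along the coordinate fields of r and theta. The first is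
   read off the vertical part of [v], the second off the horizontal part, and tangency accounts for
   the remaining equation. *)
pose al := - (v 0 i32 * a / (pi * sin s)).
pose be := (v 0 i31 * cos t - v 0 i30 * sin t) / sin s.
have vE : v = row2 al be *m 'J (polar a) (row2 r t).
  rewrite -deriveEjacobian; last exact: differentiable_polar.
  rewrite derive_polar !row2E -/s.
  have alE : pi * al / a = - (v 0 i32 / sin s).
    rewrite /al; move: (sin s) (pi : R) pi0 s0 (a : R) a_gt0 => S P P0 S0 A A0.
    by field; rewrite !gt_eqF.
  have orth' : v 0 i32 * cos s = - sin s * (v 0 i30 * cos t + v 0 i31 * sin t).
    by apply/eqP; rewrite -subr_eq0 -orth p0 p1 zE; apply/eqP; ring.
  have beE : be * sin s = v 0 i31 * cos t - v 0 i30 * sin t by rewrite /be mulfVK ?gt_eqF.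
  have q : - (v 0 i32 / sin s) * cos s = v 0 i30 * cos t + v 0 i31 * sin t.
    rewrite mulNr mulrAC orth' mulNr mulNr opprK [sin s * _]mulrC mulfK ?gt_eqF//.
  apply/rowP => -[[|[|[|//]]] Hi]; rewrite mxE/= alE ?q ?beE.
  - rewrite (_ : Ordinal Hi = i30); last exact: val_inj.
    by rewrite -[LHS]mulr1 -ct; ring.
  - rewrite (_ : Ordinal Hi = i31); last exact: val_inj.
    by rewrite -[LHS]mulr1 -ct; ring.
  - rewrite (_ : Ordinal Hi = i32); last exact: val_inj.
    by rewrite mulNr opprK mulfVK// gt_eqF.
have [_ _ _ ph] := rs; have := ph (row2 r t); rewrite row2E => /(_ r0 ra) phE.
have nE : (v *m h p *m v^T) 0 0 = al ^+ 2 + u r ^+ 2 * be ^+ 2.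
  rewrite vE pE trmx_mul.
  have -> : row2 al be *m 'J (polar a) (row2 r t) *m h (polar a (row2 r t)) *m
      (('J (polar a) (row2 r t))^T *m (row2 al be)^T) =
      row2 al be *m pullback h (polar a) (row2 r t) *m (row2 al be)^T.
    by rewrite /pullback !mulmxA.
  rewrite phE mul_mx_diag mxE sum2E !mxE/=; ring.
rewrite nE zE (_ : 1 - cos s ^+ 2 = sin s ^+ 2); last by rewrite sin2cos2.
apply: (@le_trans _ _ (sin s ^+ 2 * al ^+ 2)).
  apply: eq_lerW; rewrite /al; move: (sin s) (pi : R) pi0 s0 => S P P0 S0.
  by field; rewrite !gt_eqF.
by rewrite ler_wpM2l ?sqr_ge0// lerDl mulr_ge0 ?sqr_ge0.
Qed.

(** * Length of a single arc, compared with its change of height *)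

Section ArcLength.
Variables (rho : R) (rho0 : 0 < rho) (rho1 : rho < 1).
Variables (c : R -> 'rV[R]_3) (sc : smooth [set t : R | 0 <= t <= 1] c)
  (Sc : forall t, 0 <= t <= 1 -> S2 (c t)).

Let z t : R := c t 0 i32.
Let z1 t : R := ('D_1 c t) 0 i32.
Let w t : R := a / pi * asin (rho * z t).
Let w1 t : R := a / pi * ((Num.sqrt (1 - (rho * z t) ^+ 2))^-1 * (rho * z1 t)).

Let dc (t : R) : 0 < t < 1 -> differentiable c t.
Proof. exact: (Ck_diff (Ck_smooth_itv 0 sc)). Qed.

Let dc1 (t : R) : 0 < t < 1 -> differentiable ('D_1 c) t.
Proof. by have [_ /(_ 1)[+ _]] := Ck_smooth_itv 1 sc; exact. Qed.

Let z_le1 (t : R) : 0 <= t <= 1 -> z t ^+ 2 <= 1.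
Proof. by move=> /Sc/S2E <-; rewrite lerDr addr_ge0 ?sqr_ge0. Qed.

Let rz2 (t : R) : 0 <= t <= 1 -> (rho * z t) ^+ 2 < 1.
Proof.
move=> /z_le1 zt; rewrite exprMn.
have r2 : rho ^+ 2 < 1 by rewrite expr_lt1// ltW.
apply: le_lt_trans r2; rewrite -[leRHS]mulr1; apply: ler_wpM2l; [exact: sqr_ge0|exact: zt].
Qed.

Let rz1 (t : R) : 0 <= t <= 1 -> -1 < rho * z t < 1.
Proof. by move=> /rz2 h2; apply/andP; split; nra. Qed.

Let le01 (t : R) : 0 < t < 1 -> 0 <= t <= 1.
Proof. by move=> /andP[? ?]; rewrite !ltW. Qed.

Let dw (t : R) : 0 < t < 1 -> is_derive t 1 w (w1 t).
Proof.
move=> t01; have rz := rz1 (le01 t01).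
have dz : differentiable z t by apply: differentiable_mxE; exact: dc.
have Dz : 'D_1 z t = z1 t by rewrite /z1 derive_mxE//; exact: dc.
have [das asE] := is_derive1_asin rz.
have drz : differentiable (fun t => rho * z t) t by exact: dfM.
have das' : differentiable (@asin R) (rho * z t) by exact/derivable1_diffP.
have dasz : differentiable (fun t => asin (rho * z t)) t.
  exact: (differentiable_comp drz das').
apply: DeriveDef; first by apply: diff_derivable; exact: dfM.
rewrite derive_fM// derive_cst mulr0 addr0 (derive_comp1 _ drz das') asE.
by rewrite derive_fM// derive_cst mulr0 addr0 Dz /w1 [X in _ * X]mulrC.
Qed.

Let cw1 (t : R) : 0 < t < 1 -> {for t, continuous w1}.
Proof.
move=> t01; have rz := rz2 (le01 t01).
have cz : {for t, continuous z}.
  by apply: differentiable_continuous; apply: differentiable_mxE; exact: dc.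
have cz1 : {for t, continuous z1}.
  by apply: differentiable_continuous; apply: (differentiable_mxE (f := 'D_1 c)); exact: dc1.
apply: cvgM; first exact: cvg_cst.
apply: cvgM; last by apply: cvgM => //; exact: cvg_cst.
apply: cvgV; first by rewrite gt_eqF// sqrtr_gt0 subr_gt0.
apply: (@continuous_comp _ _ _ (fun t => 1 - (rho * z t) ^+ 2) Num.sqrt).
  apply: cvgB; first exact: cvg_cst.
  rewrite /GRing.exp/=; apply: cvgM; (apply: cvgM => //; exact: cvg_cst).
exact: sqrt_continuous.
Qed.

Let orth (t : R) : 0 < t < 1 -> c t 0 i30 * ('D_1 c t) 0 i30 +
  c t 0 i31 * ('D_1 c t) 0 i31 + c t 0 i32 * ('D_1 c t) 0 i32 = 0.
Proof.
move=> t01; have dci i : differentiable (fun t => c t 0 i) t.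
  by apply: differentiable_mxE; exact: dc.
have oI : open [set t : R | 0 < t < 1].
  by rewrite (_ : mkset _ = `]0, 1[%classic); [exact: interval_open|rewrite set_itvoo].
have : 'D_1 (fun t => c t 0 i30 * c t 0 i30 + c t 0 i31 * c t 0 i31 + c t 0 i32 * c t 0 i32) t = 0.
  rewrite -[RHS](derive_cst (1 : R) t (1 : R)); apply: near_eq_derive.
  apply: near_open oI t01 _ => x x01; have /S2E := Sc (le01 x01).
  by rewrite -!expr2.
rewrite derive_fD; [|apply: dfD; exact: dfM|exact: dfM].
rewrite derive_fD; [|exact: dfM|exact: dfM].
rewrite !derive_fM// -!(derive_mxE _ _ _ (dc t01)) => e.
lra.
Qed.

(** The bound on tangent vectors gives w'^2 (1 - rho^2 z^2) <= rho^2 (1 - z^2) h(c', c'), and rho^2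
    (1 - z^2) <= 1 - rho^2 z^2 because rho < 1. *)
Let w1_le (t : R) : 0 < t < 1 ->
  `|w1 t| <= Num.sqrt ((derive1 c t *m h (c t) *m (derive1 c t)^T) 0 0).
Proof.
move=> t01; rewrite derive1E; set v := 'D_1 c t.
have o := orth t01; have rz := rz2 (le01 t01); have S1 := Sc (le01 t01).
have zl := z_le1 (le01 t01).
have [z1E|zlt] := eqVneq (z t ^+ 2) 1.
  have : z1 t = 0.
    have /S2E := S1; rewrite -/(z t) z1E => e.
    have x0 : c t 0 i30 = 0 by nra.
    have y0 : c t 0 i31 = 0 by nra.
    move: o; rewrite x0 y0 !mul0r !add0r -/(z t) => /eqP; rewrite mulf_eq0 -sqrf_eq0.
    by rewrite z1E oner_eq0 /= => /eqP.
  by move=> e; rewrite /w1 e !mulr0 normr0 sqrtr_ge0.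
have zlt1 : c t 0 i32 ^+ 2 < 1 by rewrite lt_neqAle zlt.
have key := tangent_norm_ge S1 zlt1 o; rewrite -/(z t) -/(z1 t) in key zlt1.
set N := (v *m _ *m _) 0 0 in key *.
have N0 : 0 <= N.
  have k0 : 0 <= (1 - z t ^+ 2) * N by apply: le_trans key; rewrite mulr_ge0 ?sqr_ge0.
  by move: k0; rewrite pmulr_rge0// subr_gt0.
rewrite -sqrtr_sqr ler_wsqrtr// /w1.
have D0 : 0 < 1 - (rho * z t) ^+ 2 by rewrite subr_gt0.
rewrite exprMn [in X in _ * X]exprMn exprVn sqr_sqrtr ?(ltW D0)//.
rewrite mulrCA -ler_pdivlMl ?invr_gt0// invrK.
apply: (@le_trans _ _ (rho ^+ 2 * ((1 - z t ^+ 2) * N))).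
  by rewrite [X in _ * X <= _]exprMn [leLHS]mulrCA; exact: (ler_wpM2l (sqr_ge0 rho) key).
rewrite mulrA ler_wpM2r// exprMn.
have r2 : rho ^+ 2 < 1 by rewrite expr_lt1// ltW.
lra.
Qed.

(** The derivative of [w] is known, and continuous, in the open interval; the fundamental theorem of
    calculus is therefore applied on closed subintervals of it. The integral of |w'| is then
    compared with the length by monotonicity. *)
Let arc_sub (p q : R) : 0 < p -> p < q -> q < 1 -> ((w p - w q)%:E <= arc_length h c)%E.
Proof.
move=> p0 pq q1; have sub x : x \in `[p, q] -> 0 < x < 1.
  by rewrite in_itv/= => /andP[px xq]; rewrite (lt_le_trans p0)//= (le_lt_trans xq).
have ftc : (\int[@lebesgue_measure R]_(x in `[p, q]) (w1 x)%:E = (w q)%:E - (w p)%:E)%E.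
  apply: continuous_FTC2 => //.
  - by apply: continuous_in_subspaceT => x; rewrite inE => /sub; exact: cw1.
  - have cw x : x \in `[p, q] -> {for x, continuous w}.
      move=> /sub/dw[d _]; exact/differentiable_continuous/derivable1_diffP.
    split.
    + by move=> x; rewrite in_itv/= => /andP[px xq]; have [|] := dw (t := x) _ => //;
        rewrite (lt_trans p0)//= (lt_trans xq).
    + by apply: cvg_at_right_filter; apply: cw; rewrite in_itv/= lexx ltW.
    + by apply: cvg_at_left_filter; apply: cw; rewrite in_itv/= lexx ltW.
  - move=> x; rewrite in_itv/= => /andP[px xq]; rewrite derive1E.
    by have [|_ ->] := dw (t := x) _ => //; rewrite (lt_trans p0)//= (lt_trans xq).
have mw : measurable_fun `[p, q] (EFin \o w1).
  apply/measurable_EFinP; apply: subspace_continuous_measurable_fun => //.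
  by apply: continuous_in_subspaceT => x; rewrite inE => /sub; exact: cw1.
apply: (@le_trans _ _ `|(w q)%:E - (w p)%:E|%E).
  by rewrite -EFinB/= lee_fin -normrN opprB ler_norm.
rewrite -ftc; have le := le_abse_integral (@lebesgue_measure R) (measurable_itv `[p, q]) mw.
apply: le_trans le _.
rewrite /arc_length integral_mkcond [leRHS]integral_mkcond.
apply: ge0_le_integralT => x; rewrite !patchE; first by case: ifP.
case: ifPn => [|_]; last by case: ifP => // _; rewrite lee_fin sqrtr_ge0.
rewrite inE/= => /sub x01; rewrite mem_set/= ?in_itv//= lee_fin.
exact: w1_le.
Qed.

Lemma arc_length_ge : ((w 0 - w 1)%:E <= arc_length h c)%E.
Proof.
have a0 : (0 <= arc_length h c)%E.
  by apply: integral_ge0 => x _; rewrite lee_fin sqrtr_ge0.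
case lE : (arc_length h c) a0 => [l| |]//= l0; last by rewrite leey.
rewrite lee_fin.
(* At the end points, continuity comes from the local extensions of [c] that [smooth] provides; the
   bound on [x, 1 - x] then passes to the limit x -> 0. *)
have ends t : 0 <= t <= 1 -> exists2 F : R -> 'rV[R]_3, F t = c t /\ {for t, continuous F} &
    \forall x \near t, 0 <= x <= 1 -> F x = c x.
  move=> t01; have [B [F [oB Bt sF FE]]] := sc t01.
  exists F; first by split; [exact: FE|exact/differentiable_continuous/(smooth_open_diff sF)].
  by apply: near_open oB Bt _ => x Bx x01; exact: FE.
have wF t (F : R -> 'rV[R]_3) : 0 <= t <= 1 -> F t = c t -> {for t, continuous F} ->
    a / pi * asin (rho * F x 0 i32) @[x --> t] --> w t.
  move=> t01 Ft cF; apply: cvgM; first exact: cvg_cst.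
  have cz : rho * F x 0 i32 @[x --> t] --> rho * z t.
    apply: cvgM; first exact: cvg_cst.
    rewrite /z -Ft; apply: (@continuous_comp _ _ _ F (fun y : 'rV[R]_3 => y 0 i32)) => //.
    exact: coord_continuous.
  apply: (continuous_cvg _ _ cz); exact: continuous_asin (rz1 t01).
have [|F [F0 cF] nF] := ends 0; first by rewrite lexx ler01.
have [|G [G1 cG] nG] := ends 1; first by rewrite lexx ler01.
have cr : (1 - x : R) @[x --> (0 : R)] --> (1 : R).
  by rewrite -[X in _ --> X]subr0; apply: cvgB; [exact: cvg_cst|exact: cvg_id].
have nF0 : \forall x \near (0 : R)^'+, 0 <= x <= 1 -> F x = c x by exact: cvg_within nF.
have nG0 : \forall x \near (0 : R)^'+, 0 <= 1 - x <= 1 -> G (1 - x) = c (1 - x).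
  by apply: cvg_within; exact: cr nG.
have lF := wF _ _ _ F0 cF; have lG := cvg_comp _ _ cr (wF _ _ _ G1 cG).
have le0 : 0 <= (0 : R) <= 1 by rewrite lexx ler01.
have le1 : 0 <= (1 : R) <= 1 by rewrite lexx ler01.
apply: (cvgr_to_le (cvg_at_right_filter (cvgB (lF le0) (lG le1)))).
near=> x; have x0 : 0 < x by near: x; exact: nbhs_right_gt.
have x2 : x < 2^-1 by near: x; apply: nbhs_right_lt; rewrite invr_gt0.
rewrite /= (near nF0 x)//; last by apply/andP; split; lra.
rewrite [X in _ + X](_ : _ = - (a / pi * asin (rho * G (1 - x) 0 i32)))// (near nG0 x)//; last by apply/andP; split; lra.
by have := @arc_sub x (1 - x); rewrite lE lee_fin; apply; lra.
Unshelve. all: by end_near. Qed.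

End ArcLength.

Lemma curve_length_ge (rho : R) (cs : seq (R -> 'rV[R]_3)) (p q : 'rV[R]_3) :
  0 < rho -> rho < 1 -> piecewise_smooth_curve S2 cs p q ->
  ((a / pi * asin (rho * p 0 i32) - a / pi * asin (rho * q 0 i32))%:E <=
   \sum_(c <- cs) arc_length h c)%E.
Proof.
move=> rho0 rho1; elim: cs p => [p -> |c cs ih p]/=; first by rewrite big_nil subrr.
move=> [sc Sc <- /ih le]; rewrite big_cons.
have := leeD (arc_length_ge rho0 rho1 sc Sc) le; apply: le_trans.
by rewrite -EFinD lee_fin addrA subrK.
Qed.

Lemma riem_dist_poles : (a%:E <= riem_dist S2 h (polar a (row2 0 0)) (polar a (row2 a 0)))%E.
Proof.
apply: le_ereal_inf_tmp => _ [cs [pcs ->]].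
have pi0 := @pi_gt0 R.
have key (sg : R) : 0 < sg -> sg < 1 -> ((a * sg)%:E <= \sum_(c <- cs) arc_length h c)%E.
  (* With rho = sin y, the function asin (rho z) goes from y to - y between the poles, and (a / pi)
     2 y = a sg. The condition rho < 1 corresponds to sg < 1, so that a itself is only
     approached. *)
  move=> sg0 sg1; pose y : R := pi / 2 * sg.
  have y0 : 0 < y by rewrite mulr_gt0// divr_gt0.
  have y1 : y < pi / 2 by rewrite gtr_pMr// divr_gt0.
  have s0 : 0 < sin y by apply: sin_gt0_pi; rewrite y0/=; lra.
  have s1 : sin y < 1.
    have c0 : 0 < cos y by apply: cos_gt0_pihalf; apply/andP; split; lra.
    by have := cos2Dsin2 y; nra.
  have asE : asin (sin y) = y by apply: sinK; rewrite in_itv/=; apply/andP; split; lra.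
  have := curve_length_ge s0 s1 pcs; apply: le_trans; rewrite lee_fin.
  rewrite !polar_z !row2E mulr0 mul0r cos0 mulfK ?gt_eqF// cospi mulr1 mulrN1 -sinN.
  rewrite asE sinK; last by rewrite in_itv/=; apply/andP; split; lra.
  rewrite /y; apply: eq_lerW; move: (pi : R) pi0 => P P0; field; by rewrite gt_eqF.
case E : (\sum_(c <- cs) arc_length h c)%E key => [l| |] key; last first.
- have k0 : 0 < 2^-1 :> R by lra.
  have k1 : 2^-1 < 1 :> R by lra.
  by have := key _ k0 k1; rewrite leeNy_eq.
- by rewrite leey.
rewrite lee_fin leNgt; apply/negP => la.
have [l0|l0] := lerP l 0.
  have := key 2^-1; rewrite lee_fin => H; have : a * 2^-1 <= l by apply: H; lra.
  have a0 := a_gt0; lra.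
(* For the midpoint of l / a and 1, the lower bound for the length is (l + a) / 2 > l. *)
have := key ((l / a + 1) / 2); rewrite lee_fin => H.
have a0 := a_gt0.
have la1 : l / a < 1 by rewrite ltr_pdivrMr// mul1r.
have la0 : 0 < l / a by rewrite divr_gt0.
have : a * ((l / a + 1) / 2) <= l by apply: H; lra.
rewrite mulrA mulrDr mulr1 mulrCA mulfV ?gt_eqF// mulr1; lra.
Qed.

Lemma diam_rot_sym : Diam S2 h = a%:E.
Proof.
apply/eqP; rewrite eq_le; apply/andP; split.
  by apply: ge_ereal_sup => _ [p [q [Sp Sq ->]]]; exact: riem_dist_le.
apply: le_trans riem_dist_poles _; apply: ereal_sup_ubound => /=.
exists (polar a (row2 0 0)), (polar a (row2 a 0)); split=> //; exact: polar_S2.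
Qed.

End Diameter.

Theorem theorem1p2 (R : realType) (V0 A0 : R) (V0_gt0 : 0 < V0)
    (A0_gt0 : 0 < A0) :
  exists C : R, 0 < C /\
    forall (a : nat -> R) (u : nat -> R -> R)
           (h : nat -> 'rV[R]_3 -> 'M[R]_3) (phi : nat -> 'rV[R]_3 -> R)
           (g : nat -> 'rV[R]_(3 + 2) -> 'M[R]_(3 + 2)),
    (forall i, rot_sym_metric (a i) (u i) (h i)) ->
    (forall i, smooth S2 (phi i) /\ forall p, S2 p -> 0 < phi i p) ->
    (forall i, g i = warped (phi i) (h i)) ->
    (forall i, riemannian_metric 3 S2xS1 (g i)) ->
    (forall i, scalar_ge0 3 S2xS1 (g i)) ->
    (forall i V, has_volume 3 (g i) S2xS1 V -> (V <= V0%:E)%E) ->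
    (forall i, (A0%:E <= MinA S2xS1 (g i))%E) ->
    forall i, [/\ Diam S2 (h i) = (a i)%:E, C^-1 <= a i & a i <= C].
Proof.
exists (diam_bound V0 A0); split; first exact: diam_bound_gt0.
move=> a u h phi g rs sphi gE _ sc vol mA i.
have [sp pp] := sphi i; have [lo up] : (diam_bound V0 A0)^-1 <= a i /\ a i <= diam_bound V0 A0.
  apply: (a_bounds (rs i) sp pp V0_gt0 A0_gt0); rewrite -gE => //; exact: vol.
by split=> //; exact: diam_rot_sym (rs i).
Qed.
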